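(* Let $d\ge 1$, let $h$ be the ballistic deposition process on $\mathbb{Z}^d$, and let $w(t,x) := h(t,x)-h(t,0)$. The process $\{w(t,\cdot)\}_{t\ge 0}$ is a time-homogeneous Markov process on $\Omega=\mathbb{Z}^{\mathbb{Z}^d}$ with at least one stationary probability distribution. The stationary distribution can be chosen such that the height at each location has finite $L^1$ norm (that is, if $g$ is drawn from it, then $\mathbb{E}|g(x)|<\infty$ for every $x\in\mathbb{Z}^d$). Equivalently, the gradient process $\{\delta h(t,\cdot)\}_{t\ge 0}$ is a Markov process with at least one stationary probability distribution, where $\delta h(t,x) := (h(t,x+e_i)-h(t,x),\ i=1,\ldots,d)$. Moreover, the stationary distribution of the gradient process can be chosen to be translation invariant on the lattice, as well as invariant under lattice symmetries, and with finite $L^1$ norm at each site.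
   Context: Fix an integer $d\ge 1$. Let $\Omega := \mathbb{Z}^{\mathbb{Z}^d}$ with the product topology ($\mathbb{Z}$ discrete) and its Borel $\sigma$-algebra; $e_1,\ldots,e_d$ are the standard basis vectors. Ballistic deposition: at each site $x\in\mathbb{Z}^d$ there is a Poisson clock of rate $1$ on $[0,\infty)$, the clocks being independent. Given an initial condition $h(0,\cdot)\in\Omega$, whenever the clock at $x$ rings at a time $t$, the height at $x$ is instantaneously updated to $$\max\Bigl\{\max_{1\le i\le d} h(t,x\pm e_i),\ h(t,x)+1\Bigr\}$$ (the inner maximum is over all $i$ and both signs), and this is the value of $h(s,x)$ for all $s\in(t,t']$, where $t'$ is the next ringing time of the clock at $x$. Precisely: for finite $D\subseteq\mathbb{Z}^d$ one performs only the updates at sites of $D$, in temporal order; the resulting heights are nondecreasing in $D$, and $h(t,x)$ is the limit as $D\uparrow\mathbb{Z}^d$, which is almost surely finite. A stationary (invariant) probability distribution of a Markov process is a probability measure $\mu$ on the state space such that if the initial state has law $\mu$ (independent of the clocks), then the state at each time $t\ge0$ has law $\mu$. The state space of the gradient process is the set of gradient fields $\delta f$, $f\in\Omega$, where $\delta f(x) := (f(x+e_i)-f(x))_{1\le i\le d}$. Translation invariance of the law of a random gradient field $\delta g$ means that $\delta g(\cdot+y)$ has the same law as $\delta g$ for each $y\in\mathbb{Z}^d$; invariance under lattice symmetries means that $\delta(g\circ\sigma)$ has the same law as $\delta g$ for every $\sigma$ in the group of symmetries of $\mathbb{Z}^d$ fixing $0$ (permutations and sign changes of coordinates). *)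

(* Defs.v *)
From HB Require Import structures.
From mathcomp Require Import all_boot all_order all_algebra.
From mathcomp Require Import finmap.
From mathcomp Require Import all_fingroup.
From mathcomp Require Import all_classical all_reals all_analysis.

Set Implicit Arguments.
Unset Strict Implicit.
Unset Printing Implicit Defensive.

Import Order.TTheory GRing.Theory Num.Theory.
Import numFieldNormedType.Exports.

Local Open Scope classical_set_scope.
Local Open Scope ring_scope.

Definition site (d : nat) := 'rV[int]_d.

Definition unit_vec (d : nat) (i : 'I_d) : site d := delta_mx 0 i.

(* Omega = Z^(Z^d) with the Borel sigma-algebra of its product topology. *)
Definition field_space (d : nat) := {ptws site d -> discrete_topology int}.

HB.instance Definition _ (d : nat) := Topological.on (field_space d).
HB.instance Definition _ (d : nat) :=
  isPointed.Build (field_space d) (fun=> 0 : int).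

Definition field (d : nat) := g_sigma_algebraType (@open (field_space d)).

HB.instance Definition _ (d : nat) := Measurable.on (field d).

Definition delta (d : nat) (f : site d -> int) :
    {ptws site d -> {ptws 'I_d -> discrete_topology int}} :=
  fun x i => f (x + unit_vec i) - f x.

Definition gradient_space (d : nat) := set_type (range (@delta d)).

HB.instance Definition _ (d : nat) := Topological.on (gradient_space d).

Definition grad_def (d : nat) (f : site d -> int) : gradient_space d :=
  exist _ (delta f) (mem_set (imageT (@delta d) f)).

HB.instance Definition _ (d : nat) :=
  isPointed.Build (gradient_space d) (grad_def (fun=> 0)).

Definition gradient_field (d : nat) :=
  g_sigma_algebraType (@open (gradient_space d)).

HB.instance Definition _ (d : nat) := Measurable.on (gradient_field d).

Definition grad (d : nat) (f : field d) : gradient_field d := grad_def f.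

Definition slope (d : nat) (v : gradient_field d) (x : site d) (i : 'I_d) : int :=
  sval v x i.

(* The starting value f x + 1 of the big max is one of the competing heights. *)
Definition update (d : nat) (f : site d -> int) (x : site d) : site d -> int :=
  fun y =>
    if y == x then
      \big[Num.max/f x + 1]_(i < d)
        Num.max (f (x + unit_vec i)) (f (x - unit_vec i))
    else f y.

Section ballistic_deposition.
Context {R : realType} {d : nat}.
Implicit Types (gaps : site d -> nat -> R) (f : site d -> int) (D : {fset site d}).

(* gaps x n is the time between the n-th ring of the clock at x (time 0 when
   n = 0) and the next one. *)
Definition ring_time gaps (x : site d) (n : nat) : R :=
  \sum_(k < n.+1) gaps x k.

(* The inequality at t is strict: the update made at a ringing time s is
   visible only at times t > s. *)
Definition rings_before gaps D (t : R) : set (site d * nat) :=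
  [set p | p.1 \in D /\ 0 <= ring_time gaps p.1 p.2 < t].

(* fset_set of an infinite set is empty, but almost surely rings_before is
   finite and the ringing times are distinct. *)
Definition finite_height gaps f D (t : R) : site d -> int :=
  foldl (fun g p => update g p.1) f
    (sort (fun p q => ring_time gaps p.1 p.2 <= ring_time gaps q.1 q.2)
       (fset_set (rings_before gaps D t))).

(* A limit of integers is an eventually constant value; on the null event where
   the limit as D increases to Z^d is not finite, the value is 0. *)
Definition height gaps f (t : R) : field d :=
  fun x => xget 0 [set v : int | exists D0 : {fset site d},
    forall D, (D0 `<=` D)%fset -> finite_height gaps f D t x = v].

Definition recentred_height gaps f (t : R) : field d :=
  fun x => height gaps f t x - height gaps f t 0.

Definition gradient_height gaps f (t : R) : gradient_field d :=
  grad (height gaps f t).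

End ballistic_deposition.

Section laws.
Context {R : realType} {dT : measure_display} {T : measurableType dT}.
Context {dE : measure_display} {E : measurableType dE}.

Definition has_law (M : set T -> \bar R) (X : T -> E) (mu : set E -> \bar R) :=
  measurable_fun setT X /\
  forall A : set E, measurable A -> M (X @^-1` A) = mu A.

Definition transition_semigroup (K : R -> R.-pker E ~> E) :=
  (forall (x : E) (A : set E), measurable A -> K 0 x A = \d_x A) /\
  forall (s t : R) (x : E) (A : set E), 0 <= s -> 0 <= t -> measurable A ->
    K (s + t) x A = (\int[K s x]_y K t y A)%E.

Definition history (X : R -> T -> E) (s : R) : set (set T) :=
  <<s [set B | exists r A, [/\ 0 <= r <= s, measurable A & B = X r @^-1` A]] >>.

(* The Markov property with respect to the natural filtration of X:
   K t (X s) A is a version of the conditional probability of X (s + t) \in A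
   given the history up to time s. *)
Definition markov_process (M : {measure set T -> \bar R}) (X : R -> T -> E)
    (K : R -> R.-pker E ~> E) :=
  (forall t : R, 0 <= t -> measurable_fun setT (X t)) /\
  forall (s t : R) (B : set T) (A : set E), 0 <= s -> 0 <= t ->
    history X s B -> measurable A ->
    M (B `&` X (s + t) @^-1` A) = (\int[M]_(p in B) K t (X s p) A)%E.

End laws.

Definition mutually_independent (R : realType) (dT : measure_display)
    (T : measurableType dT) (P : probability T R) (I : choiceType)
    (X : I -> T -> R) :=
  forall (J : {fset I}) (B : I -> set R), (forall i, measurable (B i)) ->
    P (\bigcap_(i in [set` J]) X i @^-1` B i) =
    (\prod_(i <- J) P (X i @^-1` B i))%E.

(* Independent rate-1 Poisson clocks, through their waiting times. *)
Definition poisson_clocks (R : realType) (d : nat) (dT : measure_display)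
    (T : measurableType dT) (P : probability T R)
    (gap : site d -> nat -> T -> R) :=
  (forall x n, has_law P (gap x n) (exponential_prob (1 : R))) /\
  mutually_independent P (fun p : site d * nat => gap p.1 p.2).

Definition finite_expectation (R : realType) (dE : measure_display)
    (E : measurableType dE) (mu : probability E R) (X : E -> int) : Prop :=
  (\int[mu]_g `|(X g)%:~R : R|%:E < +oo)%E.

Section process.
Context {R : realType} {d : nat} {dT : measure_display} {T : measurableType dT}.
Variable gap : site d -> nat -> T -> R.

(* A sample point is a pair (initial condition, outcome of the clocks); under
   rho \x P the initial condition has law rho and is independent of the
   clocks. *)
Definition w_process (t : R) (p : field d * T) : field d :=
  recentred_height (fun x n => gap x n p.2) p.1 t.

Definition gradient_process (t : R) (p : field d * T) : gradient_field d :=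
  gradient_height (fun x n => gap x n p.2) p.1 t.

End process.

Section markov_and_stationary.
Context {R : realType} {d : nat} {dT : measure_display} {T : measurableType dT}.
Context {dE : measure_display} {E : measurableType dE}.
Variable P : probability T R.

Definition time_homogeneous_markov (X : R -> field d * T -> E) :=
  exists K : R -> R.-pker E ~> E, transition_semigroup K /\
    forall rho : probability (field d) R, markov_process (rho \x P)%E X K.

(* The first clause is needed since not every law on E need be the law of an
   initial state X 0: in the case of w, only those carried by the fields
   vanishing at the origin are. *)
Definition stationary (X : R -> field d * T -> E) (mu : probability E R) :=
  (exists rho : probability (field d) R, has_law (rho \x P)%E (X 0) mu) /\
  forall rho : probability (field d) R, has_law (rho \x P)%E (X 0) mu ->
    forall t : R, 0 <= t -> has_law (rho \x P)%E (X t) mu.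

End markov_and_stationary.

(* If the random field g is such that grad g has law nu, then so does the
   gradient of g \o phi. Every nu is the law of grad g for some g. *)
Definition invariant_under (R : realType) (d : nat)
    (nu : probability (gradient_field d) R) (phi : site d -> site d) :=
  forall rho : probability (field d) R, has_law rho (@grad d) nu ->
    has_law rho (fun g : field d => grad (g \o phi)) nu.

(* delta (g \o phi) x = delta g (x + y) for the translation phi by y. *)
Definition translation_invariant (R : realType) (d : nat)
    (nu : probability (gradient_field d) R) :=
  forall y : site d, invariant_under nu (fun x => x + y).

Definition lattice_symmetry (d : nat) (s : {perm 'I_d}) (eps : 'I_d -> bool)
    (x : site d) : site d :=
  \row_i ((-1) ^+ eps i * x 0 (s i)).

Definition symmetry_invariant (R : realType) (d : nat)
    (nu : probability (gradient_field d) R) :=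
  forall (s : {perm 'I_d}) (eps : 'I_d -> bool),
    invariant_under nu (lattice_symmetry s eps).

(* Main.v *)
(** The height at [x] started from the flat field is at most the length of some
    chain of updates leading back from [x]. Over a short time such chains are
    subcritical, so the height at [x] almost surely depends on finitely many
    sites, and its mean grows at most linearly in time. Whenever the clock at [x]
    rings, [x] catches up with each neighbour [y], so the mean height at [x] grows
    at a rate proportional to the mean of [(h y - h x)^+]; hence the time averages
    of the mean gradients are bounded. The time averages of the laws of the
    recentred heights are therefore tight with bounded first moments, and an
    ultralimit of them is a probability measure. It is invariant since the
    transition maps are uniform limits of maps depending on finitely many sites,
    it inherits the moment bound, and it inherits the symmetries of the flat
    initial condition and of the clocks. The Markov property comes from the
    memorylessness of the exponential law: the clocks after time [s] can be
    replaced by independent fresh ones. *)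

From HB Require Import structures.
Require Import Defs.
From mathcomp Require Import all_boot all_order all_algebra.
From mathcomp Require Import finmap all_fingroup.
From mathcomp Require Import all_classical all_reals all_analysis measurable_realfun.
From mathcomp Require Import zify ring lra.

Set Implicit Arguments.
Unset Strict Implicit.
Unset Printing Implicit Defensive.
Import Order.TTheory GRing.Theory Num.Theory.
Import numFieldNormedType.Exports.
Local Open Scope classical_set_scope.
Local Open Scope ring_scope.

(** * Updates and chains of updates *)

(** The heights are unbounded and the initial law is arbitrary, so continuity in the initial field
    has to come from the clocks alone: [finitely_influenced] asks for one finite set of sites that
    serves every initial condition. Chains of updates provide it for short times only, and gluing
    clock configurations extends it to all times. The same gluing, whose law is computed once in
    [iid_glue], underlies the growth bound, the Markov property and invariance. Clocks are therefore
    treated as points of [config], and the given probability space is reduced to its image law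
    there. Time averages run over [(n+1)^2] grid points with mesh [short_time / (n+1)]: the horizon
    tends to infinity, the mesh to zero, and finite sums replace integrals over time. An ultrafilter
    gives limits for all finitely determined events at once, so that finite additivity, tail sums
    and symmetries pass to the limit. Only countable additivity is at stake, because the space of
    fields is not compact; this is where tightness enters. *)

Section updates.
Variable d : nat.
Implicit Types (x y : site d) (f : site d -> int) (l s : seq (site d)).

Definition nbrs x : seq (site d) :=
  codom (fun i => x + unit_vec i) ++ codom (fun i => x - unit_vec i).

Definition lazy_nbrs x : seq (site d) := x :: nbrs x.

Lemma size_lazy_nbrs x : size (lazy_nbrs x) = (d + d).+1.
Proof. by rewrite /= /nbrs size_cat !size_codom card_ord. Qed.

Lemma nbrsD x i : x + unit_vec i \in nbrs x.
Proof. by rewrite mem_cat codom_f. Qed.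

Lemma nbrsB x i : x - unit_vec i \in nbrs x.
Proof. by rewrite mem_cat orbC codom_f. Qed.

Lemma nbrsP x y :
  reflect (exists i, y = x + unit_vec i \/ y = x - unit_vec i) (y \in nbrs x).
Proof.
apply: (iffP idP) => [|[i [->|->]]]; rewrite ?nbrsD ?nbrsB//.
by rewrite mem_cat => /orP[|] /codomP[i ->]; exists i; [left|right].
Qed.

Lemma update_neq f x y : y != x -> update f x y = f y.
Proof. by rewrite /update => /negbTE ->. Qed.

Lemma update_id f x : update f x x =
  \big[Num.max/f x + 1]_(i < d) Num.max (f (x + unit_vec i)) (f (x - unit_vec i)).
Proof. by rewrite /update eqxx. Qed.

(** Testing the maximum against an arbitrary bound gives a conjunction over [nbrs]. Later identities
    between updated heights then follow by antisymmetry, without unfolding the iterated maximum. *)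
Lemma update_le f x (v : int) : (update f x x <= v) =
  (f x + 1 <= v) && all (fun y => f y <= v) (nbrs x).
Proof.
rewrite update_id /nbrs all_cat !all_map /index_enum -enumT.
elim: (fintype.enum 'I_d) => [|i r IH]; first by rewrite big_nil !andbT.
by rewrite big_cons !ge_max IH /=; lia.
Qed.

Lemma update_incr f x : f x + 1 <= update f x x.
Proof. by have := lexx (update f x x); rewrite update_le => /andP[]. Qed.

Lemma update_nbr f x y : y \in nbrs x -> f y <= update f x x.
Proof.
by have := lexx (update f x x); rewrite update_le => /andP[_ /allP]; apply.
Qed.

(** One less than the maximum is not an upper bound, so some competing height exceeds it. The form
    [f y + 1] covers both the site itself, where it is exact, and a neighbour, where it may lose 1;
    thus each step of a walk costs at most 1. *)
Lemma update_attained f x :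
  exists2 y, y \in lazy_nbrs x & update f x x <= f y + 1.
Proof.
have : update f x x - 1 < update f x x by lia.
rewrite ltNge update_le negb_and => /orP[|/allPn[y yx]].
  by exists x; [rewrite mem_head|lia].
by exists y; [rewrite in_cons yx orbT|lia].
Qed.

Lemma update_eq (f1 f2 : site d -> int) x :
  {in lazy_nbrs x, f1 =1 f2} -> update f1 x x = update f2 x x.
Proof.
move=> H; apply/eqP; rewrite eq_le !update_le !H ?mem_head// update_incr /=.
by apply/andP; split; [|rewrite -H ?mem_head// update_incr /=];
  apply/allP => y yx; [rewrite H|rewrite -H]; rewrite ?update_nbr// in_cons yx orbT.
Qed.

Lemma update_ge f x y : f y <= update f x y.
Proof.
by case: (eqVneq y x) => [->|/update_neq-> //]; have := update_incr f x; lia.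
Qed.

Definition run f l := foldl (@update d) f l.

Lemma run_rcons f l x : run f (rcons l x) = update (run f l) x.
Proof. by rewrite /run -cats1 foldl_cat. Qed.

Lemma run_cat f l s : run f (l ++ s) = run (run f l) s.
Proof. by rewrite /run foldl_cat. Qed.

Lemma run_ge f l x : f x <= run f l x.
Proof.
elim/last_ind: l => // l y IH; rewrite run_rcons.
exact: le_trans IH (update_ge _ _ _).
Qed.

Lemma run_notin f l x : x \notin l -> run f l x = f x.
Proof.
elim/last_ind: l => // l y IH; rewrite mem_rcons in_cons negb_or => /andP[xy xl].
by rewrite run_rcons update_neq ?IH.
Qed.

Lemma run_nbr f l x y : x \in l -> y \in nbrs x -> f y <= run f l x.
Proof.
move=> + yx; elim/last_ind: l => // l z IH; rewrite mem_rcons in_cons run_rcons.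
case: (eqVneq x z) => [<- _|xz /IH]; last by rewrite update_neq.
exact: le_trans (run_ge f l y) (update_nbr _ yx).
Qed.

Lemma run_shift f l (c : int) :
  run (fun x => f x + c) l = (fun x => run f l x + c).
Proof.
elim/last_ind: l => // l y IH; rewrite !run_rcons IH; apply/funext => x.
case: (eqVneq x y) => [->|xy]; last by rewrite !update_neq.
apply/eqP; rewrite eq_le -lerBrDr !update_le; apply/andP; split.
  rewrite -addrA (addrC c) addrA lerD2r update_incr; apply/allP => z zy.
  by rewrite lerD2r update_nbr.
apply/andP; split.
  have := update_incr (fun x => run f l x + c) y; lia.
by apply/allP => z zy; rewrite lerBrDr (@update_nbr (fun x => run f l x + c)).
Qed.

(** An update reads only the lazy neighbourhood of its site. The list of sites is crude, but it is
    finite and does not depend on the fields, which is what measurability, gluing and approximation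
    require. *)
Lemma run_eq_on (f1 f2 : site d -> int) l x :
  (forall y, y \in x :: flatten [seq lazy_nbrs z | z <- l] -> f1 y = f2 y) ->
  run f1 l x = run f2 l x.
Proof.
elim/last_ind: l x => [|l z IH] x H; first by rewrite /= H ?mem_head.
rewrite !run_rcons.
have sub y : y \in flatten [seq lazy_nbrs z0 | z0 <- l] -> f1 y = f2 y.
  move=> yl; apply: H; rewrite in_cons map_rcons -cats1 flatten_cat mem_cat.
  by rewrite yl orbT.
case: (eqVneq x z) => [->|xz].
  apply: update_eq => y yz; apply: IH => u; rewrite in_cons => /orP[/eqP->|/sub//].
  apply: H; rewrite in_cons map_rcons -cats1 flatten_cat mem_cat /= cats0.
  by rewrite yz !orbT.
rewrite !update_neq//; apply: IH => u; rewrite in_cons => /orP[/eqP->|/sub//].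
by apply: H; rewrite mem_head.
Qed.

Definition graph_automorphism (phi : site d -> site d) :=
  bijective phi /\ forall x, map phi (nbrs x) =i nbrs (phi x).

(** An update sees the lattice only through [nbrs], which [phi] preserves. *)
Lemma run_automorphism phi f l : graph_automorphism phi ->
  run (f \o phi) l = run f (map phi l) \o phi.
Proof.
move=> [bphi phin]; elim/last_ind: l => // l y IH.
rewrite map_rcons !run_rcons IH; apply/funext => x /=.
case: (eqVneq x y) => [->|xy]; last first.
  by rewrite !update_neq// (inj_eq (bij_inj bphi)).
apply/eqP; rewrite eq_le !update_le /= update_incr /=; apply/andP; split.
  by apply/allP => z zy; rewrite update_nbr// -phin map_f.
rewrite (update_incr (run f (map phi l) \o phi)) /=.
apply/allP => z; rewrite -phin => /mapP[u uy ->].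
exact: (@update_nbr (run f (map phi l) \o phi)).
Qed.

(* The [k]-step lazy walks from [x], without their starting point. *)
Fixpoint walks (k : nat) x : seq (seq (site d)) :=
  if k is k'.+1
  then flatten [seq map (cons y) (walks k' y) | y <- lazy_nbrs x]
  else [:: [::]].

Lemma walksS k x :
  walks k.+1 x = flatten [seq map (cons y) (walks k y) | y <- lazy_nbrs x].
Proof. by []. Qed.

Lemma walksSP k x w :
  reflect (exists y w', [/\ y \in lazy_nbrs x, w' \in walks k y & w = y :: w'])
    (w \in walks k.+1 x).
Proof.
rewrite walksS; apply: (iffP flatten_mapP) => [[y yx /mapP[w' ? ->]]|].
  by exists y, w'.
by move=> [y [w' [yx w'y ->]]]; exists y => //; apply: map_f.
Qed.

Lemma size_walk k x w : w \in walks k x -> size w = k.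
Proof.
elim: k x w => [|k IH] x w; first by rewrite inE => /eqP->.
by move=> /walksSP[y [w' [_ /IH <- ->]]].
Qed.

Lemma size_walks k x : size (walks k x) = ((d + d).+1 ^ k)%N.
Proof.
elim: k x => // k IH x; rewrite walksS size_flatten /shape -map_comp.
rewrite (eq_map (g := fun=> ((d + d).+1 ^ k)%N)); last first.
  by move=> y /=; rewrite size_map IH.
rewrite expnS; set c := (_ ^ k)%N; rewrite -(size_lazy_nbrs x).
by elim: (lazy_nbrs x) => //= y r ->; rewrite mulSn.
Qed.

(* Following backwards in time the site that attained each maximum produces a
   walk, whose sites were updated in that order. *)
Lemma run_le_walk f l x : exists k w, [/\ w \in walks k x,
  subseq (belast x w) (rev l) & run f l x <= f (last x w) + k%:Z].
Proof.
elim/last_ind: l x => [|l z IH] x.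
  by exists 0%N, [::]; rewrite inE /= addr0.
rewrite rev_rcons run_rcons; case: (eqVneq x z) => [->|xz].
  have [y yz Hy] := update_attained (run f l) z.
  have [k [w [wk ws H]]] := IH y.
  exists k.+1, (y :: w); split.
  - by apply/walksSP; exists y, w.
  - by rewrite /= eqxx.
  - by apply: le_trans Hy _ => /=; lia.
have [k [w [wk ws H]]] := IH x.
exists k, w; split => //; last by rewrite update_neq.
exact: subseq_trans ws (subseq_cons _ _).
Qed.

Lemma walks_neq0 k x : exists w, w \in walks k x.
Proof.
elim: k x => [|k IH] x; first by exists [::]; rewrite inE.
have [w wx] := IH x; exists (x :: w); apply/walksSP.
by exists x, w; rewrite mem_head.
Qed.

(** Read backwards in time from [x], a dropped update can matter only at the end of a chain of
    updates that leaves [D]. Induction on the list from its end: an update at [x] spends one step of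
    the walk and passes to the lazy neighbours with a smaller [k], any other update is skipped. The
    budget cannot run out, since at [k = 0] the second hypothesis fails for the empty chain. *)
Lemma run_filter f (D : {pred site d}) k l x :
  (forall w, w \in walks k x -> {subset belast x w <= D}) ->
  (forall w, w \in walks k x -> ~~ subseq (belast x w) (rev l)) ->
  run f [seq y <- l | y \in D] x = run f l x.
Proof.
elim/last_ind: l k x => // l z IH [|k] x HD Hw.
  by have := Hw [::]; rewrite inE /= eqxx sub0seq => /(_ isT).
have xD : x \in D.
  have [w wx] := walks_neq0 k x.
  apply: (HD (x :: w)); last by rewrite mem_head.
  by apply/walksSP; exists x, w; rewrite mem_head.
rewrite filter_rcons run_rcons.
case: (eqVneq x z) => [xz|xz].
  subst z; rewrite ifT// run_rcons; apply: update_eq => y yx.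
  apply: (IH k) => w wy.
  - move=> u uw; apply: (HD (y :: w)); first by apply/walksSP; exists y, w.
    by rewrite /= in_cons uw orbT.
  - apply: contra (Hw (y :: w) _); last by apply/walksSP; exists y, w.
    by rewrite rev_rcons /= eqxx.
rewrite [RHS]update_neq//.
have IH' : run f [seq y <- l | y \in D] x = run f l x.
  apply: (IH k.+1) => // w /Hw; apply: contra => H.
  by rewrite rev_rcons; apply: subseq_trans H (subseq_cons _ _).
by case: ifP => _; rewrite ?run_rcons ?update_neq.
Qed.

End updates.

(** * Gluing clocks at a given time *)

Section partial_sums.
Variable R : realType.
Implicit Types a b : nat -> R.

Definition psum a n : R := \sum_(k < n.+1) a k.

Lemma psum0 a : psum a 0 = a 0%N.
Proof. by rewrite /psum big_ord1. Qed.

Lemma psumSr a n : psum a n.+1 = psum a n + a n.+1.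
Proof. by rewrite /psum big_ord_recr. Qed.

Lemma psumS a n : psum a n.+1 = a 0%N + psum (a \o S) n.
Proof. by rewrite /psum big_ord_recl. Qed.

Lemma psum_lt a m n : (forall k, 0 < a k) -> (m < n)%N -> psum a m < psum a n.
Proof.
move=> a0; elim: n => // n IH; rewrite ltnS leq_eqVlt => /orP[/eqP->|/IH mn].
  by rewrite psumSr ltrDl.
by apply: lt_trans mn _; rewrite psumSr ltrDl.
Qed.

Lemma psum_ge a n : (forall k, 0 < a k) -> a n <= psum a n.
Proof.
by case: n => [|n] a0; rewrite ?psum0// psumSr lerDr sumr_ge0// => i _; exact: ltW.
Qed.

(* The gap sequence of the clock that rings as [a] before time [s] and from then
   on as [b] restarted at time [s]. *)
Fixpoint glue_seq (n : nat) (s : R) a b : R :=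
  if s <= a 0%N then (if n is 0%N then s + b 0%N else b n)
  else (if n is m.+1 then glue_seq m (s - a 0%N) (a \o S) b else a 0%N).

(** [N] counts the rings of [a] strictly before [s]. A ring of [a] exactly at [s] is discarded, in
    accordance with the strict inequality in [rings_before]; from index [N] on, the clock is [b]
    delayed by [s]. *)
Lemma glue_seqP s a b : (forall k, 0 < a k) -> (exists n, s <= psum a n) ->
  exists N, (forall n, (n < N)%N ->
      psum a n < s /\ psum (fun k => glue_seq k s a b) n = psum a n) /\
    forall n, s <= psum a (N + n) /\
      psum (fun k => glue_seq k s a b) (N + n) = s + psum b n.
Proof.
move=> + [n]; elim: n s a => [|n IH] s a a0; case: (leP s (a 0%N)) => sa H.
- exists 0%N; split => // m; rewrite add0n; split.
    by case: m => [|m]; rewrite ?psum0// (le_trans sa)// ltW// -psum0 psum_lt.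
  have -> : (fun k => glue_seq k s a b) = (fun k => if k is 0%N then s + b 0%N else b k).
    by apply/funext => -[|k] /=; rewrite sa.
  by case: m => [|m]; rewrite ?psum0// !psumS addrA.
- by move: H; rewrite psum0 leNgt sa.
- exists 0%N; split => // m; rewrite add0n; split.
    by case: m => [|m]; rewrite ?psum0// (le_trans sa)// ltW// -psum0 psum_lt.
  have -> : (fun k => glue_seq k s a b) = (fun k => if k is 0%N then s + b 0%N else b k).
    by apply/funext => -[|k] /=; rewrite sa.
  by case: m => [|m]; rewrite ?psum0// !psumS addrA.
- have [|N [H1 H2]] := IH (s - a 0%N) (a \o S) (fun k => a0 k.+1).
    by rewrite lerBlDl -psumS.
  have E0 : (fun k => glue_seq k s a b) 0%N = a 0%N by rewrite /= leNgt sa.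
  have E1 : (fun k => glue_seq k s a b) \o S =
      (fun k => glue_seq k (s - a 0%N) (a \o S) b).
    by apply/funext => k /=; rewrite leNgt sa.
  exists N.+1; split => [[|m]|m].
  + by rewrite !psum0 E0.
  + rewrite ltnS => /H1 [mN e].
    by rewrite [psum (fun k => _) _]psumS psumS E0 E1 e -ltrBrDl.
  + have [h1 h2] := H2 m; rewrite addSn; split.
      by rewrite psumS -lerBlDl.
    by rewrite psumS E0 E1 h2 addrA subrKC.
Qed.

End partial_sums.

(** * Rings of the clocks in temporal order *)

Section ring_lists.
Context {R : realType} {d : nat}.
Implicit Types (g : site d -> nat -> R) (D : {fset site d}) (t s : R).
Implicit Types (f : site d -> int) (p : site d * nat).

Definition ring_list g D t : seq (site d * nat) :=
  sort (fun p q => ring_time g p.1 p.2 <= ring_time g q.1 q.2)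
    (fset_set (rings_before g D t)).

Definition updates g D t : seq (site d) := map fst (ring_list g D t).

Lemma finite_heightE g f D t : finite_height g f D t = run f (updates g D t).
Proof.
rewrite /finite_height /run /updates /ring_list.
by elim: (sort _ _) f => //= p l IH f; rewrite IH.
Qed.

Definition earlier g : rel (site d * nat) :=
  fun p q => ring_time g p.1 p.2 < ring_time g q.1 q.2.

Definition regular g :=
  [/\ forall x n, 0 < g x n,
      forall x t, exists n, t <= ring_time g x n &
      forall p q, ring_time g p.1 p.2 = ring_time g q.1 q.2 -> p = q].

Lemma ring_timeE g x n : ring_time g x n = psum (g x) n. Proof. by []. Qed.

Lemma earlier_trans g : transitive (earlier g).
Proof. by move=> y x z; exact: lt_trans. Qed.

Lemma earlier_irr g : irreflexive (earlier g).
Proof. by move=> x; exact: ltxx. Qed.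

Lemma ring_time_gt0 g x n : (forall x n, 0 < g x n) -> 0 < ring_time g x n.
Proof. by move=> g0; apply: lt_le_trans (g0 x n) (psum_ge _ _). Qed.

Lemma rings_before_finite g D t : regular g -> finite_set (rings_before g D t).
Proof.
move=> [g0 gu _].
have [N NP] : {N : site d -> nat & forall x, t <= ring_time g x (N x)}.
  by apply: (@choice _ _ (fun x n => t <= ring_time g x n)) => x; exact: gu.
pose M := (\max_(x <- D) N x)%N.
apply: (@sub_finite_set _ _ ([set` D] `*` `I_M.+1)).
  move=> [x n] /= [xD /andP[_ xn]]; split => //=.
  rewrite ltnNge; apply/negP => Mn; move: xn; rewrite ltNge => /negP; apply.
  apply: le_trans (NP x) _; rewrite !ring_timeE.
  have : (N x <= n)%N.
    apply: leq_trans (ltnW Mn).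
    by apply: leq_bigmax_seq.
  rewrite leq_eqVlt => /orP[/eqP->//|h]; apply: ltW; exact: psum_lt.
exact: finite_setX.
Qed.

Lemma mem_ring_list g D t p : regular g ->
  (p \in ring_list g D t) = (p.1 \in D) && (ring_time g p.1 p.2 < t).
Proof.
move=> rg; rewrite mem_sort in_fset_set; last exact: rings_before_finite.
have [g0 _ _] := rg.
apply/idP/idP.
  by rewrite inE => -[-> /andP[_ ->]].
by move=> /andP[pD pt]; rewrite inE; split => //; rewrite pt andbT ltW ?ring_time_gt0.
Qed.

Lemma uniq_ring_list g D t : uniq (ring_list g D t).
Proof. by rewrite sort_uniq fset_uniq. Qed.

Lemma sorted_ring_list g D t : regular g -> sorted (earlier g) (ring_list g D t).
Proof.
move=> [_ _ ginj].
have : sorted (fun p q => ring_time g p.1 p.2 <= ring_time g q.1 q.2) (ring_list g D t).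
  by apply: sort_sorted => p q; exact: le_total.
have := uniq_ring_list g D t.
rewrite !sorted_pairwise; last 2 first.
  exact: earlier_trans.
  by move=> y x z; exact: le_trans.
elim: (ring_list g D t) => //= p l IH /andP[pl ul] /andP[/allP h1 h2].
rewrite IH// andbT; apply/allP => q ql; rewrite /earlier lt_neqAle h1// andbT.
by apply: contra pl => /eqP/ginj->.
Qed.

(** A strictly sorted list is determined by its members. Restricting the domain, gluing and
    relabelling are all verified by exhibiting a sorted list with the right members. *)
Lemma ring_list_unique g D t l : regular g -> sorted (earlier g) l ->
  (forall p, (p \in l) = (p.1 \in D) && (ring_time g p.1 p.2 < t)) ->
  l = ring_list g D t.
Proof.
move=> rg sl lP; apply: (irr_sorted_eq (@earlier_trans g) (@earlier_irr g)) => //.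
  exact: sorted_ring_list.
by move=> p; rewrite lP mem_ring_list.
Qed.

Lemma updates_filter g D D' t : regular g -> (D' `<=` D)%fset ->
  updates g D' t = [seq x <- updates g D t | x \in D'].
Proof.
move=> rg /fsubsetP sub; rewrite /updates filter_map; congr map.
apply/esym/ring_list_unique => //.
  by apply: sorted_filter; [exact: earlier_trans|exact: sorted_ring_list].
move=> p; rewrite mem_filter mem_ring_list//=.
by case: (boolP (p.1 \in D')) => // /sub ->.
Qed.

Lemma mem_updates g D t x : regular g ->
  (x \in updates g D t) = (x \in D) && (g x 0%N < t).
Proof.
move=> rg; apply/mapP/andP => [[p]|[xD xt]].
  rewrite mem_ring_list// => /andP[pD pt] ->; split => //.
  apply: le_lt_trans pt; rewrite ring_timeE; have [g0 _ _] := rg.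
  case: (p.2) => [|n]; rewrite ?psum0// -psum0.
  by apply/ltW/psum_lt.
by exists (x, 0%N) => //; rewrite mem_ring_list//= ring_timeE psum0 xD.
Qed.

Lemma updates_nonpos g D t : t <= 0 -> updates g D t = [::].
Proof.
move=> t0; rewrite /updates /ring_list (_ : rings_before g D t = set0) ?fset_set0 //.
rewrite -subset0 => p [_ /andP[h1 h2]].
by have := le_lt_trans h1 h2; rewrite ltNge t0.
Qed.

(** Pigeonhole: if the ring with index [c - 1] came too late, the [c] distinct indices of the rings
    at [x] before [t] would all lie below [c - 1]. *)
Lemma count_updates g D t x : regular g -> (0 < count_mem x (updates g D t))%N ->
  ring_time g x (count_mem x (updates g D t)).-1 < t.
Proof.
move=> rg c0; rewrite ltNge; apply/negP => tc.
set c := count_mem _ _ in c0 tc; have [g0 _ _] := rg.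
pose L := [seq p <- ring_list g D t | p.1 == x].
have cL : c = size L.
  by rewrite /c /updates count_map -size_filter; congr size; apply: eq_filter.
have uL : uniq (map snd L).
  rewrite map_inj_in_uniq ?filter_uniq ?uniq_ring_list// => -[y n] [y' n'].
  by rewrite !mem_filter /= => /andP[/eqP-> _] /andP[/eqP-> _] ->.
have sL : {subset map snd L <= iota 0 c.-1}.
  move=> n /mapP[[y m]]; rewrite mem_filter mem_ring_list//= => /andP[/eqP-> /andP[_ mt]] ->.
  rewrite mem_iota /= add0n ltnNge; apply/negP => cm.
  move: mt; rewrite ltNge (le_trans tc)//; move: cm.
  by rewrite leq_eqVlt => /orP[/eqP->//|?]; rewrite ltW// !ring_timeE psum_lt.
have := uniq_leq_size uL sL; rewrite size_map size_iota -cL.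
by case: (c) c0 => // n _; rewrite ltnn.
Qed.

(* Necessary condition, in terms of the gaps alone, for the sites of [w] to be
   updated before [t] in the order opposite to that of [w]. *)
Fixpoint feasible g t (w : seq (site d)) :=
  if w is x :: w' then (g x (count_mem x w') < t) && feasible g t w' else true.

(** If [x] heads [w] and occurs [n] more times in it, then it is updated at least [n + 1] times, so
    its ring with index [n] occurs before [t], and the gap with index [n] is at most that ring time.
    Ring times at one site are dependent while gaps are not; the weaker condition makes the
    probability of a chain a product. *)
Lemma subseq_feasible g D t w : regular g ->
  subseq w (rev (updates g D t)) -> feasible g t w.
Proof.
move=> rg; elim: w => // x w IH H /=.
rewrite IH ?andbT; last exact: subseq_trans (subseq_cons w x) H.
have cle : (count_mem x (x :: w) <= count_mem x (updates g D t))%N.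
  by rewrite -(count_rev _ (updates g D t)); exact: leq_count_subseq.
rewrite /= eqxx add1n in cle.
have := @count_updates g D t x rg (leq_ltn_trans (leq0n _) cle).
have [g0 _ _] := rg.
move=> h; apply: le_lt_trans h; rewrite ring_timeE.
have : (count_mem x w <= (count_mem x (updates g D t)).-1)%N.
  by rewrite -ltnS prednK// (leq_ltn_trans _ cle).
rewrite leq_eqVlt => /orP[/eqP->|h]; first exact: psum_ge.
apply/ltW; apply: le_lt_trans (psum_lt _ h) => //; exact: psum_ge.
Qed.

End ring_lists.

(** * Heights as eventually constant values, and their behaviour under gluing and relabelling *)

Section heights.
Context {R : realType} {d : nat}.
Implicit Types (g : site d -> nat -> R) (D : {fset site d}) (t s : R).
Implicit Types (f : site d -> int) (p : site d * nat).

Definition glue s (g g' : site d -> nat -> R) : site d -> nat -> R :=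
  fun x n => glue_seq n s (g x) (g' x).

(** With [N x] rings of [g] at [x] before [s], the ring [(x, n)] of [g'] becomes the ring
    [(x, N x + n)] of the glued clocks, delayed by [s]. So the second list of rings simply follows
    the first. *)
Lemma updates_glue s t g g' D : regular g -> regular g' ->
  regular (glue s g g') -> 0 <= t ->
  updates (glue s g g') D (s + t) = updates g D s ++ updates g' D t.
Proof.
move=> rg rg' rG t0.
have [g0 gu _] := rg; have [g'0 _ _] := rg'.
have [N NP] : {N : site d -> nat & forall x, 
    (forall n, (n < N x)%N -> ring_time g x n < s /\
       ring_time (glue s g g') x n = ring_time g x n) /\
    forall n, s <= ring_time g x (N x + n) /\
      ring_time (glue s g g') x (N x + n) = s + ring_time g' x n}.
  apply: (@choice _ _ (fun x N => (forall n, (n < N)%N -> ring_time g x n < s /\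
       ring_time (glue s g g') x n = ring_time g x n) /\
    forall n, s <= ring_time g x (N + n) /\
      ring_time (glue s g g') x (N + n) = s + ring_time g' x n)) => x.
  by have [N HN] := @glue_seqP R s (g x) (g' x) (g0 x) (gu x s); exists N.
rewrite /updates.
have -> : ring_list (glue s g g') D (s + t) =
    ring_list g D s ++ map (fun p => (p.1, N p.1 + p.2)%N) (ring_list g' D t).
  apply/esym/ring_list_unique => //.
    have := sorted_ring_list D s rg; have := sorted_ring_list D t rg'.
    rewrite !sorted_pairwise; try exact: earlier_trans.
    move=> p2 p1; rewrite pairwise_cat; apply/and3P; split.
    + apply/allrelP => p q; rewrite mem_ring_list// => /andP[_ ps] /mapP[r _ ->].
      rewrite /earlier /= ((NP r.1).2 r.2).2.
      have pN : (p.2 < N p.1)%N.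
        rewrite ltnNge; apply/negP => h.
        by have := ((NP p.1).2 (p.2 - N p.1)%N).1; rewrite subnKC// leNgt ps.
      rewrite ((NP p.1).1 _ pN).2; apply: lt_le_trans ps _.
      by rewrite lerDl ltW// ring_time_gt0.
    + suff X : {in ring_list g D s &, subrel (earlier g) (earlier (glue s g g'))}.
        by apply: (sub_in_pairwise X) p1; exact: allss.
      move=> p q pl ql.
      have E (r : site d * nat) : r \in ring_list g D s ->
          ring_time (glue s g g') r.1 r.2 = ring_time g r.1 r.2.
        rewrite mem_ring_list// => /andP[_ rs]; apply: ((NP r.1).1 _ _).2.
        rewrite ltnNge; apply/negP => h.
        by have := ((NP r.1).2 (r.2 - N r.1)%N).1; rewrite subnKC// leNgt rs.
      by rewrite /earlier !E.
    + rewrite pairwise_map; apply: sub_pairwise p2 => p q; rewrite /earlier /=.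
      by rewrite !((NP _).2 _).2 ltrD2l.
  move=> [x n]; rewrite mem_cat mem_ring_list//=.
  case: (ltnP n (N x)) => nN.
    have [h1 h2] := (NP x).1 _ nN.
    rewrite h1 h2 andbT (lt_le_trans h1) ?lerDl// andbT.
    case: (x \in D) => //=; apply/negbTE/mapP => -[[y m] _ [xy nm]].
    by move: nN; rewrite nm -xy ltnNge leq_addr.
  have [h1 h2] := (NP x).2 (n - N x)%N; rewrite subnKC// in h1 h2.
  rewrite h2 ltrD2l ltNge h1 andbF /=; apply/mapP/idP => [[[y m]]|H].
    rewrite mem_ring_list//= => yD [-> ->].
    by rewrite addnC addnK.
  by exists (x, n - N x)%N; rewrite ?mem_ring_list//= subnKC.
rewrite map_cat; congr (_ ++ _); rewrite -map_comp; exact: eq_map.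
Qed.

Lemma updates_glue_before s r g g' D : regular g -> regular g' ->
  regular (glue s g g') -> r <= s -> updates (glue s g g') D r = updates g D r.
Proof.
move=> rg rg' rG rs; have [g0 gu _] := rg; have [g'0 _ _] := rg'.
rewrite /updates; congr map.
have E (p : site d * nat) : (ring_time (glue s g g') p.1 p.2 < r) = (ring_time g p.1 p.2 < r) /\
    (ring_time g p.1 p.2 < r -> ring_time (glue s g g') p.1 p.2 = ring_time g p.1 p.2).
  have [N [N1 N2]] := @glue_seqP _ s (g p.1) (g' p.1) (g0 p.1) (gu p.1 s).
  case: (ltnP p.2 N) => pN.
    by have [_ e] := N1 _ pN; rewrite !ring_timeE e.
  have [h1 h2] := N2 (p.2 - N)%N; rewrite subnKC// in h1 h2.
  rewrite !ring_timeE h2 !ltNge (le_trans rs)//; last first.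
    by rewrite lerDl ltW// (ring_time_gt0 _ _ g'0).
  by rewrite (le_trans rs h1).
apply/esym/ring_list_unique => //; last first.
  by move=> p; rewrite mem_ring_list// (E p).1.
have := sorted_ring_list D r rg; rewrite !sorted_pairwise; try exact: earlier_trans.
suff X : {in ring_list g D r &, subrel (earlier g) (earlier (glue s g g'))}.
  by apply: (sub_in_pairwise X); exact: allss.
move=> p q; rewrite !mem_ring_list// => /andP[_ pl] /andP[_ ql].
by rewrite /earlier (E p).2// (E q).2.
Qed.

Lemma updates_relabel (phi : site d -> site d) g D t : bijective phi ->
  regular g -> regular (fun x => g (phi x)) ->
  map phi (updates (fun x => g (phi x)) D t) = updates g [fset phi x | x in D]%fset t.
Proof.
move=> bphi rg rg'; rewrite /updates -map_comp.
have -> : map (phi \o fst) (ring_list (fun x => g (phi x)) D t) =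
    map fst (map (fun p => (phi p.1, p.2)) (ring_list (fun x => g (phi x)) D t)).
  by rewrite -map_comp; exact: eq_map.
congr map; apply: ring_list_unique => //.
  by rewrite sorted_map; exact: (sorted_ring_list D t rg').
move=> [x n] /=; apply/mapP/andP => [[[y m]]|[]].
  rewrite mem_ring_list//= => /andP[yD ?] [-> ->]; split => //.
  by apply/imfsetP; exists y.
move=> /imfsetP[y /= yD ->] H; exists (y, n) => //.
by rewrite mem_ring_list//= yD.
Qed.

(* The heights at time [t] are determined by finitely many sites, uniformly in
   the initial condition. *)
Definition finitely_influenced g t := forall x, exists D0, forall D,
  (D0 `<=` D)%fset -> forall f,
    run f (updates g D t) x = run f (updates g D0 t) x.

(** The order of the quantifiers matters: one [D0] serves all initial fields, in particular the
    random field reached at an intermediate time. *)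
Lemma heightE g t x : finitely_influenced g t -> exists D0, forall D,
  (D0 `<=` D)%fset -> forall f, height g f t x = run f (updates g D t) x.
Proof.
move=> /(_ x)[D0 HD0]; exists D0 => D D0D f; rewrite /height.
case: xgetP => [v _ [D1 H1]|/(_ (run f (updates g D t) x)) []].
  rewrite -(H1 (D0 `|` D1)%fset) ?fsubsetUr// finite_heightE.
  by rewrite HD0 ?fsubsetUl// -(HD0 D).
by exists D0 => D' D'D; rewrite finite_heightE HD0// -(HD0 D).
Qed.

Lemma height_common g t (X : seq (site d)) : finitely_influenced g t ->
  exists D0, forall D, (D0 `<=` D)%fset -> forall f, {in X, forall x,
    height g f t x = run f (updates g D t) x}.
Proof.
move=> FI; elim: X => [|x X [D0 H0]]; first by exists fset0.
have [D1 H1] := @heightE g t x FI.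
exists (D0 `|` D1)%fset => D; rewrite fsubUset => /andP[h0 h1] f y.
by rewrite in_cons => /orP[/eqP->|]; [exact: H1|exact: H0].
Qed.

Lemma height_nonpos g f t : t <= 0 -> height g f t = f.
Proof.
move=> t0; apply/funext => x; have [|D0 H] := @heightE g t x.
  by move=> y; exists fset0 => D _ f'; rewrite !updates_nonpos.
by rewrite (H D0)// updates_nonpos.
Qed.

Lemma height_glue_before s r g g' f : regular g -> regular g' ->
  regular (glue s g g') -> r <= s -> height (glue s g g') f r = height g f r.
Proof.
move=> rg rg' rG rs; rewrite /height; apply/funext => x; congr xget.
apply/seteqP; split => v [D0 H]; exists D0 => D /H.
  by rewrite !finite_heightE updates_glue_before.
by rewrite !finite_heightE updates_glue_before.
Qed.

Section glued.
Variables (s t : R) (g g' : site d -> nat -> R).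
Hypotheses (rg : regular g) (rg' : regular g') (rG : regular (glue s g g')).
Hypotheses (t0 : 0 <= t).
Hypotheses (Fg : finitely_influenced g s) (Fg' : finitely_influenced g' t).

(** After time [s] the height at [x] reads the intermediate field only on the finite list [X], and
    finitely many sites determine that field on [X]. *)
Lemma height_run_glue x : exists D0, forall D, (D0 `<=` D)%fset -> forall f,
  run f (updates (glue s g g') D (s + t)) x = height g' (height g f s) t x.
Proof.
have [D1 H1] := @heightE g' t x Fg'.
pose X := x :: flatten [seq lazy_nbrs z | z <- updates g' D1 t].
have [D2 H2] := @height_common g s X Fg.
exists (D1 `|` D2)%fset => D; rewrite fsubUset => /andP[h1 h2] f.
(* The updates of the second period are reduced from [D] to [D1], because the list [X] of sites they
   read was fixed before [D]. *)
rewrite updates_glue// run_cat -(H1 D)// (H1 D1)//= [RHS](H1 D1)//=.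
by apply: run_eq_on => y yX; rewrite (H2 D).
Qed.

Lemma finitely_influenced_glue : finitely_influenced (glue s g g') (s + t).
Proof.
move=> x; have [D0 H0] := height_run_glue x.
by exists D0 => D D0D f; rewrite !H0.
Qed.

Lemma height_glue f : height (glue s g g') f (s + t) = height g' (height g f s) t.
Proof.
apply/funext => x; have [D0 H0] := height_run_glue x.
have [D1 H1] := heightE x finitely_influenced_glue.
by rewrite (H1 (D0 `|` D1)%fset) ?fsubsetUr// H0 ?fsubsetUl.
Qed.

End glued.

Lemma height_shift g f t (c : int) : finitely_influenced g t ->
  height g (fun x => f x + c) t = (fun x => height g f t x + c).
Proof.
move=> FI; apply/funext => x; have [D0 H] := heightE x FI.
by rewrite !(H D0)// run_shift.
Qed.

Lemma height_relabel phi g f t : graph_automorphism phi -> regular g ->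
  regular (fun x => g (phi x)) -> finitely_influenced g t ->
  finitely_influenced (fun x => g (phi x)) t ->
  height (fun x => g (phi x)) (f \o phi) t = height g f t \o phi.
Proof.
move=> aphi rg rg' FI FI'; apply/funext => x /=.
have [psi phiK psiK] := aphi.1.
have [D0 H0] := heightE x FI'; have [D1 H1] := heightE (phi x) FI.
(* [D] has to contain [D0] while its image under [phi] contains [D1], so that both heights have
   reached their limits. *)
pose D := (D0 `|` [fset psi y | y in D1])%fset.
rewrite (H0 D) ?fsubsetUl// (H1 [fset phi y | y in D]%fset); last first.
  apply/fsubsetP => y yD1; apply/imfsetP; exists (psi y) => //=.
  by rewrite inE; apply/orP; right; apply/imfsetP; exists y.
by rewrite run_automorphism// updates_relabel//; exact: aphi.1.
Qed.

Lemma height_ge g f t x : finitely_influenced g t -> f x <= height g f t x.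
Proof. by move=> FI; have [D0 H] := heightE x FI; rewrite (H D0)// run_ge. Qed.

Lemma height_ge_nbr g f t x y : regular g -> finitely_influenced g t ->
  g x 0%N < t -> y \in nbrs x -> f y <= height g f t x.
Proof.
move=> rg FI xt yx; have [D0 H] := heightE x FI.
rewrite (H (x |` D0)%fset) ?fsubsetUr//; apply: run_nbr => //.
by rewrite mem_updates// !inE eqxx.
Qed.

Lemma height_silent g f t x : regular g -> finitely_influenced g t ->
  t <= g x 0%N -> height g f t x = f x.
Proof.
move=> rg FI tx; have [D0 H] := heightE x FI.
by rewrite (H D0)// run_notin// mem_updates// ltNge tx andbF.
Qed.

Lemma height_le_walk g f t x : regular g -> finitely_influenced g t ->
  exists k w, [/\ w \in walks k x, feasible g t (belast x w) &
    height g f t x <= f (last x w) + k%:Z].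
Proof.
move=> rg FI; have [D0 H] := heightE x FI; rewrite (H D0)//.
have [k [w [wk sw Hw]]] := run_le_walk f (updates g D0 t) x.
by exists k, w; split => //; exact: subseq_feasible sw.
Qed.

(** The [k]-step walks visit finitely many sites. If no such walk can be followed by updates,
    [run_filter] shows that updates elsewhere have no effect at [x], whatever the initial field. *)
Lemma finitely_influenced_walks g t : regular g ->
  (forall x, exists k, forall w, w \in walks k x -> ~~ feasible g t (belast x w)) ->
  finitely_influenced g t.
Proof.
move=> rg H x; have [k Hk] := H x.
exists [fset y in flatten [seq belast x w | w <- walks k x]]%fset => D sub f.
rewrite (@updates_filter _ _ g D _ t rg sub).
apply/esym; apply: (@run_filter _ _ (mem [fset y in flatten [seq belast x w | w <- walks k x]]%fset) k) => w wx.
  move=> y yw; apply/imfsetP; exists y => //=.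
  by apply/flatten_mapP; exists w.
by apply: contra (Hk w wx); exact: subseq_feasible.
Qed.

End heights.

(** * Independent exponential gaps *)

Section probability_generalities.
Context {R : realType}.

Lemma mfun_of_subproof d d' (T : measurableType d) (T' : measurableType d')
  (f : T -> T') : measurable_fun setT f -> f \in mfun.
Proof. by move=> mf; rewrite inE. Qed.

Definition law d d' (T : measurableType d) (T' : measurableType d')
    (P : probability T R) (f : T -> T') (mf : measurable_fun setT f) :
  probability T' R := distribution P (mfun_Sub (mfun_of_subproof mf)).

Lemma lawE d d' (T : measurableType d) (T' : measurableType d')
    (P : probability T R) (f : T -> T') (mf : measurable_fun setT f) A :
  law P mf A = P (f @^-1` A).
Proof. by []. Qed.

Lemma probability_eq d (T : measurableType d) (G : set (set T))
    (P P' : probability T R) :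
  @measurable _ T = <<s G >> -> setI_closed G ->
  (forall A, G A -> P A = P' A) -> forall A, measurable A -> P A = P' A.
Proof.
move=> mG GI PP' A mA.
(* Two probabilities agree on the whole space, which can thus join the generators and supply the
   covering sequence of the uniqueness theorem. *)
pose G' := G `|` [set setT].
apply: (@measure_unique _ R T G' (fun=> setT)) => //.
- rewrite mG; apply/seteqP; split.
    apply: smallest_sub; first exact: smallest_sigma_algebra.
    by move=> B GB; apply: sub_sigma_algebra; left.
  apply: smallest_sub; first exact: smallest_sigma_algebra.
  move=> B [GB|->]; first exact: sub_sigma_algebra.
  by rewrite -mG; exact: measurableT.
- move=> B C [GB|->] [GC|->]; rewrite ?setTI ?setIT; [left|left|left|right] => //.
  exact: GI.
- by move=> _; right.
- by rewrite bigcup_const.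
- by move=> B [/PP'//|->]; rewrite /= !probability_setT.
- by move=> _; rewrite /= probability_setT ltry.
Qed.

Definition prod_prob d1 d2 (T1 : measurableType d1) (T2 : measurableType d2)
   (P1 : probability T1 R) (P2 : probability T2 R) : set (T1 * T2) -> \bar R :=
  (P1 \x P2)%E.

Section product.
Context d1 d2 (T1 : measurableType d1) (T2 : measurableType d2).
Variables (P1 : probability T1 R) (P2 : probability T2 R).

HB.instance Definition _ := Measure.on (prod_prob P1 P2).

Let prod_prob_setT : prod_prob P1 P2 setT = 1%E.
Proof. by rewrite /prod_prob -setXTT product_measure1E//= !probability_setT mule1. Qed.

HB.instance Definition _ :=
  Measure_isProbability.Build _ _ _ (prod_prob P1 P2) prod_prob_setT.

Lemma prod_probX A B : measurable A -> measurable B ->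
  prod_prob P1 P2 (A `*` B) = (P1 A * P2 B)%E.
Proof. exact: product_measure1E. Qed.

Lemma prod_probE A : measurable A ->
  prod_prob P1 P2 A = (\int[P1]_x P2 [set y | A (x, y)])%E.
Proof.
by move=> mA; apply: eq_integral => x _ /=; rewrite xsectionE.
Qed.

Lemma prod_prob_unique (P' : probability (T1 * T2)%type R) :
  (forall A B, measurable A -> measurable B -> P' (A `*` B) = P1 A * P2 B)%E ->
  forall A, measurable A -> P' A = prod_prob P1 P2 A.
Proof. by move=> H A mA; apply/esym; exact: product_measure_unique. Qed.

Lemma measurable_section (A : set (T1 * T2)) x : measurable A ->
  measurable [set y | A (x, y)].
Proof. by move=> /(measurable_xsection x); rewrite xsectionE. Qed.

Lemma measurable_fun_section (A : set (T1 * T2)) : measurable A ->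
  measurable_fun setT ((fun x => P2 [set y | A (x, y)]) : T1 -> \bar R).
Proof.
move=> mA; have := measurable_fun_xsection P2 mA.
by apply: eq_measurable_fun => x _ /=; rewrite xsectionE.
Qed.

End product.

Section almost_everywhere.
Context d1 d2 (T1 : measurableType d1) (T2 : measurableType d2).
Variables (P1 : probability T1 R) (P2 : probability T2 R).

Lemma ae_fst (A : T1 -> Prop) : {ae P1, forall x, A x} ->
  {ae prod_prob P1 P2, forall z, A z.1}.
Proof.
move=> [N [mN N0 AN]]; exists (N `*` setT); split.
- exact: measurableX.
- by rewrite prod_probX// N0 mul0e.
- by move=> z Az; split => //; exact: AN.
Qed.

Lemma ae_snd (A : T2 -> Prop) : {ae P2, forall x, A x} ->
  {ae prod_prob P1 P2, forall z, A z.2}.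
Proof.
move=> [N [mN N0 AN]]; exists (setT `*` N); split.
- exact: measurableX.
- by rewrite prod_probX// N0 mule0.
- by move=> z Az; split => //; exact: AN.
Qed.

Lemma ae_prob1 (A : set T1) : measurable A ->
  {ae P1, forall x, A x} <-> P1 A = 1%E.
Proof.
move=> mA; have -> : {ae P1, forall x, A x} <-> P1 (~` A) = 0%E.
  by apply: negligibleP; exact: measurableC.
rewrite probability_setC//; have := fin_num_measure P1 _ mA.
move: (P1 A) => [r| |]//= _; rewrite -EFinB; split => -[] /eqP.
  by rewrite subr_eq0 => /eqP <-.
by move=> /eqP->; rewrite subrr.
Qed.

Lemma ae_eq_prob (A B : set T1) : measurable A -> measurable B ->
  {ae P1, forall x, A x <-> B x} -> P1 A = P1 B.
Proof.
move=> mA mB [N [mN N0 ABN]].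
have E C : measurable C -> P1 C = P1 (C `\` N).
  move=> mC; rewrite (measureDI P1 mC mN) [X in (_ + X)%E](_ : _ = 0%E) ?adde0//.
  by apply: (subset_measure0 (measurableI _ _ mC mN) mN) N0; exact: subIsetr.
rewrite (E A)// (E B)//; congr (P1 _); apply/seteqP.
have AB x : ~ N x -> A x <-> B x by move=> Nx; apply: contrapT => /ABN.
by split => x [Cx Nx]; split => //; apply/(AB x Nx).
Qed.

End almost_everywhere.

Lemma ae_countable d (T : measurableType d) (P : probability T R) (I : countType)
    (A : I -> T -> Prop) : (forall i, {ae P, forall x, A i x}) ->
  {ae P, forall x, forall i, A i x}.
Proof.
move=> H; pose N n := if (@choice.unpickle I n) is Some i then ~` [set x | A i x] else set0.
have NN : P.-negligible (\bigcup_n N n).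
  apply: negligible_bigcup => n; rewrite /N; case: (@choice.unpickle I n) => [i|]; first exact: H.
  exact: negligible_set0.
apply: negligibleS NN => x /= /existsNP[i Ai].
by exists (choice.pickle i) => //; rewrite /N choice.pickleK.
Qed.

End probability_generalities.

Section independent_pi_systems.
Context {R : realType} d (T : measurableType d) (P : probability T R).
Context (K : choiceType) (G : K -> set (set T)).
Hypotheses (GI : forall k, setI_closed (G k)) (Gm : forall k, G k `<=` measurable).
Hypothesis GT : forall k, G k setT.
Hypothesis indG : forall (J : {fset K}) (A : K -> set T), (forall k, G k (A k)) ->
  P (\bigcap_(k in [set` J]) A k) = (\prod_(k <- J) P (A k))%E.

Let sGm k : <<s G k >> `<=` measurable.
Proof. by apply: smallest_sub => //; exact: sigma_algebra_measurable. Qed.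

(** Dynkin's argument, one index at a time: [L] lists the indices whose sets range over the
    generated sigma-algebra, the sets at all other indices staying in their pi-systems. *)
Lemma independent_sigma (J : {fset K}) (A : K -> set T) :
  (forall k, <<s G k >> (A k)) ->
  P (\bigcap_(k in [set` J]) A k) = (\prod_(k <- J) P (A k))%E.
Proof.
move=> sA.
suff H (L : seq K) (A' : K -> set T) : uniq L -> (forall k, <<s G k >> (A' k)) ->
    (forall k, k \notin L -> G k (A' k)) -> forall J : {fset K},
    P (\bigcap_(k in [set` J]) A' k) = (\prod_(k <- J) P (A' k))%E.
  pose A' k := if k \in J then A k else setT.
  have -> : \bigcap_(k in [set` J]) A k = \bigcap_(k in [set` J]) A' k.
    by apply: eq_bigcapr => k /= kJ; rewrite /A' kJ.
  rewrite [RHS](eq_big_seq (fun k => P (A' k))); last by move=> k kJ; rewrite /A' kJ.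
  apply: (H J); first exact: fset_uniq.
    by move=> k; rewrite /A'; case: ifP => // _; apply: sub_sigma_algebra.
  by move=> k /negbTE kJ; rewrite /A' kJ.
elim: L A' {A sA J} => [|k0 L IH] A.
  by move=> _ _ GA J; apply: indG => k; exact: GA.
move=> /= /andP[k0L uL] sA GA J.
have mA k : measurable (A k) by exact: sGm.
case: (boolP (k0 \in J)) => k0J; last first.
  pose A' k := if k == k0 then setT else A k.
  have -> : \bigcap_(k in [set` J]) A k = \bigcap_(k in [set` J]) A' k.
    apply: eq_bigcapr => k /= kJ; rewrite /A'; case: eqVneq => // e.
    by rewrite e (negbTE k0J) in kJ.
  rewrite [RHS](eq_big_seq (fun k => P (A' k))); last first.
    move=> k kJ; rewrite /A'; case: eqVneq => // e.
    by rewrite e (negbTE k0J) in kJ.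
  apply: IH => // [k|k kL]; rewrite /A'; case: eqVneq => // kk0.
    exact: sub_sigma_algebra.
  by apply: GA; rewrite in_cons negb_or kk0.
rewrite (big_fsetD1 k0)//= [LHS](_ : _ =
  P (A k0 `&` \bigcap_(k in [set` (J `\ k0)%fset]) A k)); last first.
  congr (P _); apply/seteqP; split => x.
    move=> H; split; first exact: H.
    by move=> k /=; rewrite in_fsetD1 => /andP[_ kJ]; exact: H.
  move=> [H0 H] k /= kJ; case: (eqVneq k k0) => [->//|kk0].
  by apply: H; rewrite /= in_fsetD1 kk0.
set C := \bigcap_(k in _) _.
have mC : measurable C by apply: fin_bigcap_measurable.
have PC : (\prod_(k <- (J `\ k0)%fset) P (A k) = P C)%E.
  pose A' k := if k == k0 then setT else A k.
  have sA' k : <<s G k >> (A' k).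
    by rewrite /A'; case: eqVneq => // _; exact: sub_sigma_algebra.
  have GA' k : k \notin L -> G k (A' k).
    move=> kL; rewrite /A'; case: eqVneq => // kk0.
    by apply: GA; rewrite in_cons negb_or kk0.
  have := IH A' uL sA' GA' (J `\ k0)%fset.
  rewrite [X in _ = X -> _](eq_big_seq (fun k => P (A k))); last first.
    by move=> k; rewrite in_fsetD1 /A' => /andP[/negbTE->].
  move=> <-; congr (P _); apply: eq_bigcapr => k /=.
  by rewrite in_fsetD1 /A' => /andP[/negbTE->].
have EG B : G k0 B -> P (B `&` C) = (P B * P C)%E.
  move=> GB; pose A' k := if k == k0 then B else A k.
  have GA' k : k \notin L -> G k (A' k).
    by move=> kL; rewrite /A'; case: eqVneq => [->//|kk0]; apply: GA; rewrite in_cons negb_or kk0.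
  have sA' k : <<s G k >> (A' k).
    by rewrite /A'; case: eqVneq => [->|//]; exact: sub_sigma_algebra.
  have := IH A' uL sA' GA' J; rewrite (big_fsetD1 k0)//=.
  rewrite [X in _ = (P X * _)%E -> _](_ : _ = B); last by rewrite /A' eqxx.
  rewrite [X in _ = (_ * X)%E -> _](eq_big_seq (fun k => P (A k))); last first.
    by move=> k; rewrite in_fsetD1 /A' => /andP[/negbTE->].
  rewrite PC => <-; congr (P _); apply/seteqP; split => x.
    move=> [H0 H1] k /= kJ; rewrite /A'; case: eqVneq => // kk0.
    by apply: H1; rewrite /= in_fsetD1 kk0.
  move=> H1; split; first by have := H1 k0 k0J; rewrite /A' eqxx.
  move=> k /=; rewrite in_fsetD1 => /andP[kk0 kJ].
  by have := H1 k kJ; rewrite /A' (negbTE kk0).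
rewrite PC.
pose c := fine (P C).
have cE : P C = c%:E by rewrite fineK// fin_num_measure.
have c0 : 0 <= c by rewrite fine_ge0.
(* As functions of the set at [k0], the probability of its intersection with [C] and the product of
   the two probabilities are finite measures. They agree on the pi-system [G k0], hence on what it
   generates. *)
pose m1 := mrestr P mC; pose m2 := mscale (NngNum c0) P.
have := @g_sigma_algebra_measure_unique _ R T (G k0) (@Gm k0) (fun=> setT) _ _ m1 m2.
move=> /(_ _ _ (@GI k0)) H.
rewrite muleC cE; apply: (H (fun _ => @GT k0) _ _ _ (A k0) (sA k0)).
- by rewrite bigcup_const.
- move=> B /EG EB; change (P (B `&` C) = (c%:E * P B)%E).
  by rewrite EB muleC cE.
- move=> _; change (P (setT `&` C) < +oo)%E.
  by apply: le_lt_trans (probability_le1 P _) (ltry _); exact: measurableI.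
Qed.

End independent_pi_systems.

(** * Configurations of gaps with independent coordinates *)

Section configurations.
Variables (R : realType) (I : choiceType).

Definition cylinders : set (set (I -> R)) :=
  [set A | exists (J : {fset I}) (B : I -> set R), (forall i, measurable (B i)) /\
     A = [set c | forall i, i \in J -> B i (c i)]].

Definition config := g_sigma_algebraType cylinders.

HB.instance Definition _ := Measurable.on config.

Lemma cylinders_setI : setI_closed cylinders.
Proof.
move=> _ _ [J [B [mB ->]]] [J' [B' [mB' ->]]].
exists (J `|` J')%fset, (fun i => (if i \in J then B i else setT) `&`
  (if i \in J' then B' i else setT)); split.
  by move=> i; apply: measurableI; case: ifP.
apply/seteqP; split => c.
  by move=> [H H'] i _; split; case: ifP => // iJ; [exact: H|exact: H'].
move=> H; split => i iJ; have := H i; rewrite in_fsetU iJ ?orbT => /(_ isT)[] //.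
Qed.

Lemma measurable_coord i : measurable_fun setT (fun c : config => c i).
Proof.
move=> _ B mB; rewrite setTI; apply: sub_sigma_algebra.
exists [fset i]%fset, (fun=> B); split => //; apply/seteqP; split => c /=.
  by move=> H j; rewrite inE => /eqP->.
by apply; rewrite inE.
Qed.

Lemma measurable_config d (T : measurableType d) (f : T -> config) :
  (forall i, measurable_fun setT (fun x => f x i)) -> measurable_fun setT f.
Proof.
move=> mf; apply: (@measurability _ _ _ _ setT f cylinders) => //.
move=> _ [_ [J [B [mB ->]]] <-]; rewrite setTI.
have -> : f @^-1` [set c | forall i, i \in J -> B i (c i)] =
    \bigcap_(i in [set` J]) (fun x => f x i) @^-1` B i by [].
apply: fin_bigcap_measurable => // i _.
by rewrite -[_ @^-1` _]setTI; exact: (mf i measurableT).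
Qed.

End configurations.

Section iid.
Context {R : realType} (I : choiceType) (e : probability R R).

Definition iid d (T : measurableType d) (P : probability T R) (Z : T -> config R I) :=
  measurable_fun setT Z /\ forall (J : {fset I}) (B : I -> set R),
    (forall i, measurable (B i)) ->
    P [set w | forall i, i \in J -> B i (Z w i)] = (\prod_(i <- J) e (B i))%E.

Lemma iid_unique d d' (T : measurableType d) (T' : measurableType d')
    (P : probability T R) (P' : probability T' R) Z Z' :
  iid P Z -> iid P' Z' ->
  forall A, measurable A -> P (Z @^-1` A) = P' (Z' @^-1` A).
Proof.
move=> [mZ PZ] [mZ' PZ'] A mA.
change (law P mZ A = law P' mZ' A).
apply: (@probability_eq R _ (config R I) (@cylinders R I) (law P mZ) (law P' mZ')) => //.
  exact: cylinders_setI.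
move=> _ [J [B [mB ->]]].
by change (P [set w | forall i, i \in J -> B i (Z w i)] =
  P' [set w | forall i, i \in J -> B i (Z' w i)]); rewrite PZ// PZ'.
Qed.

End iid.

Section iid_operations.
Context {R : realType} (e : probability R R).

Lemma iid_reindex (I I' : choiceType) d (T : measurableType d)
    (P : probability T R) (Z : T -> config R I) (phi : I' -> I) :
  injective phi -> iid e P Z -> iid e P (fun w i => Z w (phi i) : R).
Proof.
move=> iphi [mZ PZ]; split.
  apply: measurable_config => i.
  exact: (measurableT_comp (measurable_coord (phi i)) mZ).
move=> J B mB.
(* Coordinates outside the range of [phi] are left free; injectivity makes the others well
   defined. *)
pose B' i := if pselect (exists j, phi j = i) is left H then B (projT1 (cid H)) else setT.
have B'E j : B' (phi j) = B j.
  rewrite /B'; case: pselect => [H|]; last by case; exists j.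
  by case: cid => /= j' /iphi ->.
have mB' i : measurable (B' i) by rewrite /B'; case: pselect.
have := PZ [fset phi j | j in J]%fset B' mB'.
rewrite (big_imfset _ _ (h := phi)) /=; last by move=> ? ? _ _; exact: iphi.
rewrite (eq_bigr (fun j => e (B j))); last by move=> j _; rewrite B'E.
move=> <-; congr (P _); apply/seteqP; split => w /= H i.
  by move=> /imfsetP[j /= jJ ->]; rewrite B'E; exact: H.
by move=> iJ; rewrite -B'E; apply: H; apply/imfsetP; exists i.
Qed.

Lemma iid_coord1 (I : choiceType) d (T : measurableType d)
    (P : probability T R) (Z : T -> config R I) i B :
  iid e P Z -> measurable B -> P [set w | B (Z w i)] = e B.
Proof.
move=> [mZ PZ] mB; have := PZ [fset i]%fset (fun=> B) (fun=> mB).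
rewrite big_seq_fset1 => <-; congr (P _); apply/seteqP; split => w /=.
  by move=> H j; rewrite inE => /eqP->.
by apply; rewrite inE.
Qed.

Lemma prod_fset_nat (J : {fset nat}) (B : nat -> set R) m :
  (forall n, n \in J -> (n < m)%N) ->
  (\prod_(n <- J) e (B n) = \prod_(n < m) e (if (n : nat) \in J then B n else setT))%E.
Proof.
move=> Jm; rewrite (eq_bigr (fun n : 'I_m => if (n : nat) \in J then e (B n) else 1%E)); last first.
  by move=> n _; case: ifP => //; rewrite probability_setT.
rewrite -big_mkcond /= -(big_mkord (fun n => n \in J) (fun n => e (B n))).
rewrite -[RHS]big_filter; apply: perm_big; apply: uniq_perm.
- exact: fset_uniq.
- by rewrite filter_uniq// iota_uniq.
- move=> n; rewrite mem_filter mem_index_iota /=.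
  by case: (boolP (n \in J)) => // /Jm ->.
Qed.

Lemma fset_nat_bound (J : {fset nat}) : exists m, forall n, n \in J -> (n < m)%N.
Proof.
exists (\max_(n <- J) n).+1 => n nJ; rewrite ltnS.
by have := @leq_bigmax_seq _ (enum_fset J) xpredT id n nJ isT.
Qed.

(** For sequences, constraints on initial segments suffice, and they allow induction on the
    length. *)
Definition box_law d (T : measurableType d) (P : probability T R)
    (Z : T -> config R nat) :=
  forall m (B : nat -> set R), (forall n, measurable (B n)) ->
    P [set w | forall n, (n < m)%N -> B n (Z w n)] = (\prod_(n < m) e (B n))%E.

Lemma iid_box_law d (T : measurableType d) (P : probability T R)
    (Z : T -> config R nat) : iid e P Z -> box_law P Z.
Proof.
move=> [mZ PZ] m B mB; pose J := [fset n | n in iota 0 m]%fset.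
have Jm n : (n \in J) = (n < m)%N.
  by apply/imfsetP/idP => [[k /= + ->]|nm]; [|exists n => //=]; rewrite mem_iota.
have := PZ J B mB; rewrite (@prod_fset_nat J B m); last by move=> n; rewrite Jm.
rewrite (eq_bigr (fun n : 'I_m => e (B n))); last by move=> n _; rewrite Jm ltn_ord.
move=> <-; congr (P _); apply/seteqP.
by split => w /= H n; [rewrite Jm; exact: H|move=> nm; apply: H; rewrite Jm].
Qed.

Lemma box_law_iid d (T : measurableType d) (P : probability T R)
    (Z : T -> config R nat) : measurable_fun setT Z -> box_law P Z -> iid e P Z.
Proof.
move=> mZ PZ; split => // J B mB; have [m Jm] := fset_nat_bound J.
rewrite (prod_fset_nat B Jm) -(PZ m (fun n => if n \in J then B n else setT));
  last by move=> n; case: ifP.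
congr (P _); apply/seteqP; split => w /= H n.
  by move=> _; case: ifP => // /H.
by move=> nJ; have := H n (Jm n nJ); rewrite nJ.
Qed.

Definition consc (z : R * config R nat) : config R nat :=
  fun n => if n is m.+1 then z.2 m else z.1.

Lemma measurable_consc : measurable_fun setT consc.
Proof.
apply: measurable_config => -[|n]; first exact: measurable_fst.
exact: (measurableT_comp (measurable_coord n) measurable_snd).
Qed.

Lemma measurable_box m (B : nat -> set R) : (forall n, measurable (B n)) ->
  measurable [set c : config R nat | forall n, (n < m)%N -> B n (c n)].
Proof.
move=> mB.
have -> : [set c : config R nat | forall n, (n < m)%N -> B n (c n)] =
    \bigcap_(i in `I_m) (fun c : config R nat => c i) @^-1` B i by [].
apply: fin_bigcap_measurable => // i _; rewrite -[_ @^-1` _]setTI.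
exact: (measurable_coord i measurableT).
Qed.

Lemma iid_consc (q : probability (config R nat) R) :
  iid e q id -> iid e (prod_prob e q) consc.
Proof.
move=> /iid_box_law Pq; apply: box_law_iid; first exact: measurable_consc.
case=> [|m] B mB.
  rewrite big_ord0 (_ : [set w | _] = setT) ?probability_setT//.
  by apply/seteqP; split.
rewrite (_ : [set w | _] =
  B 0%N `*` [set c : config R nat | forall n, (n < m)%N -> B n.+1 (c n)]).
  rewrite [LHS]prod_probX//; last exact: (@measurable_box m (fun n => B n.+1) (fun n => mB n.+1)).
  by rewrite (Pq m (fun n => B n.+1))// big_ord_recl.
apply/seteqP; split => -[a c] /= H.
  by split=> [|n nm]; [exact: (H 0%N)|exact: (H n.+1)].
by move=> [|n] nm; [exact: H.1|exact: H.2].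
Qed.

End iid_operations.

Section exponential_law.
Context {R : realType}.

Let idTR : measurableTypeR R -> R := idfun.

Let measurable_idTR : measurable_fun setT idTR.
Proof. exact: (@measurable_id _ _ setT). Qed.

(* [exponential_prob] is a measure on [measurableTypeR R], which has the same
   measurable sets as [R] but another display. *)
Definition ex : probability R R :=
  law (@exponential_distribution_exponential_prob__canonical__probability_measure_Probability R 1 ltr01)
    measurable_idTR.

Lemma exE A : ex A = exponential_prob (1 : R) A. Proof. by []. Qed.

Lemma ex_lt0 : ex `]-oo, 0%R[%classic = 0%E.
Proof.
rewrite exE /exponential_prob integral0_eq// => x; rewrite /= in_itv /= => x0.
by rewrite /exponential_pdf patchE memNset//= in_itv/= andbT => /(lt_le_trans x0); rewrite ltxx.
Qed.

Lemma ex_set1 x : ex [set x] = 0%E.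
Proof. by rewrite exE /exponential_prob (@integral_Sset1 _ _ _ x). Qed.

Lemma ex_itv0c (x : R) : 0 <= x -> ex `[0, x]%classic = (1 - (expR (- x))%:E)%E.
Proof.
rewrite le_eqVlt => /orP[/eqP<-|x0].
  by rewrite set_itv1 ex_set1 oppr0 expR0 subee.
by rewrite exE exponential_prob_itv0c// mulN1r.
Qed.

Lemma ex_itvcy (x : R) : 0 <= x -> ex `[x, +oo[%classic = (expR (- x))%:E.
Proof.
move=> x0; rewrite -setCitvl probability_setC//.
have -> : `]-oo, x[%classic = `]-oo, 0[%classic `|` (`[0, x]%classic `\ x) :> set R.
  apply/seteqP; split => y /=; rewrite !in_itv/=.
    move=> yx; case: (ltP y 0) => y0; [by left|right].
    by rewrite (ltW yx); split => // e; rewrite e ltxx in yx.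
  by move=> [y0|[/andP[_ yx] /eqP xy]]; [exact: lt_le_trans x0|rewrite lt_neqAle xy].
rewrite measureU//; last 2 first.
  exact: measurableD.
  by rewrite -subset0 => y /= []; rewrite !in_itv/= => y0 [/andP[/(lt_le_trans y0)]]; rewrite ltxx.
rewrite [X in (_ - (X + _))%E]ex_lt0 add0e.
have E : ex (`[0, x]%classic `\ x) = (1 - (expR (- x))%:E)%E.
  rewrite -(ex_itv0c x0) [RHS](@measureDI _ _ _ ex _ [set x])//.
  rewrite [X in (_ + X)%E](_ : _ = 0%E) ?adde0//.
  by apply: (subset_measure0 _ _ _ (ex_set1 x)) => //; apply: measurableI.
rewrite [X in (_ - X)%E]E; set r := expR _.
by rewrite -!EFinB opprB addrC subrK.
Qed.

Lemma ex_itvcy_neg (x : R) : x <= 0 -> ex `[x, +oo[%classic = 1%E.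
Proof.
move=> x0; apply/eqP; rewrite eq_le probability_le1//=.
have := ex_itvcy (lexx 0); rewrite oppr0 expR0 => <-.
by apply: le_measure; rewrite ?inE// => y /=; rewrite !in_itv/= !andbT; exact: le_trans.
Qed.

Lemma ex_gt0 : {ae ex, forall x, 0 < x}.
Proof.
exists (`]-oo, 0%R[%classic `|` [set 0]); split.
- exact: measurableU.
- apply/eqP; rewrite eq_le measure_ge0 andbT.
  apply: le_trans (measureU2 _ _ _) _ => //.
  by rewrite [X in (X + _)%E]ex_lt0 [X in (_ + X)%E]ex_set1 adde0.
- move=> x /= /negP; rewrite -leNgt le_eqVlt => /orP[/eqP->|x0]; [by right|left].
  by rewrite /= in_itv.
Qed.

Lemma measurable_shift (s : R) (B : set R) : measurable B -> measurable [set b | B (s + b)].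
Proof.
move=> mB; have mf : measurable_fun setT (fun b : R => s + b).
  by apply: measurable_funD => //; exact: measurable_cst.
by have := mf measurableT B mB; rewrite setTI.
Qed.

Lemma setI_itvcy (x y : R) :
  `[x, +oo[%classic `&` `[y, +oo[%classic = `[Num.max x y, +oo[%classic.
Proof.
apply/seteqP; split => z /=; rewrite !in_itv/= !andbT ge_max; first by move=> [-> ->].
by move=> /andP[].
Qed.

(** Both sides are finite measures in [B], so half-lines suffice. A half-line starting before [s] is
    shifted to one starting before 0, which has full measure; for one starting after [s] the
    exponentials multiply. *)
Lemma memoryless s (B : set R) : 0 <= s -> measurable B ->
  (ex `[s, +oo[%classic * ex [set b | B (s + b)%R] = ex (`[s, +oo[ `&` B))%E.
Proof.
move=> s0 mB; rewrite ex_itvcy//.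
have mf : measurable_fun setT (fun b : R => s + b).
  by apply: measurable_funD => //; exact: measurable_cst.
pose m1 : {measure set R -> \bar R} := mscale (NngNum (expR_ge0 (- s))) (law ex mf).
have mI : measurable (`[s, +oo[%classic : set R) by [].
pose m2 : {measure set R -> \bar R} := mrestr ex mI.
transitivity (m2 B); last by rewrite /m2 /= /mrestr setIC.
change (m1 B = m2 B).
apply: (@measure_unique _ R R (@measurable_realfun.RGenCInfty.G R)
  (fun k => `[- k%:R, +oo[%classic) _ _ _ _ m1 m2) => //.
- exact: measurable_realfun.RGenCInfty.measurableE.
- move=> _ _ [x ->] [y ->]; exists (Num.max x y); exact: setI_itvcy.
- by move=> k; exists (- k%:R).
- apply/seteqP; split => // x _; exists (Num.truncn (`|x|)).+1 => //=.
  rewrite in_itv/= andbT lerNl.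
  apply: le_trans (ler_norm _) _; rewrite normrN ltW//.
  exact: truncnS_gt.
- move=> _ [x ->].
  change ((expR (- s)%R)%:E * ex [set b | `[x, +oo[%classic (s + b)%R] =
    ex (`[x, +oo[ `&` `[s, +oo[))%E.
  have -> : [set b | `[x, +oo[%classic (s + b)%R] = `[x - s, +oo[%classic :> set R.
    by apply/seteqP; split => b /=; rewrite !in_itv/= !andbT lerBlDl.
  have -> : `[x, +oo[%classic `&` `[s, +oo[%classic = `[Num.max x s, +oo[%classic :> set R.
    exact: setI_itvcy.
  case: (leP x s) => xs.
    by rewrite ex_itvcy_neg ?subr_le0// mule1 ex_itvcy.
  rewrite !ex_itvcy ?subr_ge0 ?(ltW xs)//; last exact: le_trans (ltW xs).
  by rewrite -EFinM -expRD; congr (expR _)%:E; ring.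
- move=> k; change ((expR (- s)%R)%:E * ex [set b | `[(- k%:R)%R, +oo[%classic (s + b)%R] < +oo)%E.
  apply: lte_mul_pinfty; rewrite ?lee_fin ?expR_ge0//.
  by apply: le_lt_trans (probability_le1 _ _) (ltry _); exact: measurable_shift.
Qed.

End exponential_law.

#[global] Opaque ex.

(** * Glued clocks have the law of the clocks *)

Section glue_law.
Context {R : realType}.
Implicit Types (q : probability (config R nat) R).

Lemma measurable_glue_seq d (T : measurableType d) n (s : T -> R)
    (a b : T -> config R nat) :
  measurable_fun setT s -> measurable_fun setT a -> measurable_fun setT b ->
  measurable_fun setT (fun w => glue_seq n (s w) (a w) (b w)).
Proof.
move=> ms ma mb.
have ma_ k : measurable_fun setT (fun w => a w k : R).
  exact: (measurableT_comp (measurable_coord k) ma).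
have mb_ k : measurable_fun setT (fun w => b w k : R).
  exact: (measurableT_comp (measurable_coord k) mb).
elim: n s a ms ma ma_ => [|n IH] s a ms ma ma_ /=.
  apply: measurable_fun_ifT => //; last exact: measurable_funD.
  exact: measurable_fun_ler.
apply: measurable_fun_ifT => //; first exact: measurable_fun_ler.
apply: (IH (fun w => s w - a w 0%N) (fun w => (a w \o S) : config R nat)).
- exact: measurable_funB.
- by apply: measurable_config => k; exact: ma_.
- by move=> k; exact: ma_.
Qed.

(** A sequence of independent gaps is a first gap followed by an independent copy of the sequence.
    This is the form in which the first gap of the first sequence is conditioned upon. *)
Lemma prod_iid_split q (A : set (config R nat * config R nat)) :
  iid ex q id -> measurable A ->
  prod_prob q q A = (\int[ex]_r prod_prob q q [set z | A (consc (r, z.1), z.2)])%E.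
Proof.
move=> iq mA.
pose F (z : R * (config R nat * config R nat)) := (consc (z.1, z.2.1), z.2.2).
have mF : measurable_fun setT F.
  apply: measurable_fun_pair; last exact: measurableT_comp.
  apply: (measurableT_comp measurable_consc).
  by apply: measurable_fun_pair => //; exact: measurableT_comp.
have mFA : measurable (F @^-1` A) by rewrite -[_ @^-1` _]setTI; exact: mF.
rewrite -(@prod_probE _ _ _ _ _ ex (prod_prob q q) _ mFA).
rewrite -(lawE (prod_prob ex (prod_prob q q)) mF).
apply/esym/prod_prob_unique => // {A mA mFA} A B mA mB.
rewrite lawE.
have mA' : measurable (consc @^-1` A : set (R * config R nat)).
  by rewrite -[_ @^-1` _]setTI; exact: measurable_consc.
have -> : q A = prod_prob ex q (consc @^-1` A).
  by apply: (iid_unique iq (iid_consc iq)).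
rewrite [LHS]prod_probE; last first.
  by rewrite -[_ @^-1` _]setTI; apply: mF => //; exact: measurableX.
rewrite [X in (X * _)%E]prod_probE// -ge0_integralZr//; last first.
  exact: measurable_fun_section.
apply: eq_integral => r _.
have -> : [set y | (F @^-1` (A `*` B)) (r, y)] = [set c | A (consc (r, c))] `*` B by [].
by rewrite [LHS]prod_probX//; exact: (measurable_section r mA').
Qed.

Lemma measurable_glue_box (m : nat) (s : R) (B : nat -> set R) :
  (forall n, measurable (B n)) ->
  measurable [set z : config R nat * config R nat |
    forall n, (n < m)%N -> B n (glue_seq n s z.1 z.2)].
Proof.
move=> mB.
rewrite (_ : [set z | _] = \bigcap_(i in `I_m)
  (fun z : config R nat * config R nat => glue_seq i s z.1 z.2) @^-1` B i)//.
apply: fin_bigcap_measurable => // i _; rewrite -[_ @^-1` _]setTI.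
by apply: (measurable_glue_seq i (s := fun=> s)).
Qed.

(* By induction on [m], conditioning on the first gap. *)
Lemma glue_seq_box q m (s : R) (B : nat -> set R) : iid ex q id -> 0 <= s ->
  (forall n, measurable (B n)) ->
  prod_prob q q [set z | forall n, (n < m)%N -> B n (glue_seq n s z.1 z.2)] =
  (\prod_(n < m) ex (B n))%E.
Proof.
move=> iq; elim: m s B => [|m IH] s B s0 mB.
  rewrite big_ord0 (_ : [set _ | _] = setT) ?probability_setT//.
  by apply/seteqP; split.
rewrite prod_iid_split//; last exact: measurable_glue_box.
pose p := (\prod_(n < m) ex (B n.+1))%E.
have p0 : (0 <= p)%E by apply: prode_ge0 => n _; exact: measure_ge0.
(* If the first gap [r] satisfies [s <= r], the glued sequence is the second one with its first gap
   lengthened by [s]; if [r < s], it starts with [r] and continues as a gluing at time [s - r], to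
   which the induction hypothesis applies. Each case contributes one term. *)
rewrite (eq_integral (fun r => (ex [set b | B 0%N (s + b)%R] * p *
    (\1_(`[s, +oo[) r)%:E + p * (\1_(`]-oo, s[ `&` B 0%N) r)%:E)%E)); last first.
  move=> r _; rewrite !indicE.
  case: (leP s r) => sr.
    have -> : (r \in `[s, +oo[%classic) by rewrite inE /= in_itv /= sr.
    have -> : (r \in (`]-oo, s[ `&` B 0%N)) = false.
      by apply/negbTE; rewrite notin_setE => -[/=]; rewrite in_itv/= ltNge sr.
    rewrite mule0 adde0 mule1.
    pose B' n := if n is 0%N then [set b | B 0%N (s + b)%R] else B n.
    have mB' n : measurable (B' n) by case: n => [|n]; [exact: (measurable_shift s (mB 0%N))|exact: mB].
    have -> : [set z | (forall n, (n < m.+1)%N ->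
        B n (glue_seq n s (consc (r, z.1)) z.2))] = setT `*`
        ([set b : config R nat | forall n, (n < m.+1)%N ->
          B' n (b n)]).
      apply/seteqP; split => -[a b] /= H.
        split=> // -[|n] nm; have := H _ nm; rewrite /= sr //.
      by move=> [|n] nm; have := H.2 _ nm; rewrite /= sr.
    rewrite prod_probX//; last exact: measurable_box.
    rewrite probability_setT mul1e.
    by have /iid_box_law -> // := iq; rewrite big_ord_recl.
  have -> : (r \in `[s, +oo[%classic) = false.
    by apply/negbTE; rewrite notin_setE /= in_itv /= andbT leNgt sr.
  rewrite mule0 add0e.
  case: (pselect (B 0%N r)) => Br.
    have -> : (r \in (`]-oo, s[ `&` B 0%N)) by rewrite inE; split; rewrite //= in_itv.
    have E : prod_prob q q [set z | forall n, (n < m)%N ->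
        B n.+1 (glue_seq n (s - r) z.1 z.2)] = p.
      by apply: (IH (s - r) (fun n => B n.+1)) => //; rewrite subr_ge0 ltW.
    rewrite mule1 -E.
    congr (prod_prob q q _); apply/seteqP; split => -[a b] /= H n nm.
      by have := H n.+1 nm; rewrite /= leNgt sr.
    case: n nm => [|n] nm; rewrite /= leNgt sr//=; exact: H.
  have -> : (r \in (`]-oo, s[ `&` B 0%N)) = false.
    by apply/negbTE; rewrite notin_setE => -[].
  rewrite mule0 (_ : [set z | _] = set0) ?measure0//.
  by rewrite -subset0 => -[a b] /= /(_ 0%N isT); rewrite /= leNgt sr.
have mI : measurable (`[s, +oo[%classic : set R) by [].
have mJ : measurable (`]-oo, s[%classic `&` B 0%N) by exact: measurableI.
have e0 : (0 <= ex [set b | B 0%N (s + b)%R] * p)%E by apply: mule_ge0.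
have mIe (D : set R) : measurable D -> measurable_fun setT (fun r : R => (\1_D r)%:E).
  by move=> mD; apply/measurable_EFinP; exact: measurable_indic.
have Ie0 (D : set R) (r : R) : setT r -> (0 <= (\1_D r)%:E :> \bar R)%E.
  by move=> _; rewrite lee_fin.
rewrite ge0_integralD//.
- rewrite !ge0_integralZl//; try exact: mIe.
  rewrite !integral_indic// !setIT.
  (* Memorylessness turns the first term into the part of [B 0] beyond [s], and the two parts of
     [B 0] add up. *)
  rewrite muleAC [X in (X * p + _)%E]muleC memoryless// (muleC p) -ge0_muleDl//.
  rewrite big_ord_recl; congr (_ * _)%E; rewrite -measureU//.
  + congr (ex _); rewrite -setIUl [X in X `&` _](_ : _ = setT) ?setTI//.
    apply/seteqP; split => // x _; rewrite /= !in_itv/= andbT.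
    by case: (leP s x); [left|right].
  + exact: measurableI.
  + rewrite -subset0 => x [[/= + _] [+ _]]; rewrite !in_itv/= andbT.
    by move=> /le_lt_trans/[apply]; rewrite ltxx.
- by move=> r _; apply: mule_ge0 => //; exact: Ie0.
- by apply: measurable_funeM; exact: mIe.
- by move=> r _; apply: mule_ge0 => //; exact: Ie0.
- by apply: measurable_funeM; exact: mIe.
Qed.

End glue_law.

Section glue_configurations.
Context {R : realType} {K : choiceType}.
Variable Q : probability (config R (K * nat)%type) R.
Hypothesis iQ : iid ex Q id.

Notation conf := (config R (K * nat)%type).

Definition row (x : K) (c : conf) : config R nat := fun n => c (x, n).

Definition glue_config (s : R) (z : conf * conf) : conf :=
  fun p => glue_seq p.2 s (row p.1 z.1) (row p.1 z.2).

Lemma measurable_row x : measurable_fun setT (row x).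
Proof. by apply: measurable_config => n; exact: measurable_coord. Qed.

Lemma measurable_glue_config s : measurable_fun setT (glue_config s).
Proof.
apply: measurable_config => p.
apply: (measurable_glue_seq p.2 (s := fun=> s)) => //.
  exact: (measurableT_comp (measurable_row _) measurable_fst).
exact: (measurableT_comp (measurable_row _) measurable_snd).
Qed.

Lemma iid_row x : iid ex (law Q (measurable_row x)) id.
Proof.
have [_ H] : iid ex Q (fun c n => c (x, n) : R).
  by apply: (iid_reindex (phi := pair x)) iQ => n m [].
by split; first exact: measurable_id.
Qed.

Lemma iid_boxes (J : {fset K}) (m : K -> nat) (B : K -> nat -> set R) :
  (forall x n, measurable (B x n)) ->
  Q [set c | forall x, x \in J -> forall n, (n < m x)%N -> B x n (c (x, n))] =
  (\prod_(x <- J) \prod_(n < m x) ex (B x n))%E.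
Proof.
move=> mB; pose L := [seq (x, n) | x <- J, n <- iota 0 (m x)].
have uL : uniq L.
  apply: allpairs_uniq_dep; first exact: fset_uniq.
    by move=> x _; exact: iota_uniq.
  by move=> [x n] [y k] /= _ _ [-> ->].
have LP x n : ((x, n) \in L) = (x \in J) && (n < m x)%N.
  apply/allpairsPdep/andP => [[y [k [yJ + [-> ->]]]]|[xJ nm]].
    by rewrite mem_iota.
  by exists x, n; rewrite mem_iota.
have [_ /(_ [fset p in L]%fset (fun p => B p.1 p.2))] := iQ.
move=> /(_ (fun p => mB p.1 p.2)).
rewrite (perm_big L) /=; last first.
  apply: uniq_perm => [||p]; [exact: fset_uniq|exact: uL|].
  by apply/imfsetP/idP => [[q /= + ->]//|]; exists p.
rewrite big_allpairs_dep /= => E.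
transitivity (\prod_(x <- J) \prod_(j <- iota 0 (m x)) ex (B x j))%E; last first.
  by apply: eq_bigr => x _; rewrite -(big_mkord xpredT (fun n => ex (B x n))) /index_iota subn0.
rewrite -E; congr (Q _); apply/seteqP; split => c /= H.
  move=> [x n] /imfsetP[p /= pL e]; move: pL; rewrite -e LP => /andP[xJ nm].
  exact: H.
move=> x xJ n nm; apply: (H (x, n)).
by apply/imfsetP; exists (x, n) => //=; rewrite LP xJ.
Qed.

(** The pi-system of a site constrains the row of that site in both configurations, so independence
    between sites only has to be checked on boxes. *)
Let G (x : K) : set (set (conf * conf)) :=
  [set A | exists (m : nat) (B B' : nat -> set R),
    (forall n, measurable (B n)) /\ (forall n, measurable (B' n)) /\
    A = [set c | forall n, (n < m)%N -> B n (c (x, n))] `*`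
        [set c | forall n, (n < m)%N -> B' n (c (x, n))]].

Let measurable_row_box (J : {fset K}) (m : K -> nat) (B : K -> nat -> set R) :
  (forall x n, measurable (B x n)) ->
  measurable [set c : conf | forall x, x \in J -> forall n, (n < m x)%N -> B x n (c (x, n))].
Proof.
move=> mB; rewrite (_ : [set c | _] = \bigcap_(x in [set` J]) \bigcap_(n in `I_(m x))
  ((fun c : conf => c (x, n)) @^-1` B x n))//.
apply: fin_bigcap_measurable => // x _; apply: fin_bigcap_measurable => // n _.
by rewrite -[_ @^-1` _]setTI; exact: (measurable_coord (x, n) measurableT).
Qed.

Let box1 x (m : nat) (B : nat -> set R) :
  [set c : conf | forall n, (n < m)%N -> B n (c (x, n))] =
  [set c | forall y, y \in [fset x]%fset -> forall n, (n < m)%N -> B n (c (y, n))].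
Proof.
apply/seteqP; split => c H.
  by move=> y; rewrite inE => /eqP->.
by apply: H; rewrite inE.
Qed.

Let measurable_box1 x (m : nat) (B : nat -> set R) : (forall n, measurable (B n)) ->
  measurable [set c : conf | forall n, (n < m)%N -> B n (c (x, n))].
Proof.
by move=> mB; rewrite box1; apply: (@measurable_row_box [fset x]%fset (fun=> m) (fun=> B)).
Qed.

Let iid_box1 x (m : nat) (B : nat -> set R) : (forall n, measurable (B n)) ->
  Q [set c : conf | forall n, (n < m)%N -> B n (c (x, n))] = (\prod_(n < m) ex (B n))%E.
Proof.
move=> mB; rewrite box1 (@iid_boxes [fset x]%fset (fun=> m) (fun=> B))//.
by rewrite big_seq_fset1.
Qed.

Let GI x : setI_closed (G x).
Proof.
move=> _ _ [m [B [B' [mB [mB' ->]]]]] [k [C [C' [mC [mC' ->]]]]].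
pose F m k (B C : nat -> set R) n := (if (n < m)%N then B n else setT) `&`
  (if (n < k)%N then C n else setT).
exists (maxn m k), (F m k B C), (F m k B' C').
split; first by move=> n; apply: measurableI; case: ifP.
split; first by move=> n; apply: measurableI; case: ifP.
have E (D D' : nat -> set R) :
    [set c : conf | forall n, (n < m)%N -> D n (c (x, n))] `&`
    [set c : conf | forall n, (n < k)%N -> D' n (c (x, n))] =
    [set c : conf | forall n, (n < maxn m k)%N -> F m k D D' n (c (x, n))].
  apply/seteqP; split => c /=.
    by move=> [H H'] n _; split; case: ifP => // nm; [exact: H|exact: H'].
  move=> H; split => n nm.
    by have [] := H n (leq_trans nm (leq_maxl _ _)); rewrite nm.
  by have [] := H n (leq_trans nm (leq_maxr _ _)); rewrite nm.
by rewrite -!E setXI.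
Qed.

Let Gm x : G x `<=` measurable.
Proof.
by move=> _ [m [B [B' [mB [mB' ->]]]]]; apply: measurableX; exact: measurable_box1.
Qed.

Let GT x : G x setT.
Proof.
exists 0%N, (fun=> setT), (fun=> setT); split => //; split => //.
by apply/seteqP; split.
Qed.

Let indG (J : {fset K}) (A : K -> set (conf * conf)) : (forall x, G x (A x)) ->
  prod_prob Q Q (\bigcap_(x in [set` J]) A x) = (\prod_(x <- J) prod_prob Q Q (A x))%E.
Proof.
move=> GA.
have [F FP] : {F : K -> nat * ((nat -> set R) * (nat -> set R)) & forall x,
    (forall n, measurable ((F x).2.1 n)) /\ (forall n, measurable ((F x).2.2 n)) /\
    A x = [set c | forall n, (n < (F x).1)%N -> (F x).2.1 n (c (x, n))] `*`
        [set c | forall n, (n < (F x).1)%N -> (F x).2.2 n (c (x, n))]}.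
  apply: (@choice _ _ (fun x (F : nat * ((nat -> set R) * (nat -> set R))) =>
    (forall n, measurable (F.2.1 n)) /\ (forall n, measurable (F.2.2 n)) /\
    A x = [set c | forall n, (n < F.1)%N -> F.2.1 n (c (x, n))] `*`
        [set c | forall n, (n < F.1)%N -> F.2.2 n (c (x, n))])) => x.
  by have [m [B [B' [mB [mB' AE]]]]] := GA x; exists (m, (B, B')).
have mF1 x n := (FP x).1 n.
have mF2 x n := (FP x).2.1 n.
rewrite (_ : \bigcap_(x in _) _ =
  [set c | forall x, x \in J -> forall n, (n < (F x).1)%N -> (F x).2.1 n (c (x, n))] `*`
  [set c | forall x, x \in J -> forall n, (n < (F x).1)%N -> (F x).2.2 n (c (x, n))]); last first.
  apply/seteqP; split => z H.
    by split => x xJ n nm; have := H x xJ; rewrite (FP x).2.2 => -[]; auto.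
  by move=> x xJ; rewrite (FP x).2.2; split => n nm; [exact: H.1|exact: H.2].
rewrite prod_probX//; last 2 first.
- exact: (@measurable_row_box J (fun x => (F x).1) (fun x => (F x).2.1)).
- exact: (@measurable_row_box J (fun x => (F x).1) (fun x => (F x).2.2)).
rewrite (@iid_boxes J (fun x => (F x).1) (fun x => (F x).2.1))//.
rewrite (@iid_boxes J (fun x => (F x).1) (fun x => (F x).2.2))//.
rewrite -big_split /=; apply: eq_bigr => x _.
rewrite (FP x).2.2 prod_probX//; try exact: measurable_box1.
by rewrite !iid_box1.
Qed.

(** Gluing acts on each row separately, and the rows of a pair of configurations are independent.
    This reduces the claim to a single row, where it is [glue_seq_box]. *)
Lemma iid_glue s : 0 <= s -> iid ex (prod_prob Q Q) (glue_config s).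
Proof.
move=> s0; split; first exact: measurable_glue_config.
move=> J B mB.
pose X := [fset p.1 | p in J]%fset.
have [m mP] := fset_nat_bound [fset p.2 | p in J]%fset.
pose B' x n := if (x, n) \in J then B (x, n) else setT.
have mB' x n : measurable (B' x n) by rewrite /B'; case: ifP.
have JE (c : conf) : (forall i, i \in J -> B i (c i)) <->
    (forall x, x \in X -> forall n, (n < m)%N -> B' x n (c (x, n))).
  split => [H x xX n nm|H [x n] xnJ].
    by rewrite /B'; case: ifP => // /H.
  have := H x _ n; rewrite /B' xnJ; apply.
    by apply/imfsetP; exists (x, n).
  by apply: mP; apply/imfsetP; exists (x, n).
rewrite -(iQ.2 J B mB) (_ : [set w | forall i, i \in J -> B i (id w i)] =
  [set c : conf | forall x, x \in X -> forall n, (n < m)%N -> B' x n (c (x, n))]); last first.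
  by apply/seteqP; split => c /JE.
rewrite (@iid_boxes X (fun=> m) B')//.
pose E x := [set z : conf * conf | forall n, (n < m)%N ->
  B' x n (glue_seq n s (row x z.1) (row x z.2))].
rewrite (_ : [set _ | _] = \bigcap_(x in [set` X]) E x); last first.
  apply/seteqP; split => z H; last first.
    by apply: (JE (glue_config s z)).2 => x xX n nm; exact: (H x xX n nm).
  by move=> x xX n nm; exact: ((JE (glue_config s z)).1 H x xX n nm).
(* That gluing at [x] reads only the row of [x] is obtained by repeating the measurability argument
   on the product equipped with the sigma-algebra generated by [G x]. *)
have sE x : <<s G x >> (E x).
  pose W := g_sigma_algebraType (G x).
  have mW1 : measurable_fun setT (fun z : W => row x z.1).
    apply: measurable_config => n; move=> _ D mD; rewrite setTI.
    apply: sub_sigma_algebra.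
    exists n.+1, (fun k => if k == n then D else setT), (fun=> setT).
    split; first by move=> k; case: ifP.
    split=> //; apply/seteqP; split => z /= H.
      by split => // k _; case: eqP => // ->.
    by have := H.1 n (ltnSn n); rewrite eqxx.
  have mW2 : measurable_fun setT (fun z : W => row x z.2).
    apply: measurable_config => n; move=> _ D mD; rewrite setTI.
    apply: sub_sigma_algebra.
    exists n.+1, (fun=> setT), (fun k => if k == n then D else setT).
    split=> //; split; first by move=> k; case: ifP.
    apply/seteqP; split => z /= H.
      by split => // k _; case: eqP => // ->.
    by have := H.2 n (ltnSn n); rewrite eqxx.
  have : measurable (\bigcap_(n in `I_m)
      (fun z : W => glue_seq n s (row x z.1) (row x z.2)) @^-1` B' x n).
    apply: fin_bigcap_measurable => // n _; rewrite -[_ @^-1` _]setTI.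
    exact: (measurable_glue_seq n (s := fun=> s) _ mW1 mW2 measurableT).
  by [].
rewrite (independent_sigma GI Gm GT indG)//; apply: eq_bigr => x _.
pose rr (z : conf * conf) := (row x z.1, row x z.2).
have mrr : measurable_fun setT rr.
  apply: measurable_fun_pair.
    exact: (measurableT_comp (measurable_row _) measurable_fst).
  exact: (measurableT_comp (measurable_row _) measurable_snd).
rewrite -(@glue_seq_box _ (law Q (measurable_row x)) m s (B' x) (iid_row x) s0)//.
rewrite -(lawE (prod_prob Q Q) mrr [set z | forall n, (n < m)%N ->
  B' x n (glue_seq n s z.1 z.2)]).
apply: prod_prob_unique; last exact: measurable_glue_box.
move=> A A' mA mA'.
transitivity (prod_prob Q Q ((row x @^-1` A) `*` (row x @^-1` A'))); first by [].
by rewrite [LHS]prod_probX// -[_ @^-1` _]setTI; exact: measurable_row.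
Qed.

(** Memorylessness of the whole system of clocks: independent fresh clocks may be started at time
    [s]. *)
Lemma law_glue s (A : set conf) : 0 <= s -> measurable A ->
  Q A = prod_prob Q Q [set z | A (glue_config s z)].
Proof. by move=> s0 mA; exact: (iid_unique iQ (iid_glue s0) mA). Qed.

End glue_configurations.

(** * Measurability of maps with countably many values *)

Section countable_measurability.
Context d (T : measurableType d).

Lemma measurable_cst_set (p : Prop) : measurable [set _ : T | p].
Proof.
case: (pselect p) => h; [rewrite (_ : mkset _ = setT)|rewrite (_ : mkset _ = set0)] => //.
  by apply/seteqP; split.
by rewrite -subset0.
Qed.

Lemma measurable_is_true (b : T -> bool) :
  measurable_fun setT b -> measurable [set w | b w].
Proof. by move=> /(_ measurableT [set true]); rewrite setTI; exact. Qed.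

(** Intermediate values such as lists of updates lie in countable types without a chosen
    sigma-algebra. Measurability of the fibres is preserved by arbitrary maps between such types. *)
Definition cmeasurable (X : countType) (h : T -> X) :=
  forall x, measurable [set w | h w = x].

Lemma cmeasurable_preimage (X : countType) (h : T -> X) (A : set X) :
  cmeasurable h -> measurable [set w | A (h w)].
Proof.
move=> mh; rewrite (_ : [set w | _] = \bigcup_x ([set w | h w = x] `&` [set w | A x])).
  apply: countable_bigcupT_measurable => // x; apply: measurableI; first exact: mh.
  exact: measurable_cst_set.
apply/seteqP; split => w /=; first by exists (h w).
by move=> [x _ [->]].
Qed.

Lemma cmeasurable_comp (X Y : countType) (h : T -> X) (k : X -> Y) :
  cmeasurable h -> cmeasurable (k \o h).
Proof. by move=> mh y; exact: (cmeasurable_preimage [set x | k x = y] mh). Qed.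

Lemma cmeasurable_bind (X Y : countType) (h : T -> X) (k : X -> T -> Y) :
  cmeasurable h -> (forall x, cmeasurable (k x)) -> cmeasurable (fun w => k (h w) w).
Proof.
move=> mh mk y.
rewrite (_ : [set w | _] = \bigcup_x ([set w | h w = x] `&` [set w | k x w = y])).
  apply: countable_bigcupT_measurable => // x; apply: measurableI; [exact: mh|exact: mk].
apply/seteqP; split => w /=; first by exists (h w).
by move=> [x _ [<- <-]].
Qed.

Lemma cmeasurable_pair (X Y : countType) (h : T -> X) (k : T -> Y) :
  cmeasurable h -> cmeasurable k -> cmeasurable (fun w => (h w, k w)).
Proof.
move=> mh mk; apply: (@cmeasurable_bind _ _ h (fun x w => (x, k w))) => // x.
exact: (cmeasurable_comp (pair x) mk).
Qed.

Lemma cmeasurable_cst (X : countType) (x : X) : cmeasurable (fun=> x).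
Proof.
by move=> y; exact: measurable_cst_set.
Qed.

Lemma cmeasurable_bool (b : T -> bool) :
  measurable [set w | b w] -> cmeasurable b.
Proof.
move=> mb [|]; first by [].
rewrite (_ : [set w | _] = ~` [set w | b w]); first exact: measurableC.
by apply/seteqP; split => w /= => [-> //|/negP/negbTE].
Qed.

End countable_measurability.

(** * Random fields and their gradients *)

Section fields.
Variable d : nat.

Lemma open_cylinder (x : site d) (v : int) : open [set f : field_space d | f x = v].
Proof.
rewrite openE => f /= fx.
apply: (@proj_continuous (site d) (fun=> discrete_topology int) x f [set v]).
rewrite /proj -fx; exact: discrete_set1.
Qed.

Lemma cmeasurable_field_coord (x : site d) : cmeasurable (fun f : field d => f x).
Proof. by move=> v; apply: sub_sigma_algebra; exact: open_cylinder. Qed.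

(** The sets containing a cylinder around [f] form a filter. It converges to [f] in the product
    topology, since each coordinate is eventually constant along it, and so it contains every
    neighbourhood of [f]. *)
Lemma nbhs_cylinder (f : field_space d) U : nbhs f U ->
  exists S : seq (site d), [set g : field_space d | {in S, f =1 g}] `<=` U.
Proof.
move=> fU.
pose F : set_system (field_space d) := [set V | exists S : seq (site d),
  [set g : field_space d | {in S, f =1 g}] `<=` V].
have FF : Filter F.
  split.
  - by exists [::].
  - move=> V W [S SV] [S' SW]; exists (S ++ S') => g H; split.
      by apply: SV => x xS; apply: H; rewrite mem_cat xS.
    by apply: SW => x xS; apply: H; rewrite mem_cat xS orbT.
  - by move=> V W VW [S SV]; exists S; exact: subset_trans SV VW.
suff : F --> f by apply.
rewrite cvg_sup => x; rewrite cvg_image; last first.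
  by rewrite eqEsubset; split => // v _; exists (fun=> v).
move=> W /= /nbhs_singleton Wfx; exists (@^~ x @^-1` W); last first.
  by rewrite eqEsubset; split => [_ [g + <-]//|v Wv]; exists (fun=> v).
exists [:: x] => g H /=.
by rewrite -H ?mem_head.
Qed.

Definition finitely_determined (A : set (site d -> int)) :=
  exists S : seq (site d), forall f g, {in S, f =1 g} -> A f -> A g.

Lemma finitely_determined_eqv A : finitely_determined A ->
  exists S : seq (site d), forall f g, {in S, f =1 g} -> A f <-> A g.
Proof.
move=> [S H]; exists S => f g fg; split; apply: H => // x xS; exact/esym/fg.
Qed.

Lemma finitely_determinedC A : finitely_determined A -> finitely_determined (~` A).
Proof.
move=> /finitely_determined_eqv[S H]; exists S => f g fg nA Ag.
by apply: nA; apply/(H f g fg).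
Qed.

Lemma finitely_determinedI A B : finitely_determined A -> finitely_determined B ->
  finitely_determined (A `&` B).
Proof.
move=> [S H] [S' H']; exists (S ++ S') => f g fg [Af Bf]; split.
  by apply: H Af => x xS; apply: fg; rewrite mem_cat xS.
by apply: H' Bf => x xS; apply: fg; rewrite mem_cat xS orbT.
Qed.

Lemma finitely_determinedU A B : finitely_determined A -> finitely_determined B ->
  finitely_determined (A `|` B).
Proof.
move=> mA mB; rewrite -[A `|` B]setCK setCU.
by apply/finitely_determinedC/finitely_determinedI; exact: finitely_determinedC.
Qed.

Lemma finitely_determinedT : finitely_determined setT.
Proof. by exists [::]. Qed.

Lemma finitely_determined0 : finitely_determined set0.
Proof. by exists [::]. Qed.

Lemma finitely_determined_coord x (B : set int) :
  finitely_determined [set f | B (f x)].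
Proof. by exists [:: x] => f g fg /=; rewrite fg ?mem_head. Qed.

Lemma cmeasurable_restrict (S : seq (site d)) :
  cmeasurable (fun f : field d => [seq f x | x <- S]).
Proof.
elim: S => [|x S IH] /=; first exact: cmeasurable_cst.
exact: (cmeasurable_comp (fun p => p.1 :: p.2)
  (cmeasurable_pair (cmeasurable_field_coord x) IH)).
Qed.

Lemma map_eq_in (S : seq (site d)) (f g : site d -> int) :
  [seq f x | x <- S] = [seq g x | x <- S] <-> {in S, f =1 g}.
Proof. by split=> [/eq_in_map//|H]; apply/eq_in_map. Qed.

Lemma measurable_finitely_determined (A : set (field d)) :
  finitely_determined A -> measurable A.
Proof.
move=> [S H].
have := cmeasurable_preimage
  [set s | exists2 f, A f & [seq f x | x <- S] = s] (cmeasurable_restrict S).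
congr (measurable _); apply/seteqP; split => f /=; last by exists f.
by move=> [g Ag /map_eq_in gf]; exact: H Ag.
Qed.

(** There are only countably many pairs of a finite list of sites and a list of heights, and an open
    set is the union of the cylinders given by such pairs that it contains. *)
Lemma measurable_fieldE :
  @measurable _ (field d) = <<s [set A : set (field d) | finitely_determined A] >>.
Proof.
apply/seteqP; split; last first.
  apply: smallest_sub; first exact: sigma_algebra_measurable.
  by move=> A /measurable_finitely_determined.
apply: smallest_sub; first exact: smallest_sigma_algebra.
move=> U oU.
have -> : U = \bigcup_(p : seq (site d) * seq int)
    [set f : field d | [seq f x | x <- p.1] = p.2 /\
       forall g, [seq g x | x <- p.1] = p.2 -> U g].
  apply/seteqP; split => f.
    move=> Uf; have [S SU] := nbhs_cylinder (open_nbhs_nbhs (conj oU Uf)).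
    exists (S, [seq f x | x <- S]) => //=; split => // g /esym/map_eq_in fg.
    exact: SU.
  by move=> [p _ /= [e H]]; exact: H.
pose W : measurableType _ := g_sigma_algebraType [set A : set (field d) | finitely_determined A].
apply: (@countable_bigcupT_measurable _ W); first exact: countableP.
move=> p.
apply: sub_sigma_algebra; exists p.1 => f g /map_eq_in e /= [e1 H]; split => //.
by rewrite -e.
Qed.

Lemma finitely_determined_setI :
  setI_closed [set A : set (field d) | finitely_determined A].
Proof. exact: finitely_determinedI. Qed.

Lemma measurable_field dT (T : measurableType dT) (X : T -> field d) :
  (forall x, cmeasurable (fun w => X w x)) -> measurable_fun setT X.
Proof.
move=> mX; apply: (@measurability _ _ _ _ setT X
  ([set A | finitely_determined A] : set (set (field d)))).
  exact: measurable_fieldE.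
move=> _ [A [S H] <-]; rewrite setTI.
have mS : cmeasurable (fun w => [seq X w x | x <- S]).
  elim: S {H} => [|x S IH] /=; first exact: cmeasurable_cst.
  exact: (cmeasurable_comp (fun p => p.1 :: p.2) (cmeasurable_pair (mX x) IH)).
have := cmeasurable_preimage [set s | exists2 f, A f & [seq f x | x <- S] = s] mS.
congr (measurable _); apply/seteqP; split => w /=; last by exists (X w).
by move=> [g Ag /map_eq_in gf]; exact: H Ag.
Qed.

Lemma field_prob_eq (R : realType) (P P' : probability (field d) R) :
  (forall A, finitely_determined A -> P A = P' A) ->
  forall A, measurable A -> P A = P' A.
Proof.
apply: (@probability_eq _ _ (field d) [set A | finitely_determined A]).
  exact: measurable_fieldE.
exact: finitely_determined_setI.
Qed.

End fields.

Section gradients.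
Variable d : nat.

Lemma cvg_ptws (U : choiceType) (V : topologicalType) (F : set_system {ptws U -> V})
    (f : {ptws U -> V}) : Filter F ->
  (forall x W, nbhs (f x) W -> F (@^~ x @^-1` W)) -> F --> f.
Proof.
move=> FF H; rewrite cvg_sup => x; rewrite cvg_image; last first.
  by rewrite eqEsubset; split => // v _; exists (fun=> v).
move=> W /= Wfx; exists (@^~ x @^-1` W); last first.
  by rewrite eqEsubset; split => [_ [g + <-]//|v Wv]; exists (fun=> v).
exact: H.
Qed.

Lemma delta_continuous (f : field_space d) : (@delta d) @ nbhs f --> delta f.
Proof.
apply: (@cvg_ptws (site d) {ptws 'I_d -> discrete_topology int}) => x W nW.
have : (fun g : field_space d => delta g x) @ nbhs f --> delta f x.
  apply: (@cvg_ptws 'I_d (discrete_topology int)) => i B /nbhs_singleton Bf.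
  rewrite /nbhs /=.
  apply: (@filterS _ (nbhs f) _ ([set g : field_space d | g (x + unit_vec i) = f (x + unit_vec i)] `&`
     [set g : field_space d | g x = f x])).
    by move=> g /= [g1 g2]; rewrite /delta /= g1 g2.
  apply: filterI; apply: open_nbhs_nbhs; split => //; exact: open_cylinder.
by apply.
Qed.

Lemma measurable_grad : measurable_fun setT (@grad d).
Proof.
apply: (@measurability _ _ (field d) (gradient_field d) setT (@grad d)
  (@open (gradient_space d))) => //.
move=> _ [A oA <-]; rewrite setTI; apply: sub_sigma_algebra.
have [W oW WA] : exists2 W, open W & set_val @^-1` W = A by exact: oA.
suff : @open (field_space d) ((@grad_def d) @^-1` A) by [].
rewrite openE => f /= Af.
have : (@delta d @ nbhs f) W.
  apply: delta_continuous; apply: open_nbhs_nbhs; split => //.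
  by move: Af; rewrite -WA.
by rewrite /nbhs /= -WA.
Qed.

Lemma cmeasurable_slope x i : cmeasurable (fun v : gradient_field d => slope v x i).
Proof.
move=> k; apply: sub_sigma_algebra.
pose W := [set u : {ptws site d -> {ptws 'I_d -> discrete_topology int}} | u x i = k].
have oW : open W.
  rewrite openE => u uk.
  apply: (@proj_continuous (site d) (fun=> {ptws 'I_d -> discrete_topology int}) x u
    [set a | a i = k]).
  apply: (@proj_continuous 'I_d (fun=> discrete_topology int) i (u x) [set k]).
  by rewrite /proj uk; exact: discrete_set1.
by exists W.
Qed.

Lemma slope_grad (f : field d) x i : slope (grad f) x i = f (x + unit_vec i) - f x.
Proof. by []. Qed.

(** The choice of a preimage is harmless: preimages differ by a constant, which subtracting the
    value at the origin removes. *)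
Definition potential (v : gradient_field d) : field d :=
  fun x => projT1 (cid2 (set_mem (valP v))) x - projT1 (cid2 (set_mem (valP v))) 0.

Lemma grad_eq (f g : field d) : delta f = delta g -> grad f = grad g.
Proof. by move=> e; apply: val_inj. Qed.

Lemma potentialK v : grad (potential v) = v.
Proof.
apply: val_inj => /=; rewrite /potential; case: cid2 => f _ /= <-.
by apply/funext => x; apply/funext => i; rewrite /delta opprB addrA subrK.
Qed.

Lemma potential0 v : potential v 0 = 0. Proof. by rewrite /potential subrr. Qed.

Lemma potentialS v x i :
  potential v (x + unit_vec i) = potential v x + slope v x i.
Proof.
by have := slope_grad (potential v) x i; rewrite potentialK => ->; rewrite [RHS]addrC subrK.
Qed.

Lemma site_ind (p : site d -> Prop) : p 0 ->
  (forall x i, p x -> p (x + unit_vec i)) -> (forall x i, p x -> p (x - unit_vec i)) ->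
  forall x, p x.
Proof.
move=> p0 pD pB x.
have pZ y i (k : int) : p y -> p (y + k *: unit_vec i).
  move=> py; elim/int_ind: k => [|n IH|n IH]; first by rewrite scale0r addr0.
    by rewrite intS scalerDl scale1r (addrC (unit_vec i)) addrA; exact: pD.
  by rewrite intS opprD scalerDl scaleN1r (addrC (- unit_vec i)) addrA; exact: pB.
rewrite (row_sum_delta x).
elim: (index_enum 'I_d) => [|i r IH]; first by rewrite big_nil.
by rewrite big_cons addrC; exact: pZ.
Qed.

Lemma potential_unique v (f : field d) : grad f = v -> potential v = (fun x => f x - f 0).
Proof.
move=> <-; apply/funext => x.
elim/site_ind: x => [|x i IH|x i IH]; first by rewrite potential0 subrr.
  by rewrite potentialS slope_grad IH; lia.
have := potentialS (grad f) (x - unit_vec i) i.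
by rewrite slope_grad subrK IH; lia.
Qed.

(** The choice in the definition says nothing about measurability, but along a lattice path from the
    origin each value is a finite signed sum of slopes. *)
Lemma measurable_potential : measurable_fun setT potential.
Proof.
apply: measurable_field; elim/site_ind => [|x i IH|x i IH].
- rewrite (_ : (fun v => potential v 0) = fun=> 0); first exact: cmeasurable_cst.
  by apply/funext => v; exact: potential0.
- rewrite (_ : (fun v => _) = (fun p : int * int => p.1 + p.2) \o
    (fun v => (potential v x, slope v x i))); last by apply/funext => v; exact: potentialS.
  by apply: cmeasurable_comp; apply: cmeasurable_pair => //; exact: cmeasurable_slope.
- rewrite (_ : (fun v => _) = (fun p : int * int => p.1 - p.2) \o
    (fun v => (potential v x, slope v (x - unit_vec i) i))); last first.
    by apply/funext => v; have := potentialS v (x - unit_vec i) i; rewrite subrK /=; lia.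
  by apply: cmeasurable_comp; apply: cmeasurable_pair => //; exact: cmeasurable_slope.
Qed.

End gradients.

(** * Almost sure finiteness of the heights *)

Section measurable_heights.
Context {R : realType} {d : nat}.
Notation conf := (config R (site d * nat)%type).
Implicit Types (D : {fset site d}) (t : R) (c : conf).

Definition clocks c : site d -> nat -> R := fun x n => c (x, n).

Lemma measurable_ring_time (x : site d) n :
  measurable_fun setT (fun c : conf => ring_time (clocks c) x n).
Proof.
rewrite /ring_time; apply: measurable_sum => k; exact: measurable_coord.
Qed.

Let before D t (p : site d * nat) : set conf :=
  [set c | rings_before (clocks c) D t p].

Let measurable_before D t p : measurable (before D t p).
Proof.
rewrite (_ : before D t p = [set _ | p.1 \in D] `&`
  ((fun c => ring_time (clocks c) p.1 p.2) @^-1` `[0, t[%classic)); last first.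
  by apply/seteqP; split => c /=; rewrite in_itv.
apply: measurableI.
  exact: measurable_cst_set.
rewrite -[_ @^-1` _]setTI; exact: (measurable_ring_time p.1 p.2 measurableT).
Qed.

Lemma countable_bigcap_measurable (X : countType) (F : X -> set conf) :
  (forall x, measurable (F x)) -> measurable (\bigcap_x F x).
Proof.
move=> mF; rewrite -[\bigcap_x _]setCK; apply: measurableC; rewrite setC_bigcap.
by apply: countable_bigcupT_measurable => [|x]; [exact: countableP|exact: measurableC].
Qed.

Let is_before D t (F : {fset site d * nat}) : set conf :=
  [set c | rings_before (clocks c) D t = [set` F]].

Let measurable_is_before D t F : measurable (is_before D t F).
Proof.
rewrite (_ : is_before D t F =
  \bigcap_p (if p \in F then before D t p else ~` before D t p)).
  by apply: countable_bigcap_measurable => p; case: ifP => _; [|apply: measurableC].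
apply/seteqP; split => c.
  move=> H p _; by case: ifP => pF; rewrite /before /= H /= ?pF.
move=> H; apply/seteqP; split => p /=; have := H p I; case: ifP => //.
Qed.

Let fset_set_inf (A : set (site d * nat)) : ~ finite_set A -> fset_set A = fset0.
Proof. by move=> nA; rewrite /fset_set; case: pselect. Qed.

Lemma cmeasurable_rings_before D t :
  cmeasurable (fun c : conf => fset_set (rings_before (clocks c) D t)).
Proof.
move=> F.
(* The fibre over [fset0] also contains the configurations with infinitely many rings, because
   [fset_set] sends infinite sets to [fset0]. *)
have -> : [set c : conf | fset_set (rings_before (clocks c) D t) = F] =
    is_before D t F `|` (~` (\bigcup_F' is_before D t F') `&` [set _ | F = fset0]).
  apply/seteqP; split => c /=.
    move=> <-; case: (pselect (finite_set (rings_before (clocks c) D t))) => fin.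
      by left; rewrite /is_before /= fset_setK.
    right; split; last by rewrite fset_set_inf.
    by move=> [F' _ H]; apply: fin; rewrite H; exact: finite_fset.
  move=> [->|[H ->]]; first by rewrite set_fsetK.
  apply: fset_set_inf => fin; apply: H.
  by exists (fset_set (rings_before (clocks c) D t)) => //; rewrite /is_before /= fset_setK.
apply: measurableU => //; apply: measurableI.
  by apply: measurableC; apply: countable_bigcupT_measurable => //; exact: countableP.
exact: measurable_cst_set.
Qed.

(** Sorting depends on the ring times only through the finite table of comparisons between the
    entries of [s]. *)
Lemma cmeasurable_sort (s : seq (site d * nat)) : cmeasurable (fun c : conf =>
  sort (fun p q => ring_time (clocks c) p.1 p.2 <= ring_time (clocks c) q.1 q.2) s).
Proof.
pose n := size s.
pose table (c : conf) : {ffun 'I_n * 'I_n -> bool} := [ffun ij : 'I_n * 'I_n =>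
  ring_time (clocks c) (tnth (in_tuple s) ij.1).1 (tnth (in_tuple s) ij.1).2 <=
  ring_time (clocks c) (tnth (in_tuple s) ij.2).1 (tnth (in_tuple s) ij.2).2].
have mt : cmeasurable table.
  move=> T; rewrite (_ : [set c | _] = \bigcap_ij [set c | table c ij = T ij]).
    apply: countable_bigcap_measurable => ij.
    apply: (cmeasurable_bool (b := fun c => table c ij)).
    rewrite (_ : [set c | _] = [set c : conf |
      ring_time (clocks c) (tnth (in_tuple s) ij.1).1 (tnth (in_tuple s) ij.1).2 <=
      ring_time (clocks c) (tnth (in_tuple s) ij.2).1 (tnth (in_tuple s) ij.2).2]); last first.
      by apply/seteqP; split => c /=; rewrite ffunE.
    by apply: measurable_is_true; apply: measurable_fun_ler; exact: measurable_ring_time.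
  apply/seteqP; split => c /=; first by move=> <-.
  by move=> H; apply/ffunP => ij; exact: H.
rewrite (_ : (fun c => _) = (fun T : {ffun 'I_n * 'I_n -> bool} =>
  map (tnth (in_tuple s)) (sort (fun i j => T (i, j)) (fintype.enum_mem (mem 'I_n)))) \o table).
  exact: cmeasurable_comp mt.
apply/funext => c /=.
transitivity (sort (fun p q => ring_time (clocks c) p.1 p.2 <= ring_time (clocks c) q.1 q.2)
    (map (tnth (in_tuple s)) (fintype.enum_mem (mem 'I_n)))).
  by rewrite map_tnth_enum.
rewrite sort_map; congr map.
by congr (sort _ _); apply/funext => i; apply/funext => j; rewrite /table ffunE.
Qed.

Lemma cmeasurable_updates D t : cmeasurable (fun c : conf => updates (clocks c) D t).
Proof.
rewrite /updates /ring_list; apply: (@cmeasurable_comp _ _ _ _ _ (map fst)).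
exact: (@cmeasurable_bind _ _ _ _ (fun c : conf => fset_set (rings_before (clocks c) D t))
  (fun F c => sort (fun p q => ring_time (clocks c) p.1 p.2 <=
     ring_time (clocks c) q.1 q.2) F) (cmeasurable_rings_before D t)
   (fun F => cmeasurable_sort F)).
Qed.

Lemma cmeasurable_run l x : cmeasurable (fun f : field d => run f l x).
Proof.
move=> v; apply: measurable_finitely_determined.
exists (x :: flatten [seq lazy_nbrs z | z <- l]) => f g fg /= <-.
by apply/esym/run_eq_on.
Qed.

Lemma cmeasurable_pullback dT dT' (T : measurableType dT) (T' : measurableType dT')
    (X : countType) (h : T -> X) (k : T' -> T) :
  measurable_fun setT k -> cmeasurable h -> cmeasurable (h \o k).
Proof.
by move=> mk mh x; have := mk measurableT _ (mh x); rewrite setTI.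
Qed.

Lemma cmeasurable_finite_height D t x : cmeasurable (fun z : field d * conf =>
  finite_height (clocks z.2) z.1 D t x).
Proof.
rewrite (_ : (fun z => _) = (fun z => run z.1 (updates (clocks z.2) D t) x)); last first.
  by apply/funext => z; rewrite finite_heightE.
apply: (@cmeasurable_bind _ _ _ _ (fun z : field d * conf => updates (clocks z.2) D t)
  (fun l z => run z.1 l x)).
  exact: (cmeasurable_pullback measurable_snd (cmeasurable_updates D t)).
by move=> l; exact: (cmeasurable_pullback measurable_fst (cmeasurable_run l x)).
Qed.

Lemma measurable_height t :
  measurable_fun setT (fun z : field d * conf => height (clocks z.2) z.1 t).
Proof.
apply: measurable_field => x.
pose C v := [set z : field d * conf | exists D0 : {fset site d}, forall D,
  (D0 `<=` D)%fset -> finite_height (clocks z.2) z.1 D t x = v].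
have mC v : measurable (C v).
  rewrite (_ : C v = \bigcup_D0 ~` \bigcup_D ([set _ | (D0 `<=` D)%fset] `&`
     ~` [set z | finite_height (clocks z.2) z.1 D t x = v])).
    apply: countable_bigcupT_measurable; first exact: countableP.
    move=> D0; apply: measurableC.
    apply: countable_bigcupT_measurable; first exact: countableP.
    move=> D; apply: measurableI; last first.
      by apply: measurableC; exact: cmeasurable_finite_height.
    exact: measurable_cst_set.
  apply/seteqP; split => z.
    by move=> [D0 H]; exists D0 => // -[D _ [/= h]]; apply; exact: H.
  move=> [D0 _ H]; exists D0 => D D0D; apply: contrapT => h.
  by apply: H; exists D.
have C_inj z v v' : C v z -> C v' z -> v = v'.
  move=> [D0 H0] [D1 H1].
  by rewrite -(H0 (D0 `|` D1)%fset) ?fsubsetUl// (H1 (D0 `|` D1)%fset) ?fsubsetUr.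
(* The value 0 is also the default where no limit exists. *)
move=> v; rewrite (_ : [set z | _] = C v `|` ([set _ | v = 0] `\` \bigcup_u C u)).
  apply: measurableU => //; apply: measurableD.
    exact: measurable_cst_set.
  by apply: countable_bigcupT_measurable => //; exact: countableP.
apply/seteqP; split => z; rewrite /= /height.
  case: xgetP => [u _ Cu <-|H <-]; first by left.
  by right; split => // -[u _ Cu]; exact: (H u).
case: xgetP => [u _ Cu [/(C_inj _ _ _ Cu)//|[_ []]]|H [Cv|[->//]]].
  by exists u.
by case: (H v).
Qed.

(** The quantifier over initial fields is uncountable, but it only concerns two lists of updates,
    which take countably many values. *)
Lemma measurable_finitely_influenced t :
  measurable [set c : conf | finitely_influenced (clocks c) t].
Proof.
pose S (l l' : seq (site d)) x := forall f, run f l x = run f l' x.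
rewrite (_ : [set c | _] = \bigcap_x \bigcup_D0 \bigcap_D
  ([set _ | ~~ (D0 `<=` D)%fset] `|`
   [set c | S (updates (clocks c) D t) (updates (clocks c) D0 t) x])).
  apply: countable_bigcap_measurable => x.
  apply: countable_bigcupT_measurable; first exact: countableP.
  move=> D0; apply: countable_bigcap_measurable => D.
  apply: measurableU; last first.
    apply: (cmeasurable_preimage [set p | S p.1 p.2 x]
      (cmeasurable_pair (cmeasurable_updates D t) (cmeasurable_updates D0 t))).
  exact: measurable_cst_set.
apply/seteqP; split => c /= H x.
  move=> _; have [D0 H0] := H x; exists D0 => // D _.
  by case: (boolP (D0 `<=` D)%fset) => h; [right => f; exact: H0|left].
have [D0 _ H0] := H x I; exists D0 => D D0D f.
by have [/=|] := H0 D I; [rewrite D0D|exact].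
Qed.

Lemma measurable_regular : measurable [set c : conf | regular (clocks c)].
Proof.
rewrite (_ : [set c | _] = (\bigcap_p [set c : conf | 0 < c p]) `&`
  (\bigcap_(xk : site d * nat) \bigcup_n [set c : conf | xk.2%:R <= ring_time (clocks c) xk.1 n]) `&`
  (\bigcap_(pq : (site d * nat) * (site d * nat)) ([set _ | pq.1 = pq.2] `|`
     ~` [set c : conf | ring_time (clocks c) pq.1.1 pq.1.2 = ring_time (clocks c) pq.2.1 pq.2.2]))).
  apply: measurableI; [apply: measurableI|].
  - apply: countable_bigcap_measurable => p.
    by apply: measurable_is_true; apply: measurable_fun_ltr => //; exact: measurable_coord.
  - apply: countable_bigcap_measurable => p; apply: bigcupT_measurable => n.
    by apply: measurable_is_true; apply: measurable_fun_ler => //; exact: measurable_ring_time.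
  - apply: countable_bigcap_measurable => pq; apply: measurableU.
      exact: measurable_cst_set.
    apply: measurableC; rewrite (_ : [set c | _] = [set c : conf |
      ring_time (clocks c) pq.1.1 pq.1.2 == ring_time (clocks c) pq.2.1 pq.2.2]).
      by apply: measurable_is_true; apply: measurable_fun_eqr; exact: measurable_ring_time.
    by apply/seteqP; split => c /= /eqP.
apply/seteqP; split => c /=.
  move=> [h1 h2 h3]; split; [split|].
  - by move=> [x n] _; exact: h1.
  - by move=> [x k] _; have [n ?] := h2 x k%:R; exists n.
  - by move=> [p q] _; case: (pselect (p = q)) => e; [left|right => /h3].
move=> [[h1 h2] h3]; split.
- by move=> x n; exact: (h1 (x, n)).
- move=> x t; have [n _ /= H] := h2 (x, (Num.truncn `|t|).+1) I.
  exists n; apply: le_trans H; apply: le_trans (ler_norm _) _; rewrite ltW//.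
  exact: truncnS_gt.
- move=> p q e; have [//|/= H] := h3 (p, q) I; by case: H.
Qed.

End measurable_heights.

Section integrals.
Context {R : realType}.

Lemma cmeasurable_fun d d' (T : measurableType d) (U : measurableType d')
    (X : countType) (h : T -> X) (k : X -> U) :
  cmeasurable h -> measurable_fun setT (fun w => k (h w)).
Proof.
by move=> mh _ B mB; rewrite setTI; exact: (cmeasurable_preimage (k @^-1` B) mh).
Qed.

Lemma integral_prodM d1 d2 (T1 : measurableType d1) (T2 : measurableType d2)
    (P1 : probability T1 R) (P2 : probability T2 R)
    (f : T1 -> \bar R) (g : T2 -> \bar R) :
  measurable_fun setT f -> measurable_fun setT g ->
  (forall x, 0 <= f x)%E -> (forall x, 0 <= g x)%E ->
  (\int[prod_prob P1 P2]_z (f z.1 * g z.2) = (\int[P1]_x f x) * (\int[P2]_y g y))%E.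
Proof.
move=> mf mg f0 g0; rewrite fubini_tonelli1//=; last 2 first.
- apply: emeasurable_funM.
    exact: (measurableT_comp mf measurable_fst).
  exact: (measurableT_comp mg measurable_snd).
- by move=> z; exact: mule_ge0.
rewrite /fubini_F -ge0_integralZr//; last exact: integral_ge0.
by apply: eq_integral => x _; rewrite /= ge0_integralZl.
Qed.

Lemma integral_fst d1 d2 (T1 : measurableType d1) (T2 : measurableType d2)
    (P1 : probability T1 R) (P2 : probability T2 R) (f : T1 -> \bar R) :
  measurable_fun setT f -> (forall x, 0 <= f x)%E ->
  (\int[prod_prob P1 P2]_z f z.1 = \int[P1]_x f x)%E.
Proof.
move=> mf f0; transitivity (\int[prod_prob P1 P2]_z (f z.1 * (cst 1 z.2)))%E.
  by apply: eq_integral => z _; rewrite mule1.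
rewrite (integral_prodM P1 P2 mf (g := cst 1%E))//.
have -> : (\int[P2]_y cst 1 y = 1)%E; last by rewrite mule1.
by rewrite integral_cst// mul1e; exact: probability_setT.
Qed.

Lemma integral_law d d' (T : measurableType d) (T' : measurableType d')
    (P : probability T R) (f : T -> T') (mf : measurable_fun setT f)
    (g : T' -> \bar R) : measurable_fun setT g -> (forall x, 0 <= g x)%E ->
  (\int[law P mf]_y g y = \int[P]_x g (f x))%E.
Proof. by move=> mg g0; rewrite ge0_integral_pushforward. Qed.

Lemma le_pow_eq0 (p : \bar R) (q : R) : 0 <= q < 1 -> (0 <= p)%E ->
  (forall n, p <= (q ^+ n)%:E)%E -> p = 0%E.
Proof.
move=> /andP[q0 q1] p0 H.
case: p p0 H => [p p0 H|_ /(_ 0%N)//|//]; congr EFin; apply/eqP.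
rewrite lee_fin in p0; rewrite eq_le p0 andbT.
have cv : (q ^+ n)%R @[n --> \oo] --> (0 : R) by apply: cvg_expr; rewrite ger0_norm.
rewrite -(cvg_lim _ cv)//; apply: limr_ge; first by apply/cvg_ex; exists 0.
by apply: nearW => n; rewrite -lee_fin.
Qed.

End integrals.

Section almost_sure_clocks.
Context {R : realType} {d : nat}.
Notation conf := (config R (site d * nat)%type).
Variable Q : probability conf R.
Hypothesis iQ : iid ex Q id.

Lemma ae_gaps_gt0 : {ae Q, forall c, forall p, 0 < (c : conf) p}.
Proof.
apply: ae_countable => p.
have mA : measurable [set c : conf | 0 < c p].
  by apply: measurable_is_true; apply: measurable_fun_ltr => //; exact: measurable_coord.
apply: ((ae_prob1 Q mA).2 _).
rewrite (iid_coord1 p (B := [set r | 0 < r]) iQ); last first.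
  by apply: measurable_is_true; apply: measurable_fun_ltr.
apply: ((ae_prob1 ex _).1 ex_gt0).
by apply: measurable_is_true; apply: measurable_fun_ltr.
Qed.

Lemma ex_lt (t : R) : 0 <= t -> ex `]-oo, t[%classic = (1 - expR (- t))%:E.
Proof.
move=> t0; rewrite -setCitvr probability_setC// ex_itvcy//.
Qed.

(** The probability that [m] consecutive gaps are all shorter than 1 is the [m]-th power of a number
    below 1. So almost surely some gap of length at least 1 follows every index, and the ring times
    grow without bound. *)
Lemma ae_ring_time_unbounded :
  {ae Q, forall c, forall x t, exists n, t <= ring_time (clocks c) x n}.
Proof.
have H (x : site d) (k : nat) : {ae Q, forall c, exists n, 1 <= (c : conf) (x, k + n)%N}.
  have phi_inj : injective (fun n => (x, k + n)%N) by move=> n m [] /addnI.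
  have /iid_box_law bl := iid_reindex phi_inj iQ.
  pose q : R := 1 - expR (- 1).
  have q01 : 0 <= q < 1.
    by rewrite /q subr_ge0 -[leRHS]expR0 ler_expR lerN10 ltrBlDr ltrDl expR_gt0.
  have mA n : measurable [set c : conf | 1 <= c (x, k + n)%N].
    by apply: measurable_is_true; apply: measurable_fun_ler => //; exact: measurable_coord.
  have mC : measurable (~` \bigcup_n [set c : conf | 1 <= c (x, k + n)%N]).
    by apply: measurableC; exact: bigcupT_measurable.
  suff Q0 : Q (~` \bigcup_n [set c : conf | 1 <= c (x, k + n)%N]) = 0%E.
    by exists (~` \bigcup_n [set c : conf | 1 <= c (x, k + n)%N]); split => // c H [n _ ?];
      apply: H; exists n.
  apply: (le_pow_eq0 q01) => // m.
  have := bl m (fun=> `]-oo, 1[%classic) (fun=> measurable_itv _).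
  rewrite ex_lt// -/q prodEFin big_const_ord iter_mulr_1 => <-.
  apply: le_measure; rewrite ?inE//.
    rewrite (_ : [set w | _] = \bigcap_(n in `I_m)
      ((fun c : conf => c (x, k + n)%N) @^-1` `]-oo, 1[%classic))//.
    apply: fin_bigcap_measurable => // n _; rewrite -[_ @^-1` _]setTI.
    exact: (measurable_coord (x, (k + n)%N) measurableT).
  move=> c H n nm /=; rewrite in_itv /= ltNge; apply/negP => h; apply: H.
  by exists n.
have Hall : {ae Q, forall c, forall xk : site d * nat, exists n, 1 <= (c : conf) (xk.1, xk.2 + n)%N}.
  by apply: ae_countable => -[x k]; exact: H.
near=> c => x t.
have c0 : forall p, 0 < (c : conf) p by near: c; exact: ae_gaps_gt0.
have c1 : forall xk : site d * nat, exists n, 1 <= (c : conf) (xk.1, xk.2 + n)%N.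
  by near: c.
have {}c1 m : exists n, m%:R <= ring_time (clocks c) x n.
  elim: m => [|m [n mn]].
    by exists 0%N; rewrite ltW// ring_time_gt0// => y n; exact: c0.
  have [k /= k1] := c1 (x, n.+1); exists (n.+1 + k)%N.
  rewrite ring_timeE addSn psumSr -natr1 lerD//.
    apply: le_trans mn _; rewrite ring_timeE.
    have := leq_addr k n; rewrite leq_eqVlt => /orP[/eqP<-//|nk].
    by apply/ltW/psum_lt => // j; exact: c0.
have [n H'] := c1 (Num.truncn `|t|).+1.
by exists n; apply: le_trans H'; apply: le_trans (ler_norm _) _; rewrite ltW// truncnS_gt.
Unshelve. all: by end_near. Qed.

(** Resampling one gap preserves the law of the configuration and exhibits that gap as a variable
    independent of all others. *)
Definition replace_gap (i0 : site d * nat) (z : conf * R) : conf :=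
  fun p => if p == i0 then z.2 else z.1 p.

Lemma measurable_replace_gap i0 : measurable_fun setT (replace_gap i0).
Proof.
apply: measurable_config => p; rewrite /replace_gap.
case: (p == i0); first exact: measurable_snd.
exact: (measurableT_comp (measurable_coord p) measurable_fst).
Qed.

Lemma measurable_cylinder (J : {fset site d * nat}) (B : site d * nat -> set R) :
  (forall i, measurable (B i)) -> measurable [set c : conf | forall i, i \in J -> B i (c i)].
Proof. by move=> mB; apply: sub_sigma_algebra; exists J, B. Qed.

Lemma iid_replace_gap i0 : iid ex (prod_prob Q ex) (replace_gap i0).
Proof.
split; first exact: measurable_replace_gap.
move=> J B mB.
rewrite (_ : [set w | _] = [set c : conf | forall i, i \in (J `\ i0)%fset -> B i (c i)] `*`
  (if i0 \in J then B i0 else setT)).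
  rewrite [LHS]prod_probX; [|exact: measurable_cylinder|by case: ifP].
  have := iQ.2 (J `\ i0)%fset B mB => /= ->.
  case: (boolP (i0 \in J)) => i0J.
    by rewrite [RHS](big_fsetD1 i0)//= muleC.
  by rewrite /= probability_setT mule1 mem_fsetD1.
apply/seteqP; split => -[c r] /= H.
  split => [i|].
    rewrite in_fsetD1 => /andP[ii0 iJ].
    by have := H i iJ; rewrite /replace_gap (negbTE ii0).
  case: ifP => // i0J; have := H i0 i0J.
  by rewrite /replace_gap eqxx.
move=> i iJ; rewrite /replace_gap; case: (eqVneq i i0) => [e|ii0].
  by have := H.2; rewrite -e iJ e.
by apply: H.1; rewrite in_fsetD1 ii0.
Qed.

(** Given all gaps other than the first one at [x], a tie forces that gap to equal the number [r0],
    since the ring time at [y] does not involve it; a single point has exponential probability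
    zero. *)
Lemma ae_no_ties (p q : site d * nat) : p.1 != q.1 ->
  {ae Q, forall c, ring_time (clocks c) p.1 p.2 <> ring_time (clocks c) q.1 q.2}.
Proof.
move: p q => [x n] [y m] /= xy.
pose A := [set c : conf | ring_time (clocks c) x n = ring_time (clocks c) y m].
have mA : measurable A.
  rewrite (_ : A = [set c : conf | ring_time (clocks c) x n == ring_time (clocks c) y m]).
    by apply: measurable_is_true; apply: measurable_fun_eqr; exact: measurable_ring_time.
  by apply/seteqP; split => c /= /eqP.
exists A; split => //; last by move=> c /contrapT.
pose i0 := (x, 0%N).
have := iid_unique iQ (iid_replace_gap i0) mA => ->.
have mfA : measurable (replace_gap i0 @^-1` A).
  by rewrite -[_ @^-1` _]setTI; exact: measurable_replace_gap.
rewrite [LHS]prod_probE// integral0_eq// => c _.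
pose r0 := ring_time (clocks c) y m - \sum_(k < n) c (x, k.+1).
apply: (subset_measure0 _ _ _ (ex_set1 r0)) => //.
  exact: (measurable_section c mfA).
move=> r; rewrite /A /= /ring_time big_ord_recl /clocks /replace_gap /= eqxx.
rewrite (eq_bigr (fun k : 'I_n => c (x, k.+1))); last first.
  by move=> k _; rewrite xpair_eqE eqxx.
rewrite (eq_bigr (fun k : 'I_m.+1 => c (y, k : nat))); last first.
  by move=> k _; rewrite xpair_eqE eq_sym (negbTE xy).
by rewrite /r0 /ring_time /clocks => <-; rewrite addrK.
Qed.

Lemma ae_regular : {ae Q, forall c, regular (clocks c)}.
Proof.
have H : {ae Q, forall c, forall pq : (site d * nat) * (site d * nat),
    pq.1.1 != pq.2.1 ->
    ring_time (clocks c) pq.1.1 pq.1.2 <> ring_time (clocks c) pq.2.1 pq.2.2}.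
  apply: ae_countable => -[p q].
  case: (eqVneq p.1 q.1) => pq; first exact: nearW.
  by apply: filterS (ae_no_ties pq) => c.
near=> c.
have c0 : forall p, 0 < (c : conf) p by near: c; exact: ae_gaps_gt0.
have c1 : forall x t, exists n, t <= ring_time (clocks c) x n.
  by near: c; exact: ae_ring_time_unbounded.
have c2 : forall pq : (site d * nat) * (site d * nat), pq.1.1 != pq.2.1 ->
    ring_time (clocks c) pq.1.1 pq.1.2 <> ring_time (clocks c) pq.2.1 pq.2.2.
  by near: c.
split => //; first by move=> x n; exact: c0.
move=> [x n] [y m] /= e.
have exy : x = y by apply/eqP; apply: contrapT => /negP xy; exact: (c2 ((x, n), (y, m)) xy).
rewrite -exy in e *; congr pair.
have g0 k : 0 < clocks c x k by exact: c0.
case: (ltngtP n m) => // nm.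
  by have := psum_lt g0 nm; rewrite -!ring_timeE e ltxx.
by have := psum_lt g0 nm; rewrite -!ring_timeE e ltxx.
Unshelve. all: by end_near. Qed.

(** The gaps tested by [feasible]. They are pairwise distinct, since repeated visits to a site use
    different indices, and so the tests are independent. *)
Fixpoint needed_gaps (w : seq (site d)) : seq (site d * nat) :=
  if w is x :: w' then (x, count_mem x w') :: needed_gaps w' else [::].

Lemma needed_gaps_lt w x n : (x, n) \in needed_gaps w -> (n < count_mem x w)%N.
Proof.
elim: w => //= y w IH; rewrite in_cons => /orP[/eqP[-> ->]|/IH h].
  by rewrite eqxx.
exact: leq_trans h (leq_addl _ _).
Qed.

Lemma uniq_needed_gaps w : uniq (needed_gaps w).
Proof.
elim: w => //= x w ->; rewrite andbT; apply/negP => /needed_gaps_lt.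
by rewrite ltnn.
Qed.

Lemma size_needed_gaps w : size (needed_gaps w) = size w.
Proof. by elim: w => //= x w ->. Qed.

Lemma feasibleE g t w :
  feasible g t w = all (fun p => (g : site d -> nat -> R) p.1 p.2 < t) (needed_gaps w).
Proof. by elim: w => //= x w ->. Qed.

Definition feasible_set t w : set conf := [set c : conf | feasible (clocks c) t w].

Lemma feasible_setE t w : feasible_set t w =
  [set c : conf | forall p, p \in [fset p in needed_gaps w]%fset -> `]-oo, t[%classic (c p)].
Proof.
apply/seteqP; split => c; rewrite /feasible_set /= feasibleE.
  by move=> /allP H p /imfsetP[[x n] /= qw ->]; rewrite /= in_itv /=; exact: (H (x, n)).
move=> H; apply/allP => -[x n] pw.
by have := H (x, n); rewrite /= in_itv /=; apply; apply/imfsetP; exists (x, n).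
Qed.

Lemma measurable_feasible t w : measurable (feasible_set t w).
Proof.
rewrite feasible_setE.
exact: (@measurable_cylinder _ (fun=> `]-oo, t[%classic) (fun=> measurable_itv _)).
Qed.

Lemma feasible_prob t w : 0 <= t ->
  Q (feasible_set t w) = ((1 - expR (- t)) ^+ size w)%:E.
Proof.
move=> t0; rewrite feasible_setE.
have := iQ.2 [fset p in needed_gaps w]%fset (fun=> `]-oo, t[%classic) (fun=> measurable_itv _).
move=> /= ->; rewrite (perm_big (needed_gaps w)) /=; last first.
  apply: uniq_perm => [||p]; [exact: fset_uniq|exact: uniq_needed_gaps|].
  by apply/imfsetP/idP => [[q /= + ->]//|]; exists p.
rewrite ex_lt// -size_needed_gaps.
elim: (needed_gaps w) => [|p r IH]; first by rewrite big_nil expr0.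
by rewrite big_cons IH exprS EFinM.
Qed.

End almost_sure_clocks.

Lemma bigcup_seq_le {R : realType} d (T : measurableType d) (P : probability T R)
    (X : eqType) (s : seq X) (F : X -> set T) : (forall x, measurable (F x)) ->
  measurable [set w | exists2 x, x \in s & F x w] /\
  (P [set w | exists2 x, x \in s & F x w] <= \sum_(x <- s) P (F x))%E.
Proof.
move=> mF; elim: s => [|x s [mU IH]].
  rewrite (_ : [set w | _] = set0); first by rewrite measure0 big_nil.
  by rewrite -subset0 => w [].
rewrite (_ : [set w | _] = F x `|` [set w | exists2 x, x \in s & F x w]).
  split; first exact: measurableU.
  by rewrite big_cons; apply: le_trans (measureU2 _ _ _) _ => //; exact: leeD2l.
apply/seteqP; split => w /=.
  move=> [y]; rewrite in_cons => /orP[/eqP->|ys] Fw; [by left|by right; exists y].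
move=> [Fw|[y ys Fw]]; first by exists x; rewrite ?mem_head.
by exists y; rewrite ?in_cons ?ys ?orbT.
Qed.

(** * Finite influence at all times *)

Section almost_sure_influence.
Context {R : realType} {d : nat}.
Notation conf := (config R (site d * nat)%type).
Variable Q : probability conf R.
Hypothesis iQ : iid ex Q id.

(* Below this time, chains of updates form a subcritical branching process. *)
Definition short_time : R := ((d + d).+1%:R * 4)^-1.

Lemma short_time_gt0 : 0 < short_time.
Proof. by rewrite invr_gt0 mulr_gt0. Qed.

Lemma ring_prob_le (t : R) : 0 <= t -> 0 <= 1 - expR (- t) <= t.
Proof.
move=> t0; rewrite subr_ge0 -[leRHS]expR0 ler_expR oppr_le0 t0 /=.
by rewrite lerBlDr -lerBlDl; exact: expR_ge1Dx.
Qed.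

(** Any bound below 1 would make long chains improbable. The value [1/4] leaves room for the factor
    2 per step in [pow2_height_le], where the resulting ratio [1/2] is that of [half_series]. *)
Lemma short_ring_prob (t : R) : 0 <= t <= short_time ->
  (d + d).+1%:R * (1 - expR (- t)) <= 4^-1.
Proof.
move=> /andP[t0 ts]; have /andP[_ h] := ring_prob_le t0.
apply: le_trans (_ : (d + d).+1%:R * short_time <= _).
  by rewrite ler_pM2l//; exact: le_trans h ts.
by rewrite /short_time invfM mulrA divff ?mul1r.
Qed.

(** Union bound: there are [(2d+1)^k] walks of [k] steps, each feasible with probability
    [(1 - expR (- t))^k], so that a feasible one exists with probability at most [4^-k]. *)
Lemma ae_finitely_influenced_short (t : R) : 0 <= t <= short_time ->
  {ae Q, forall c, finitely_influenced (clocks c) t}.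
Proof.
move=> t_short; have /andP[t0 _] := t_short.
have H (x : site d) : {ae Q, forall c, exists k, forall w, w \in walks k x ->
    ~~ feasible (clocks c) t (belast x w)}.
  pose F k := [set c : conf | exists2 w, w \in walks k x & feasible_set t (belast x w) c].
  have FP k := @bigcup_seq_le _ _ _ Q _ (walks k x) (fun w => feasible_set t (belast x w))
    (fun w => measurable_feasible t _).
  have mF k : measurable (F k) := (FP k).1.
  have mFF : measurable (\bigcap_k F k) by exact: bigcapT_measurable.
  exists (\bigcap_k F k); split => //.
    apply: (@le_pow_eq0 _ _ 4^-1) => //.
      by rewrite invr_ge0 ler0n invf_lt1// ltr1n.
    move=> k; apply: (@le_trans _ _ (Q (F k))).
      by apply: le_measure; rewrite ?inE//; exact: bigcap_inf.
    apply: le_trans (FP k).2 _.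
    rewrite big_seq (eq_bigr (fun=> ((1 - expR (- t)) ^+ k)%:E)); last first.
      by move=> w wk; rewrite feasible_prob// size_belast (size_walk wk).
    rewrite -big_seq sumEFin lee_fin big_const_seq count_predT iter_addr_0 size_walks.
    rewrite -[leLHS]mulr_natl natrX -exprMn lerXn2r ?nnegrE//.
      by apply: mulr_ge0 => //; have /andP[] := ring_prob_le t0.
    exact: short_ring_prob.
  move=> c /= /forallNP nH k _; have /existsNP[w /not_implyP[wk /negP/negPn h]] := nH k.
  by exists w.
have Hall : {ae Q, forall c, forall x, exists k, forall w, w \in walks k x ->
    ~~ feasible (clocks c) t (belast x w)} by exact: ae_countable.
near=> c; apply: finitely_influenced_walks.
  by near: c; exact: ae_regular.
by near: c.
Unshelve. all: by end_near. Qed.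

Lemma clocks_glue s (z : conf * conf) :
  clocks (glue_config s z) = glue s (clocks z.1) (clocks z.2).
Proof. by []. Qed.

Lemma ae_glue s (A : set conf) : 0 <= s -> measurable A ->
  {ae Q, forall c, A c} <-> {ae prod_prob Q Q, forall z, A (glue_config s z)}.
Proof.
move=> s0 mA.
have mgA : measurable [set z : conf * conf | A (glue_config s z)].
  by have := @measurable_glue_config R _ s measurableT A mA; rewrite setTI.
have H1 := ae_prob1 Q mA; have H2 := ae_prob1 (prod_prob Q Q) mgA.
have E := law_glue iQ s0 mA.
split => H.
  by apply/H2; transitivity (Q A); [exact/esym/E|exact/H1].
by apply/H1; transitivity (prod_prob Q Q [set z | A (glue_config s z)]); [exact: E|exact/H2].
Qed.

Lemma ae_glue_regular s : 0 <= s -> {ae prod_prob Q Q, forall z,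
  [/\ regular (clocks z.1), regular (clocks z.2) & regular (clocks (glue_config s z))]}.
Proof.
move=> s0; near=> z; split.
- by near: z; exact: (ae_fst Q (ae_regular iQ)).
- by near: z; exact: (ae_snd Q (ae_regular iQ)).
- near: z; apply/(ae_glue s0 measurable_regular) => //; exact: ae_regular.
Unshelve. all: by end_near. Qed.

(** The union bound over walks says nothing for long times. The interval is cut into [n] short ones,
    and finite influence passes to glued clocks, whose law is again that of the clocks. *)
Lemma ae_finitely_influenced t : 0 <= t ->
  {ae Q, forall c, finitely_influenced (clocks c) t}.
Proof.
move=> t0.
pose n := (Num.truncn (t / short_time)).+1.
pose u := t / n%:R.
have n0 : 0 < n%:R :> R by rewrite ltr0n.
have u_short : 0 <= u <= short_time.
  rewrite divr_ge0//= ler_pdivrMr// mulrC -ler_pdivrMr ?short_time_gt0// ltW//.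
  exact: truncnS_gt.
have /andP[u0 _] := u_short.
have -> : t = u *+ n by rewrite -mulr_natr divfK// gt_eqF.
elim: (n) => [|m IH].
  by apply: nearW => c x; exists fset0 => D _ f; rewrite !updates_nonpos// mulr0n.
have mu0 : 0 <= u *+ m by rewrite mulrn_wge0.
apply/(ae_glue mu0 (measurable_finitely_influenced _)) => //.
near=> z.
change (finitely_influenced (glue (u *+ m) (clocks z.1) (clocks z.2)) (u *+ m.+1)).
rewrite mulrSr.
have [r1 r2 r3] : [/\ regular (clocks z.1), regular (clocks z.2) &
    regular (clocks (glue_config (u *+ m) z))].
  by near: z; exact: ae_glue_regular.
apply: finitely_influenced_glue => //.
  by near: z; exact: (ae_fst Q IH).
by near: z; exact: (ae_snd Q (ae_finitely_influenced_short u_short)).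
Unshelve. all: by end_near. Qed.

Lemma ae_glue_good s t : 0 <= s -> 0 <= t -> {ae prod_prob Q Q, forall z,
  [/\ regular (clocks z.1), regular (clocks z.2), regular (clocks (glue_config s z)),
     finitely_influenced (clocks z.1) s & finitely_influenced (clocks z.2) t]}.
Proof.
move=> s0 t0; near=> z.
have [r1 r2 r3] : [/\ regular (clocks z.1), regular (clocks z.2) &
    regular (clocks (glue_config s z))].
  by near: z; exact: ae_glue_regular.
split => //.
  by near: z; exact: (ae_fst Q (ae_finitely_influenced s0)).
by near: z; exact: (ae_snd Q (ae_finitely_influenced t0)).
Unshelve. all: by end_near. Qed.

Lemma ae_height_glue s t : 0 <= s -> 0 <= t -> {ae prod_prob Q Q, forall z, forall f,
  height (clocks (glue_config s z)) f (s + t) =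
  height (clocks z.2) (height (clocks z.1) f s) t}.
Proof.
move=> s0 t0; apply: filterS (ae_glue_good s0 t0) => z [? ? ? ? ?] f.
by rewrite clocks_glue height_glue.
Qed.

Lemma ae_height_glue_before s : 0 <= s -> {ae prod_prob Q Q, forall z, forall f r,
  r <= s -> height (clocks (glue_config s z)) f r = height (clocks z.1) f r}.
Proof.
move=> s0; apply: filterS (ae_glue_regular s0) => z [? ? ?] f r rs.
by rewrite clocks_glue height_glue_before.
Qed.

End almost_sure_influence.

(** * Bounds on heights and gradients started from the flat field *)

Section growth.
Context {R : realType} {d : nat}.
Notation conf := (config R (site d * nat)%type).
Variable Q : probability conf R.
Hypothesis iQ : iid ex Q id.

Lemma cmeasurable_height t x :
  cmeasurable (fun z : field d * conf => height (clocks z.2) z.1 t x).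
Proof.
exact: (cmeasurable_pullback (measurable_height t) (cmeasurable_field_coord x)).
Qed.

Lemma cmeasurable_height_from (f : field d) t x :
  cmeasurable (fun c : conf => height (clocks c) f t x).
Proof.
apply: (@cmeasurable_pullback _ _ _ _ _ (fun z : field d * conf => height (clocks z.2) z.1 t x)
  (fun c => (f, c))); last exact: cmeasurable_height.
by apply: measurable_fun_pair.
Qed.

Definition flat : field d := fun=> 0.

Definition flat_height (c : conf) (t : R) : field d := height (clocks c) flat t.

Lemma cmeasurable_flat_height t x : cmeasurable (fun c => flat_height c t x).
Proof. exact: cmeasurable_height_from. Qed.

Lemma integral_glue s (g : conf -> \bar R) : 0 <= s -> measurable_fun setT g ->
  (forall c, 0 <= g c)%E ->
  (\int[Q]_c g c = \int[prod_prob Q Q]_z g (glue_config s z))%E.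
Proof.
move=> s0 mg g0; rewrite -(integral_law (prod_prob Q Q) (measurable_glue_config s))//.
by apply: eq_measure_integral => A mA _; exact: (iid_unique iQ (iid_glue iQ s0) mA).
Qed.

(** An exponential moment is propagated instead of the mean: a chain of [k] updates raises the
    height by at most [k], hence multiplies this quantity by at most [2 ^ k], and these factors
    combine over successive time steps. *)
Let pow2 (v : int) : R := (2 ^ `|v|)%N%:R.

Let pow2_ge0 v : 0 <= pow2 v. Proof. exact: ler0n. Qed.

Let measurable_pow2 s x (k : R) : measurable_fun setT (fun c => (k * pow2 (flat_height c s x))%:E).
Proof.
exact: (cmeasurable_fun (fun v => (k * pow2 v)%:E) (cmeasurable_flat_height s x)).
Qed.

Lemma sum_seq_ge (X : eqType) (s : seq X) (F : X -> \bar R) x :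
  (forall y, 0 <= F y)%E -> x \in s -> (F x <= \sum_(y <- s) F y)%E.
Proof.
move=> F0; elim: s => // y s IH; rewrite in_cons big_cons => /orP[/eqP<-|/IH h].
  by rewrite leeDl// sume_ge0.
by apply: le_trans h _; rewrite leeDr.
Qed.

Lemma nneseries_ge (F : nat -> \bar R) n :
  (forall k, 0 <= F k)%E -> (F n <= \sum_(0 <= k <oo) F k)%E.
Proof.
move=> F0; apply: le_trans (nneseries_lim_ge n.+1 _) => //.
by rewrite big_nat_recr//= leeDr// sume_ge0.
Qed.

Lemma half_series (M : R) : 0 <= M -> (\sum_(0 <= k <oo) (M * 2^-1 ^+ k)%:E <= (2 * M)%:E)%E.
Proof.
move=> M0; apply: lime_le.
  by apply: is_cvg_nneseries => n _ _; rewrite lee_fin mulr_ge0// exprn_ge0// invr_ge0.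
apply: nearW => n; rewrite sumEFin lee_fin -mulr_sumr mulrC ler_wpM2r//.
suff -> : \sum_(0 <= i < n) 2^-1 ^+ i = 2 - 2 * 2^-1 ^+ n :> R.
  by rewrite gerBl mulr_ge0// exprn_ge0// invr_ge0.
elim: n => [|n IH]; first by rewrite big_geq// expr0 mulr1 subrr.
by rewrite big_nat_recr//= IH exprS; lra.
Qed.

(* Follow the walk given by [height_le_walk] over one short time step. *)
Lemma pow2_height_le n x :
  (\int[Q]_c (pow2 (flat_height c (@short_time R d *+ n) x))%:E <= (2 ^+ n)%:E)%E.
Proof.
elim: n x => [|n IH] x.
  rewrite (eq_integral (cst 1%E)); last first.
    by move=> c _; rewrite mulr0n /flat_height height_nonpos.
  by rewrite integral_cst// mul1e expr0; exact: probability_le1.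
set tau := @short_time R d; set s := tau *+ n.
have tau0 : 0 <= tau by rewrite ltW// short_time_gt0.
have s0 : 0 <= s by rewrite mulrn_wge0.
have mpow t y : measurable_fun setT (fun c => (pow2 (flat_height c t y))%:E).
  have := measurable_pow2 t y 1.
  by apply: eq_measurable_fun => c _; rewrite mul1r.
rewrite (integral_glue s0); [|exact: mpow|by move=> c; rewrite lee_fin].
(* The contribution of one walk: the earlier clocks give the height at its end, the later ones
   decide whether it is feasible, and the two factors are independent. Summing over all walks
   dispenses with selecting one measurably. *)
pose T k (w : seq (site d)) (z : conf * conf) : \bar R :=
  ((2 ^+ k * pow2 (flat_height z.1 s (last x w)))%:E *
   (\1_(feasible_set tau (belast x w)) z.2)%:E)%E.
have T0 k w z : (0 <= T k w z)%E.
  by rewrite mule_ge0// lee_fin// mulr_ge0// exprn_ge0.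
have mI w : measurable_fun setT (fun c : conf =>
   (\1_(feasible_set tau (belast x w)) c : R)%:E).
  by apply/measurable_EFinP; apply: measurable_indic; exact: measurable_feasible.
have mT k w : measurable_fun setT (T k w).
  apply: emeasurable_funM.
    exact: (measurableT_comp (measurable_pow2 s (last x w) (2 ^+ k)) measurable_fst).
  exact: (measurableT_comp (mI w) measurable_snd).
have mST k : measurable_fun setT (fun z => \sum_(w <- walks k x) T k w z)%E.
  exact: emeasurable_sum.
have ST0 k z : (0 <= \sum_(w <- walks k x) T k w z)%E by apply: sume_ge0.
apply: (@le_trans _ _ (\int[prod_prob Q Q]_z \sum_(0 <= k <oo) \sum_(w <- walks k x) T k w z)%E).
  apply: ae_ge0_le_integral => //.
  - by move=> z _; rewrite lee_fin.
  - exact: (measurableT_comp (mpow _ x) (measurable_glue_config s)).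
  - by move=> z _; apply: nneseries_ge0.
  - by apply: ge0_emeasurable_sum.
  near=> z => _.
  have gE : forall f, height (clocks (glue_config s z)) f (s + tau) =
      height (clocks z.2) (height (clocks z.1) f s) tau.
    by near: z; exact: ae_height_glue.
  have [r1 r2 r3 FI1 FI2] : [/\ regular (clocks z.1), regular (clocks z.2),
     regular (clocks (glue_config s z)),
     finitely_influenced (clocks z.1) s & finitely_influenced (clocks z.2) tau].
    by near: z; exact: ae_glue_good.
  rewrite /flat_height mulrSr -/tau -/s gE.
  have [k [w [wk wf H]]] := height_le_walk (height (clocks z.1) flat s) x r2 FI2.
  apply: (@le_trans _ _ (T k w z)).
    rewrite /T indicE mem_set// mule1 lee_fin /pow2 -natrX -natrM ler_nat -expnD.
    rewrite leq_exp2l//.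
    have h0 y : 0 <= height (clocks z.1) flat s y by exact: (height_ge flat y FI1).
    have key (a b e : int) : 0 <= a -> a <= b -> 0 <= e -> b <= e + k%:Z ->
      (`|b| <= k + `|e|)%N by lia.
    by apply: (key (height (clocks z.1) flat s x)) => //; exact: height_ge.
  apply: le_trans (nneseries_ge (F := fun k => \sum_(w <- walks k x) T k w z)%E k _) => //.
  exact: (sum_seq_ge (F := fun w => T k w z)).
rewrite integral_nneseries//.
have M0 : 0 <= 2 ^+ n :> R by exact: exprn_ge0.
rewrite exprS; apply: le_trans (half_series M0).
apply: lee_nneseries => [k _ _|k _]; first by apply: integral_ge0.
rewrite ge0_integral_sum//.
have Tle w : w \in walks k x -> (\int[prod_prob Q Q]_z T k w z <=
    ((2 ^+ k * 2 ^+ n) * (1 - expR (- tau)) ^+ k)%:E)%E.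
  move=> wk; rewrite [leLHS](integral_prodM Q Q
    (measurable_pow2 s (last x w) (2 ^+ k)) (mI w)); last 2 first.
  - by move=> c; rewrite lee_fin mulr_ge0// exprn_ge0.
  - by move=> c; rewrite lee_fin.
  rewrite integral_indic ?setIT//; last exact: measurable_feasible.
  rewrite [X in (_ * X)%E](feasible_prob iQ)// size_belast (size_walk wk) EFinM.
  apply: lee_wpmul2r.
    by rewrite lee_fin exprn_ge0//; have /andP[] := ring_prob_le tau0.
  under eq_integral do rewrite EFinM.
  rewrite ge0_integralZl//; last by move=> c _; rewrite lee_fin.
  by rewrite EFinM; apply: lee_wpmul2l; [rewrite lee_fin exprn_ge0|exact: IH].
rewrite big_seq; apply: le_trans (lee_sum _ Tle) _.
rewrite -big_seq sumEFin lee_fin big_const_seq count_predT iter_addr_0 size_walks.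
rewrite -[leLHS]mulr_natl natrX.
have /andP[p0 _] := ring_prob_le tau0.
have h : (d + d).+1%:R * (1 - expR (- tau)) <= 4^-1.
  by apply: short_ring_prob; rewrite tau0 lexx.
(* The number of walks, the gain in height and the probability of each walk combine into the [k]-th
   power of a ratio of at most [1/2]. *)
have -> : (d + d).+1%:R ^+ k * (2 ^+ k * 2 ^+ n * (1 - expR (- tau)) ^+ k) =
   2 ^+ n * (2 * ((d + d).+1%:R * (1 - expR (- tau)))) ^+ k :> R.
  by rewrite !exprMn; ring.
rewrite ler_wpM2l ?exprn_ge0// lerXn2r ?nnegrE//.
  by rewrite !mulr_ge0.
by apply: le_trans (ler_wpM2l (ler0n _ 2) h) _; lra.
Unshelve. all: by end_near. Qed.

Lemma expected_height_le n x :
  (\int[Q]_c (`|flat_height c (@short_time R d *+ n) x|%N%:R)%:E <= (n.+1%:R)%:E)%E.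
Proof.
set s := _ *+ n.
have mh k : measurable_fun setT (fun c => (k * pow2 (flat_height c s x))%:E).
  exact: measurable_pow2.
(* A linearised Jensen inequality: [m <= n + 2^(m-n)] for all [m], so a bound [2^n] on the
   exponential moment yields the bound [n + 1] on the mean. *)
apply: (@le_trans _ _ (\int[Q]_c ((n%:R)%:E + (2 ^- n * pow2 (flat_height c s x))%:E))%E).
  apply: ge0_le_integral => //.
  - exact: (cmeasurable_fun (fun v : int => (`|v|%N%:R)%:E) (cmeasurable_flat_height s x)).
  - exact: emeasurable_funD.
  move=> c _; rewrite -EFinD lee_fin /pow2; set m := `|_|%N.
  case: (leqP m n) => mn.
    by rewrite ler_wpDr ?ler_nat// mulr_ge0// invr_ge0 exprn_ge0.
  rewrite -(subnKC (ltnW mn)) natrX exprD mulKf ?expf_neq0// natrD lerD2l -natrX ler_nat.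
  by rewrite ltnW// ltn_expl.
rewrite ge0_integralD//; last by move=> c _; rewrite lee_fin mulr_ge0// invr_ge0 exprn_ge0.
rewrite [leRHS](_ : _ = (n%:R)%:E + 1)%E; last by rewrite -EFinD natr1.
apply: leeD.
  rewrite integral_cst// -[leRHS]mule1.
  by apply: lee_wpmul2l; [rewrite lee_fin|exact: probability_le1].
under eq_integral do rewrite EFinM.
have m1 : measurable_fun setT (fun c => (pow2 (flat_height c s x))%:E).
  by have := mh 1; apply: eq_measurable_fun => c _; rewrite mul1r.
rewrite ge0_integralZl//; last by move=> c _; rewrite lee_fin.
apply: le_trans (lee_wpmul2l _ (pow2_height_le n x)) _.
  by rewrite lee_fin invr_ge0 exprn_ge0.
by rewrite -EFinM mulVf// expf_neq0.
Qed.

End growth.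

Section gradient_bound.
Context {R : realType} {d : nat}.
Notation conf := (config R (site d * nat)%type).
Variable Q : probability conf R.
Hypothesis iQ : iid ex Q id.
Notation tau := (@short_time R d).
Notation H := (@flat_height R d).

Definition posz (v : int) : nat := `|Num.max v 0|%N.

Lemma cmeasurable_flat_pair t x y :
  cmeasurable (fun c : conf => (H c t x, H c t y)).
Proof. by apply: cmeasurable_pair; exact: cmeasurable_flat_height. Qed.

Definition mean_height t x : \bar R := (\int[Q]_c (`|H c t x|%N%:R)%:E)%E.

Definition mean_jump t x y : \bar R := (\int[Q]_c ((posz (H c t y - H c t x))%:R)%:E)%E.

Lemma mean_height_ge0 t x : (0 <= mean_height t x)%E.
Proof. by apply: integral_ge0 => c _; rewrite lee_fin. Qed.

Lemma mean_jump_ge0 t x y : (0 <= mean_jump t x y)%E.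
Proof. by apply: integral_ge0 => c _; rewrite lee_fin. Qed.

(* If the clock at [x] rings in a time step, then [x] catches up with [y]. *)
Lemma mean_height_gain t s x y : 0 <= t -> 0 <= s -> y \in nbrs x ->
  (mean_height t x + (1 - expR (- s))%:E * mean_jump t x y <= mean_height (t + s) x)%E.
Proof.
move=> t0 s0 yx.
have mh : measurable_fun setT (fun c : conf => (`|H c t x|%N%:R : R)%:E).
  exact: (cmeasurable_fun (fun v : int => (`|v|%N%:R)%:E) (cmeasurable_flat_height t x)).
have mh' : measurable_fun setT (fun c : conf => (`|H c (t + s) x|%N%:R : R)%:E).
  exact: (cmeasurable_fun (fun v : int => (`|v|%N%:R)%:E) (cmeasurable_flat_height _ x)).
have mj : measurable_fun setT (fun c : conf => ((posz (H c t y - H c t x))%:R : R)%:E).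
  exact: (cmeasurable_fun (fun v : int * int => ((posz (v.2 - v.1))%:R)%:E)
    (cmeasurable_flat_pair t x y)).
pose F := [set c : conf | `]-oo, s[%classic (c (x, 0%N))].
have mF : measurable F.
  have := measurable_coord (R := R) (x, 0%N) measurableT (measurable_itv `]-oo, s[).
  by rewrite setTI.
have mI : measurable_fun setT (fun c : conf => (\1_F c : R)%:E).
  by apply/measurable_EFinP; exact: measurable_indic.
rewrite /mean_height (integral_glue iQ t0 mh'); last by move=> c; rewrite lee_fin.
rewrite -(integral_fst Q Q mh); last by move=> c; rewrite lee_fin.
have -> : ((1 - expR (- s))%:E * mean_jump t x y = \int[prod_prob Q Q]_z
    (((posz (H z.1 t y - H z.1 t x))%:R)%:E * (\1_F z.2)%:E))%E.
  rewrite (integral_prodM Q Q mj mI).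
  - rewrite integral_indic// setIT muleC; congr (_ * _)%E.
    by rewrite -ex_lt// -(iid_coord1 (x, 0%N) (B := `]-oo, s[%classic) iQ).
  - by move=> c; rewrite lee_fin.
  - by move=> c; rewrite lee_fin.
have mj1 : measurable_fun setT (fun z : conf * conf =>
    (((posz (H z.1 t y - H z.1 t x))%:R : R)%:E * (\1_F z.2)%:E)%E).
  apply: emeasurable_funM.
    exact: (measurableT_comp mj measurable_fst).
  exact: (measurableT_comp mI measurable_snd).
have mh1 : measurable_fun setT (fun z : conf * conf => (`|H z.1 t x|%N%:R : R)%:E).
  exact: (measurableT_comp mh measurable_fst).
have j0 (z : conf * conf) : (0 <= ((posz (H z.1 t y - H z.1 t x))%:R : R)%:E * (\1_F z.2)%:E)%E.
  by apply: mule_ge0; rewrite lee_fin.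
rewrite -ge0_integralD//.
apply: ae_ge0_le_integral => //.
- by move=> z _; apply: adde_ge0 => //; rewrite lee_fin.
- exact: emeasurable_funD.
- exact: (measurableT_comp mh' (measurable_glue_config t)).
near=> z => _.
have gE : forall f, height (clocks (glue_config t z)) f (t + s) =
    height (clocks z.2) (height (clocks z.1) f t) s.
  by near: z; exact: ae_height_glue.
have [r1 r2 r3 FI1 FI2] : [/\ regular (clocks z.1), regular (clocks z.2),
   regular (clocks (glue_config t z)),
   finitely_influenced (clocks z.1) t & finitely_influenced (clocks z.2) s].
  by near: z; exact: ae_glue_good.
rewrite /flat_height gE; set f := height (clocks z.1) _ t.
have f0 u : 0 <= f u by exact: (height_ge flat u FI1).
have hx : f x <= height (clocks z.2) f s x by exact: height_ge.
rewrite indicE; case: (boolP (z.2 \in F)) => zF; last first.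
  rewrite mule0 adde0 lee_fin ler_nat.
  by have := f0 x; lia.
rewrite mule1 -EFinD lee_fin -natrD ler_nat.
have hy : f y <= height (clocks z.2) f s x.
  apply: height_ge_nbr => //; move: zF; rewrite inE /F /= in_itv /=.
  exact.
have key (a b e : int) : 0 <= a -> a <= e -> b <= e -> (`|a| + posz (b - a) <= `|e|)%N.
  by rewrite /posz; lia.
exact: key.
Unshelve. all: by end_near. Qed.

(** The gains of consecutive time steps telescope. *)
Lemma mean_height_sum s N x y : 0 <= s -> y \in nbrs x ->
  ((1 - expR (- s))%:E * \sum_(j < N) mean_jump (s *+ j) x y <= mean_height (s *+ N) x)%E.
Proof.
move=> s0 yx; have /andP[p0 _] := ring_prob_le s0.
elim: N => [|N IH]; first by rewrite big_ord0 mule0 mean_height_ge0.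
rewrite big_ord_recr /= ge0_muleDr; last 2 first.
- by apply: sume_ge0 => j _; exact: mean_jump_ge0.
- exact: mean_jump_ge0.
apply: le_trans (leeD2r _ IH) _; rewrite mulrSr; apply: mean_height_gain => //.
by rewrite mulrn_wge0.
Qed.

(** Mesh of the [n]-th time average. After [(n+1)^2] steps the horizon is [n + 1] times [tau], a
    multiple of [tau] as [expected_height_le] demands. *)
Definition time_step n : R := tau / n.+1%:R.

Lemma time_step_gt0 n : 0 < time_step n. Proof. by rewrite divr_gt0// short_time_gt0. Qed.

Lemma time_step_le1 n : time_step n <= 1.
Proof.
rewrite /time_step /short_time -invfM invf_le1 ?mulr_gt0// -!natrM ler1n.
by rewrite !muln_gt0.
Qed.

(** From [1 + t <= expR t], together with [(1 + t)^-1 <= 1 - t / 2] on the unit interval. *)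
Lemma ring_prob_ge (t : R) : 0 <= t <= 1 -> t / 2 <= 1 - expR (- t).
Proof.
move=> /andP[t0 t1]; rewrite expRN lerBrDr -lerBrDl.
apply: (@le_trans _ _ (1 + t)^-1).
  rewrite lef_pV2 ?posrE ?expR_gt0 ?expR_ge1Dx//; lra.
have t1' : 0 < 1 + t by lra.
by rewrite -[leLHS]mul1r ler_pdivrMr//; nra.
Qed.

(** One factor 2 comes from [ring_prob_ge], the other from comparing the bound [n + 2] on the mean
    height at the horizon with [n + 1]. *)
Definition jump_bound : R := 4 / tau.

Lemma sum_mean_jump n x y : y \in nbrs x ->
  (\sum_(j < n.+1 * n.+1) mean_jump (time_step n *+ j) x y <=
    ((n.+1 * n.+1)%:R * jump_bound)%:E)%E.
Proof.
move=> yx.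
have s0 : 0 <= time_step n by rewrite ltW// time_step_gt0.
have := mean_height_sum (n.+1 * n.+1) s0 yx.
have -> : time_step n *+ (n.+1 * n.+1) = tau *+ n.+1.
  by rewrite mulrnA; congr (_ *+ _); rewrite -mulr_natr /time_step divfK// pnatr_eq0.
move=> /le_trans/(_ (expected_height_le iQ n.+1 x)).
set S := (\sum_(j < _) _)%E => hS.
have S0 : (0 <= S)%E by apply: sume_ge0 => j _; exact: mean_jump_ge0.
have hp : time_step n / 2 <= 1 - expR (- time_step n).
  by apply: ring_prob_ge; rewrite s0 time_step_le1.
have : ((time_step n / 2)%:E * S <= (n.+2%:R)%:E)%E.
  apply: le_trans hS; apply: lee_wpmul2r => //.
have t0 := short_time_gt0 (R := R) (d := d).
(* An infinite sum is impossible, as a positive multiple of it is at most [n + 2]. *)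
case: (S) S0 => [S' S0|_|//]; last by rewrite gt0_muley// lte_fin divr_gt0// time_step_gt0.
rewrite -EFinM !lee_fin => h.
have hs : time_step n / 2 != 0 by rewrite mulf_neq0 ?invr_eq0// gt_eqF// time_step_gt0.
have : S' <= n.+2%:R / (time_step n / 2).
  by rewrite ler_pdivlMr; [rewrite mulrC|rewrite divr_gt0// time_step_gt0].
move=> /le_trans; apply.
have -> : n.+2%:R / (time_step n / 2) = (n.+2 * 2)%:R * n.+1%:R / tau.
  by rewrite /time_step !invfM !invrK natrM; ring.
have -> : (n.+1 * n.+1)%:R * jump_bound = (n.+1 * 4)%:R * n.+1%:R / tau.
  by rewrite /jump_bound !natrM; ring.
rewrite ler_pM2r ?invr_gt0// ler_pM2r// ler_nat; lia.
Qed.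

Definition recentre (f : field d) : field d := fun x => f x - f 0.

Definition recentred (c : conf) (t : R) : field d := recentre (H c t).

Lemma cmeasurable_recentred t x : cmeasurable (fun c : conf => recentred c t x).
Proof.
exact: (cmeasurable_comp (fun p => p.1 - p.2) (cmeasurable_flat_pair t x 0)).
Qed.

Definition mean_abs t x : \bar R := (\int[Q]_c (`|recentred c t x|%N%:R)%:E)%E.

Lemma mean_abs_nbr t x y :
  (mean_abs t y <= mean_abs t x + (mean_jump t x y + mean_jump t y x))%E.
Proof.
have mj u v : measurable_fun setT (fun c : conf => ((posz (H c t u - H c t v))%:R : R)%:E).
  exact: (cmeasurable_fun (fun v : int * int => ((posz (v.2 - v.1))%:R)%:E)
    (cmeasurable_flat_pair t v u)).
have ma u : measurable_fun setT (fun c : conf => (`|recentred c t u|%N%:R : R)%:E).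
  exact: (cmeasurable_fun (fun v : int => (`|v|%N%:R)%:E) (cmeasurable_recentred t u)).
have e0 (v : nat) : (0 <= (v%:R : R)%:E)%E by rewrite lee_fin.
have E : (mean_abs t x + (mean_jump t x y + mean_jump t y x) =
  \int[Q]_c ((`|recentred c t x|%N%:R)%:E + (((posz (H c t y - H c t x))%:R)%:E +
    ((posz (H c t x - H c t y))%:R)%:E)))%E.
  rewrite ge0_integralD//; last 2 first.
  - by move=> c _; exact: adde_ge0.
  - exact: emeasurable_funD.
  by congr (_ + _)%E; rewrite ge0_integralD.
rewrite E; apply: ge0_le_integral => //.
  by apply: emeasurable_funD => //; exact: emeasurable_funD.
move=> c _; rewrite -!EFinD lee_fin -!natrD ler_nat /recentred /recentre.
have key (a b e : int) : (`|b - e| <= `|a - e| + (posz (b - a) + posz (a - b)))%N.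
  by rewrite /posz; lia.
exact: key.
Qed.

Lemma nbrs_sym (x y : site d) : y \in nbrs x -> x \in nbrs y.
Proof.
by move=> /nbrsP[i [->|->]]; apply/nbrsP; exists i; [right|left]; rewrite ?addrK ?subrK.
Qed.

(** The recentred height vanishes at the origin. Along a lattice path from there to [x], each edge
    costs the two one-sided mean jumps across it, which [sum_mean_jump] bounds. *)
Lemma sum_mean_abs x : exists C : R, forall n,
  (\sum_(j < n.+1 * n.+1) mean_abs (time_step n *+ j) x <= ((n.+1 * n.+1)%:R * C)%:E)%E.
Proof.
have S y z : z \in nbrs y -> (exists C : R, forall n,
  (\sum_(j < n.+1 * n.+1) mean_abs (time_step n *+ j) y <= ((n.+1 * n.+1)%:R * C)%:E)%E) ->
  (exists C : R, forall n,
  (\sum_(j < n.+1 * n.+1) mean_abs (time_step n *+ j) z <= ((n.+1 * n.+1)%:R * C)%:E)%E).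
  move=> zy [C HC]; exists (C + (jump_bound + jump_bound)) => n.
  apply: le_trans (_ : _ <= \sum_(j < n.+1 * n.+1) (mean_abs (time_step n *+ j) y +
    (mean_jump (time_step n *+ j) y z + mean_jump (time_step n *+ j) z y)))%E _.
    by apply: lee_sum => j _; exact: mean_abs_nbr.
  rewrite big_split !mulrDr !EFinD; apply: leeD; first exact: HC.
  by rewrite big_split; apply: leeD; apply: sum_mean_jump => //; exact: nbrs_sym.
elim/site_ind: x => [|x i|x i].
- exists 0 => n; rewrite mulr0 big1// => j _; rewrite /mean_abs integral0_eq// => c _.
  by rewrite /recentred /recentre subrr.
- by apply: S; exact: nbrsD.
- by apply: S; exact: nbrsB.
Qed.

End gradient_bound.

(** * The Markov property *)

Section random_map_kernel.
Context {R : realType} d1 d2 (E : measurableType d1) (C : measurableType d2).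
Variables (Q : probability C R) (F : E * C -> E).

Definition map_kernel (mF : measurable_fun setT F) (e : E) : {measure set E -> \bar R} :=
  law Q (measurableT_comp mF (measurable_pair1 e)).

Hypothesis mF : measurable_fun setT F.

Lemma map_kernelE e A : map_kernel mF e A = Q [set c | A (F (e, c))].
Proof. by []. Qed.

Let measurable_map_kernel U : measurable U ->
  measurable_fun setT (map_kernel mF ^~ U).
Proof.
move=> mU; have mA : measurable (F @^-1` U) by rewrite -[_ @^-1` _]setTI; exact: mF.
exact: (measurable_fun_section Q mA).
Qed.

HB.instance Definition _ := isKernel.Build _ _ _ _ _ (map_kernel mF)
  measurable_map_kernel.

Let map_kernel_prob x : map_kernel mF x setT = 1%E.
Proof. exact: probability_setT. Qed.

HB.instance Definition _ := Kernel_isProbability.Build _ _ _ _ _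
  (map_kernel mF) map_kernel_prob.

End random_map_kernel.

(** * Processes driven by clocks that can be glued *)

Section markov_from_clocks.
Context {R : realType} {d : nat} {dT : measure_display} {T : measurableType dT}.
Context {dE : measure_display} {E : measurableType dE}.
Notation conf := (config R (site d * nat)%type).
Variables (P : probability T R) (gapc : T -> conf).
Hypothesis iP : iid ex P gapc.
Variables (X : R -> field d * conf -> E) (step : R -> E * conf -> E).
Hypotheses (mX : forall t, measurable_fun setT (X t)).
Hypotheses (mstep : forall t, measurable_fun setT (step t)).

Let mgap : measurable_fun setT gapc := iP.1.
Let Q : probability conf R := law P mgap.

Lemma iid_law_gap : iid ex Q id.
Proof. by split; [exact: measurable_id|exact: iP.2]. Qed.

Let iQ := iid_law_gap.

Hypothesis step0 : forall e c, step 0 (e, c) = e.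
Hypothesis step_glue : forall s t, 0 <= s -> 0 <= t -> {ae prod_prob Q Q, forall z,
  forall e, step (s + t) (e, glue_config s z) = step t (step s (e, z.1), z.2)}.
Hypothesis X_before : forall s, 0 <= s -> {ae prod_prob Q Q, forall z,
  forall f r, r <= s -> X r (f, glue_config s z) = X r (f, z.1)}.
Hypothesis X_glue : forall s t, 0 <= s -> 0 <= t -> {ae prod_prob Q Q, forall z,
  forall f, X (s + t) (f, glue_config s z) = step t (X s (f, z.1), z.2)}.

Let K (t : R) : R.-pker E ~> E := map_kernel Q (mstep t).

Let mK t A : measurable A -> measurable_fun setT (fun e => K t e A).
Proof. by move=> mA; exact: (measurable_kernel (K t)). Qed.

Let measurable_glue_pre s (A : set conf) : measurable A ->
  measurable [set z : conf * conf | A (glue_config s z)].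
Proof.
by move=> mA; have := @measurable_glue_config R _ s measurableT A mA; rewrite setTI.
Qed.

Let measurable_pre dU dV (U : measurableType dU) (V : measurableType dV)
  (f : U -> V) (A : set V) : measurable_fun setT f -> measurable A ->
  measurable [set u | A (f u)].
Proof. by move=> mf mA; have := mf measurableT A mA; rewrite setTI. Qed.

(** On clocks glued at [s], the step of length [s] uses the first configuration and the step of
    length [t] the second, independent one; integrating over the second gives the Chapman-Kolmogorov
    identity. *)
Lemma map_kernel_semigroup : transition_semigroup K.
Proof.
split => [e A mA|s t e A s0 t0 mA].
  rewrite [LHS]map_kernelE.
  have -> : [set c : conf | A (step 0 (e, c))] = [set _ | A e].
    by apply/seteqP; split => c /=; rewrite step0.
  rewrite diracE; case: (pselect (A e)) => Ae.
    by rewrite mem_set// (_ : [set _ | _] = setT) ?probability_setT//; apply/seteqP; split.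
  by rewrite memNset// (_ : [set _ | _] = set0) ?measure0// -subset0.
have mA1 : measurable [set c : conf | A (step (s + t) (e, c))].
  exact: (measurable_pre (measurableT_comp (mstep (s + t)) (measurable_pair1 e)) mA).
rewrite [LHS]map_kernelE (law_glue iQ s0 mA1).
have ms : measurable_fun setT (fun c : conf => step s (e, c)).
  exact: (measurableT_comp (mstep s) (measurable_pair1 e)).
have mst : measurable_fun setT (fun z : conf * conf => step t (step s (e, z.1), z.2)).
  apply: (measurableT_comp (mstep t)); apply: measurable_fun_pair; last exact: measurable_snd.
  exact: (measurableT_comp ms measurable_fst).
rewrite (@ae_eq_prob _ _ _ _ _ [set z | A (step t (step s (e, z.1), z.2))]); last 3 first.
- exact: measurable_glue_pre.
- exact: (measurable_pre mst mA).
- by apply: filterS (step_glue s0 t0) => z H /=; rewrite H.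
rewrite [LHS]prod_probE; last exact: (measurable_pre mst mA).
rewrite (eq_measure_integral (law Q ms))//.
by rewrite (integral_law Q ms)//; exact: mK.
Qed.

Let Xgap (t : R) (p : field d * T) : E := X t (p.1, gapc p.2).

Let iota (p : field d * T) : field d * conf := (p.1, gapc p.2).

Let miota : measurable_fun setT iota.
Proof.
by apply: measurable_fun_pair => //; exact: (measurableT_comp mgap measurable_snd).
Qed.

(** Past events on the given probability space are pulled back from past events on configurations,
    where gluing makes sense. *)
Lemma history_lift s B : history Xgap s B ->
  exists2 B', history X s B' & B = iota @^-1` B'.
Proof.
pose S := [set B | exists2 B', history X s B' & B = iota @^-1` B'].
suff HS : history Xgap s `<=` S by exact: HS.
apply: smallest_sub; last first.
  move=> _ [r [A [rs mA ->]]]; exists (X r @^-1` A) => //.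
  by apply: sub_sigma_algebra; exists r, A.
have [h0 hD hU] : sigma_algebra setT (history X s) by exact: smallest_sigma_algebra.
split.
- by exists set0.
- move=> _ [B' hB' ->]; exists (setT `\` B') => //; exact: hD.
- move=> F HF; have [G GP] : {G : nat -> set (field d * conf) & forall n,
      history X s (G n) /\ F n = iota @^-1` (G n)}.
    apply: (@choice _ _ (fun n G => history X s G /\ F n = iota @^-1` G)) => n.
    by have [G hG e] := HF n; exists G.
  exists (\bigcup_n G n); first by apply: hU => n; exact: (GP n).1.
  by rewrite preimage_bigcup; apply: eq_bigcupr => n _; exact: (GP n).2.
Qed.

Lemma history_measurable s B : history X s B -> measurable B.
Proof.
suff HS : history X s `<=` measurable by exact: HS.
apply: smallest_sub; first exact: sigma_algebra_measurable.
by move=> _ [r [A [rs mA ->]]]; exact: (measurable_pre (mX r) mA).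
Qed.

(** The exceptional null set is that of [X_before], whatever [B] is. For a fixed sample point
    outside it, the events with the stated equivalence form a sigma-algebra containing the
    generators of the history. *)
Lemma history_glue s B : 0 <= s -> history X s B -> {ae prod_prob Q Q, forall z,
  forall f, B (f, glue_config s z) <-> B (f, z.1)}.
Proof.
move=> s0 hB; apply: filterS (X_before s0) => z Hz f.
pose S : set (set (field d * conf)) := [set B | B (f, glue_config s z) <-> B (f, z.1)].
suff HS : history X s `<=` S by exact: HS.
apply: smallest_sub; last first.
  by move=> _ [r [A [/andP[_ rs] mA ->]]]; rewrite /S /= Hz.
split => //.
- by move=> B' SB; split=> -[_ nB]; split=> // /SB.
- move=> F SF; split=> -[n _ Fn]; exists n => //; first exact: (SF n).1 Fn.
  exact: (SF n).2 Fn.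
Qed.

(** On clocks glued at [s], a past event depends on the first configuration only, and the future
    state is one step driven by the second. Integrating out the second configuration produces the
    kernel. *)
Lemma clocks_markov (rho : probability (field d) R) :
  markov_process (rho \x P)%E Xgap K.
Proof.
split=> [t t0|s t B A s0 t0 hB mA]; first exact: (measurableT_comp (mX t) miota).
have [B' hB' eB] := history_lift hB.
have mB' := history_measurable hB'.
have mB : measurable B by rewrite eB; exact: (measurable_pre miota mB').
pose C := B' `&` [set z | A (X (s + t) z)].
have mC : measurable C by apply: measurableI => //; exact: (measurable_pre (mX (s + t)) mA).
pose G (z : field d * conf) := ((fun z => K t (X s z) A) \_ B') z.
have mG : measurable_fun setT G.
  have mKX : measurable_fun setT (fun z => K t (X s z) A).
    exact: (measurableT_comp (mK t mA) (mX s)).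
  exact: ((measurable_restrictT _ mB').1 (measurable_funTS mKX)).
have G0 z : (0 <= G z)%E by rewrite /G patchE; case: ifP.
have mGi : measurable_fun setT (G \o iota) by exact: measurableT_comp.
transitivity (\int[rho]_f Q [set c | C (f, c)])%E.
  have -> : B `&` Xgap (s + t) @^-1` A = iota @^-1` C by rewrite eB.
  exact: (prod_probE rho P (measurable_pre miota mC)).
transitivity (\int[rho]_f \int[P]_w (G (iota (f, w))))%E; last first.
  rewrite [RHS]integral_mkcond.
  have -> : ((fun p => K t (Xgap s p) A) \_ B) = G \o iota.
    apply/funext => p; rewrite /G /= !patchE eB.
    by have -> : (p \in iota @^-1` B') = (iota p \in B') by apply/idP/idP; rewrite !inE.
  by rewrite [RHS](@fubini_tonelli1 _ _ _ _ _ rho P (G \o iota))// => p; exact: G0.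
apply: eq_integral => f _.
have mCf : measurable [set c | C (f, c)] by exact: (measurable_section f mC).
rewrite (law_glue iQ s0 mCf).
have mXf : measurable_fun setT (fun c : conf => X s (f, c)).
  exact: (measurableT_comp (mX s) (measurable_pair1 f)).
have mst : measurable_fun setT (fun z : conf * conf => step t (X s (f, z.1), z.2)).
  apply: (measurableT_comp (mstep t)); apply: measurable_fun_pair; last exact: measurable_snd.
  exact: (measurableT_comp mXf measurable_fst).
pose D := [set z : conf * conf | B' (f, z.1)] `&` [set z | A (step t (X s (f, z.1), z.2))].
have mD : measurable D.
  apply: measurableI; last exact: (measurable_pre mst mA).
  apply: (measurable_pre (f := fun z : conf * conf => (f, z.1)) _ mB').
  by apply: measurable_fun_pair.
rewrite (@ae_eq_prob _ _ _ _ _ D)//; last 2 first.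
- exact: measurable_glue_pre.
- have H1 := history_glue s0 hB'.
  apply: filterS (filterI H1 (X_glue s0 t0)) => z [h1 h2].
  by rewrite /C /D /= h2; split=> -[/h1].
rewrite [LHS]prod_probE//.
rewrite -(integral_law P mgap (g := fun c => G (f, c))); last 2 first.
- exact: (measurableT_comp mG (measurable_pair1 f)).
- by move=> c; exact: G0.
apply: eq_integral => c _; rewrite /G patchE.
case: ifP => cB.
  have {}cB := set_mem cB.
  by rewrite [RHS]map_kernelE; congr (Q _); apply/seteqP; split => c' //= -[].
rewrite (_ : [set y | D (c, y)] = set0) ?measure0// -subset0 => c' [/= /mem_set].
by rewrite cB.
Qed.

Lemma clocks_time_homogeneous_markov : time_homogeneous_markov P Xgap.
Proof. exists K; split; [exact: map_kernel_semigroup|exact: clocks_markov]. Qed.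

End markov_from_clocks.

(** * Recentred heights and gradients as clock-driven processes *)

Section ballistic_processes.
Context {R : realType} {d : nat}.
Notation conf := (config R (site d * nat)%type).

Definition w_map (t : R) (z : field d * conf) : field d :=
  recentre (height (clocks z.2) z.1 t).

(* Agrees with [w_map] on the fields vanishing at the origin, and is the identity
   at time 0 on all fields. *)
Definition w_step (t : R) (z : field d * conf) : field d :=
  fun x => height (clocks z.2) z.1 t x - height (clocks z.2) z.1 t 0 + z.1 0.

Definition gradient_map (t : R) (z : field d * conf) : gradient_field d :=
  grad (height (clocks z.2) z.1 t).

Definition gradient_step (t : R) (z : gradient_field d * conf) : gradient_field d :=
  gradient_map t (potential z.1, z.2).

Lemma measurable_recentre : measurable_fun setT (@recentre d).
Proof.
apply: measurable_field => x.
apply: (@cmeasurable_comp _ _ _ _ (fun f : field d => (f x, f 0)) (fun p => p.1 - p.2)).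
by apply: cmeasurable_pair; exact: cmeasurable_field_coord.
Qed.

Lemma measurable_w_map t : measurable_fun setT (w_map t).
Proof. exact: (measurableT_comp measurable_recentre (measurable_height t)). Qed.

Lemma measurable_w_step t : measurable_fun setT (w_step t).
Proof.
apply: measurable_field => x.
apply: (@cmeasurable_comp _ _ _ _ (fun z : field d * conf =>
  ((height (clocks z.2) z.1 t x, height (clocks z.2) z.1 t 0), z.1 0))
  (fun p => p.1.1 - p.1.2 + p.2)).
apply: cmeasurable_pair.
  by apply: cmeasurable_pair; exact: cmeasurable_height.
exact: (cmeasurable_pullback measurable_fst (cmeasurable_field_coord 0)).
Qed.

Lemma measurable_gradient_map t : measurable_fun setT (gradient_map t).
Proof. exact: (measurableT_comp (@measurable_grad d) (measurable_height t)). Qed.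

Lemma measurable_gradient_step t : measurable_fun setT (gradient_step t).
Proof.
apply: (measurableT_comp (measurable_gradient_map t)).
apply: measurable_fun_pair; last exact: measurable_snd.
exact: (measurableT_comp (@measurable_potential d) measurable_fst).
Qed.

Lemma grad_shift (f : field d) (a : int) : grad ((fun x => f x + a) : field d) = grad f.
Proof.
apply: grad_eq; apply/funext => x; apply/funext => i; rewrite /delta.
by rewrite opprD addrACA subrr addr0.
Qed.

Section almost_surely.
Variable Q : probability conf R.
Hypothesis iQ : iid ex Q id.

(** Recentring at an intermediate time shifts the field by a constant, which the dynamics carries
    along unchanged and the final normalisation cancels. *)
Lemma w_step_glue s t : 0 <= s -> 0 <= t -> {ae prod_prob Q Q, forall z, forall e,
  w_step (s + t) (e, glue_config s z) = w_step t (w_step s (e, z.1), z.2)}.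
Proof.
move=> s0 t0; near=> z => e; have : forall f, height (clocks (glue_config s z)) f (s + t) =
    height (clocks z.2) (height (clocks z.1) f s) t.
  by near: z; exact: ae_height_glue.
have [r1 r2 r3 FI1 FI2] : [/\ regular (clocks z.1), regular (clocks z.2),
   regular (clocks (glue_config s z)),
   finitely_influenced (clocks z.1) s & finitely_influenced (clocks z.2) t].
  by near: z; exact: ae_glue_good.
move=> gE; apply/funext => x; rewrite /w_step /= gE.
set h := height (clocks z.1) e s.
have -> : (fun y => h y - h 0 + e 0) = (fun y => h y + (e 0 - h 0)).
  by apply/funext => y; lia.
rewrite height_shift// /=. ring.
Unshelve. all: by end_near. Qed.

Lemma w_map_glue s t : 0 <= s -> 0 <= t -> {ae prod_prob Q Q, forall z, forall f,
  w_map (s + t) (f, glue_config s z) = w_step t (w_map s (f, z.1), z.2)}.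
Proof.
move=> s0 t0; near=> z => e; have : forall f, height (clocks (glue_config s z)) f (s + t) =
    height (clocks z.2) (height (clocks z.1) f s) t.
  by near: z; exact: ae_height_glue.
have [r1 r2 r3 FI1 FI2] : [/\ regular (clocks z.1), regular (clocks z.2),
   regular (clocks (glue_config s z)),
   finitely_influenced (clocks z.1) s & finitely_influenced (clocks z.2) t].
  by near: z; exact: ae_glue_good.
move=> gE; apply/funext => x; rewrite /w_map /w_step /recentre /= gE.
rewrite height_shift// /=; ring.
Unshelve. all: by end_near. Qed.

Lemma gradient_map_glue s t : 0 <= s -> 0 <= t -> {ae prod_prob Q Q, forall z, forall f,
  gradient_map (s + t) (f, glue_config s z) =
  gradient_step t (gradient_map s (f, z.1), z.2)}.
Proof.
move=> s0 t0; near=> z => e; have : forall f, height (clocks (glue_config s z)) f (s + t) =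
    height (clocks z.2) (height (clocks z.1) f s) t.
  by near: z; exact: ae_height_glue.
have [r1 r2 r3 FI1 FI2] : [/\ regular (clocks z.1), regular (clocks z.2),
   regular (clocks (glue_config s z)),
   finitely_influenced (clocks z.1) s & finitely_influenced (clocks z.2) t].
  by near: z; exact: ae_glue_good.
move=> gE; rewrite /gradient_step /gradient_map /= gE.
by rewrite (potential_unique erefl) height_shift// grad_shift.
Unshelve. all: by end_near. Qed.

Lemma gradient_step_glue s t : 0 <= s -> 0 <= t -> {ae prod_prob Q Q, forall z, forall v,
  gradient_step (s + t) (v, glue_config s z) =
  gradient_step t (gradient_step s (v, z.1), z.2)}.
Proof.
move=> s0 t0; apply: filterS (gradient_map_glue s0 t0) => z H v.
exact: (H (potential v)).
Qed.

Lemma w_map_before s : 0 <= s -> {ae prod_prob Q Q, forall z, forall f r,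
  r <= s -> w_map r (f, glue_config s z) = w_map r (f, z.1)}.
Proof.
move=> s0; apply: filterS (ae_height_glue_before iQ s0) => z H f r rs.
by rewrite /w_map /= H.
Qed.

Lemma gradient_map_before s : 0 <= s -> {ae prod_prob Q Q, forall z, forall f r,
  r <= s -> gradient_map r (f, glue_config s z) = gradient_map r (f, z.1)}.
Proof.
move=> s0; apply: filterS (ae_height_glue_before iQ s0) => z H f r rs.
by rewrite /gradient_map /= H.
Qed.

End almost_surely.

Lemma w_step0 f c : w_step 0 (f, c) = f.
Proof. by apply/funext => x; rewrite /w_step /= height_nonpos// subrK. Qed.

Lemma gradient_step0 v c : gradient_step 0 (v, c) = v.
Proof.
by rewrite /gradient_step /gradient_map /= height_nonpos// potentialK.
Qed.

End ballistic_processes.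

Section poisson.
Context {R : realType} {d : nat} {dT : measure_display} {T : measurableType dT}.
Variables (P : probability T R) (gap : site d -> nat -> T -> R).
Hypothesis hgap : poisson_clocks P gap.

Definition gap_config (w : T) : config R (site d * nat)%type := fun p => gap p.1 p.2 w.

Lemma iid_gap : iid ex P gap_config.
Proof.
have [hl hi] := hgap; split.
  by apply: measurable_config => p; exact: (hl p.1 p.2).1.
move=> J B mB.
transitivity (P (\bigcap_(i in [set` J]) (gap i.1 i.2) @^-1` B i)); first by [].
rewrite (hi J B mB); apply: eq_bigr => p _.
by rewrite (hl p.1 p.2).2.
Qed.

Lemma w_markov : time_homogeneous_markov P (w_process gap).
Proof.
change (time_homogeneous_markov P (fun t p => w_map t (p.1, gap_config p.2))).
apply: (clocks_time_homogeneous_markov (iP := iid_gap) measurable_w_map measurable_w_step).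
- exact: w_step0.
- by move=> s t; apply: w_step_glue; exact: iid_law_gap.
- by move=> s; apply: w_map_before; exact: iid_law_gap.
- by move=> s t; apply: w_map_glue; exact: iid_law_gap.
Qed.

Lemma gradient_markov : time_homogeneous_markov P (gradient_process gap).
Proof.
change (time_homogeneous_markov P (fun t p => gradient_map t (p.1, gap_config p.2))).
apply: (clocks_time_homogeneous_markov (iP := iid_gap) measurable_gradient_map measurable_gradient_step).
- exact: gradient_step0.
- by move=> s t; apply: gradient_step_glue; exact: iid_law_gap.
- by move=> s; apply: gradient_map_before; exact: iid_law_gap.
- by move=> s t; apply: gradient_map_glue; exact: iid_law_gap.
Qed.

Lemma grad_w_process t p : grad (w_process gap t p) = gradient_process gap t p.
Proof. exact: grad_shift. Qed.

Lemma potential_gradient_process t p :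
  potential (gradient_process gap t p) = w_process gap t p.
Proof. by rewrite (potential_unique erefl). Qed.

Lemma has_law_comp d1 d2 d3 (T1 : measurableType d1) (E : measurableType d2)
    (E' : measurableType d3) (M : set T1 -> \bar R) (X : T1 -> E)
    (g : E -> E') (mu : set E -> \bar R) (nu : set E' -> \bar R) :
  measurable_fun setT g ->
  (forall A, measurable A -> mu (g @^-1` A) = nu A) ->
  has_law M X mu -> has_law M (g \o X) nu.
Proof.
move=> mg gnu [mX H]; split; first exact: measurableT_comp.
move=> A mA; rewrite -gnu// -H//.
by rewrite -[_ @^-1` _]setTI; exact: mg.
Qed.

(** [grad] and [potential] carry the two processes into each other at every sample point. On laws,
    they are inverse between [mu] and [nu], because [potential] undoes [grad] on fields vanishing at
    the origin. *)
Lemma stationary_iff (mu : probability (field d) R) (nu : probability (gradient_field d) R) :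
  mu [set g : field d | g 0 = 0] = 1%E -> has_law mu (@grad d) nu ->
  (stationary P (w_process gap) mu <-> stationary P (gradient_process gap) nu).
Proof.
move=> mu0 [mg munu].
have mz : measurable [set g : field d | g 0 = 0] by exact: cmeasurable_field_coord.
have grad_law A : measurable A -> mu (@grad d @^-1` A) = nu A by exact: munu.
have pot_law A : measurable A -> nu (@potential d @^-1` A) = mu A.
  move=> mA; have mpA : measurable (@potential d @^-1` A).
    by rewrite -[_ @^-1` _]setTI; exact: measurable_potential.
  rewrite -grad_law//; apply: ae_eq_prob => //.
    by rewrite -[_ @^-1` _]setTI; exact: measurable_grad.
  apply: filterS ((ae_prob1 mu mz).2 mu0) => g /= g0.
  suff -> : potential (grad g) = g by [].
  rewrite (potential_unique erefl); apply/funext => x.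
  by rewrite g0 subr0.
have wg t rho : has_law (rho \x P)%E (w_process gap t) mu <->
    has_law (rho \x P)%E (gradient_process gap t) nu.
  split=> H.
    rewrite (_ : gradient_process gap t = @grad d \o w_process gap t).
      exact: (has_law_comp (@measurable_grad d) grad_law H).
    by apply/funext => p; rewrite /= grad_w_process.
  rewrite (_ : w_process gap t = @potential d \o gradient_process gap t).
    exact: (has_law_comp (@measurable_potential d) pot_law H).
  by apply/funext => p; rewrite /= potential_gradient_process.
split=> -[[rho H0] H]; split.
- by exists rho; apply/wg.
- by move=> rho' /wg H1 t t0; apply/wg; exact: H.
- by exists rho; apply/wg.
- by move=> rho' /wg H1 t t0; apply/wg; exact: H.
Qed.

End poisson.

(** * An invariant law as an ultralimit of time averages *)

Lemma ultra_finite (U : set_system nat) (X : eqType) (h : nat -> X) (s : seq X) :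
  UltraFilter U -> (\forall n \near U, h n \in s) ->
  exists x, \forall n \near U, h n = x.
Proof.
move=> UU; elim: s => [|x s IH] H.
  have [n /=] := @filter_ex _ U _ _ H; first by [].
have [hx|hx] := in_ultra_setVsetC [set n | h n = x] UU; first by exists x.
apply: IH; apply: filterS2 hx H => n /= nx.
by rewrite in_cons => /orP[/eqP//|].
Qed.

(* Carries the algebra of finitely determined events, whereas [field d] carries
   the sigma-algebra that they generate. *)
Definition cylinder_space (d : nat) := site d -> int.

HB.instance Definition _ (d : nat) := gen_eqMixin (cylinder_space d).
HB.instance Definition _ (d : nat) := gen_choiceMixin (cylinder_space d).
HB.instance Definition _ (d : nat) :=
  isPointed.Build (cylinder_space d) (fun=> 0 : int).

HB.instance Definition _ (d : nat) :=
  @isAlgebraOfSets.Build default_measure_display (cylinder_space d)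
    [set A | finitely_determined A] (@finitely_determined0 d)
    (@finitely_determinedU d) (@finitely_determinedC d).

Section ultralimit.
Context {R : realType} {d : nat} (U : set_system nat) {UU : UltraFilter U}.
Hypothesis U_oo : \oo `<=` U.
Variable o : nat -> set (site d -> int) -> R.
Hypothesis o0 : forall n A, 0 <= o n A.
Hypothesis oT : forall n, o n setT = 1.
Hypothesis oU : forall n A B, finitely_determined A -> finitely_determined B ->
  A `&` B = set0 -> o n (A `|` B) = o n A + o n B.
Hypothesis tight : forall x (eps : R), 0 < eps ->
  exists M : nat, forall n, o n [set g | (M < `|g x|)%N] <= eps.

Let o_set0 n : o n set0 = 0.
Proof.
have := @oU n set0 set0 (@finitely_determined0 d) (@finitely_determined0 d).
by rewrite setI0 setU0 => /(_ erefl); lra.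
Qed.

Let o_le n A B : finitely_determined A -> finitely_determined B -> A `<=` B ->
  o n A <= o n B.
Proof.
move=> fA fB AB; rewrite -(setDUK AB) oU ?lerDl//; last by rewrite setDE setICA setICr setI0.
by rewrite setDE; apply: finitely_determinedI => //; exact: finitely_determinedC.
Qed.

Let o_le1 n A : finitely_determined A -> o n A <= 1.
Proof. by move=> fA; rewrite -(oT n); apply: o_le => //; exact: finitely_determinedT. Qed.

Definition ultralimit (A : set (site d -> int)) : R := lim (o n A @[n --> U]).

(** The values lie in the compact interval from 0 to 1, so they have a cluster point. The
    ultrafilter contains the indices close to it or those far from it, and the latter would
    contradict clustering. *)
Lemma cvg_ultralimit A : finitely_determined A -> o n A @[n --> U] --> ultralimit A.
Proof.
move=> fA.
have FI : (o n A @[n --> U]) `[0, 1]%classic.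
  by apply: nearW => n /=; rewrite in_itv /= o0; exact: o_le1.
have [l [_ cl]] := @segment_compact R 0 1 _ _ FI.
suff ol : o n A @[n --> U] --> l by rewrite /ultralimit (cvg_lim _ ol).
apply/cvgrPdist_lt => e e0.
have [//|far] := in_ultra_setVsetC [set n | `|l - o n A| < e] UU.
have [r [/= Hr lr]] := cl (~` [set r | `|l - r| < e]) (ball l e) far (nbhsx_ballx l e e0).
by case: Hr; move: lr; rewrite /ball /=.
Qed.

Let near_eq_le (a b : nat -> R) (la lb : R) : a @ U --> la -> b @ U --> lb ->
  (forall n, a n <= b n) -> la <= lb.
Proof.
move=> ca cb H.
by rewrite -(cvg_lim (@Rhausdorff R) ca) -(cvg_lim (@Rhausdorff R) cb);
  apply: ler_lim; [apply/cvg_ex; exists la|apply/cvg_ex; exists lb|exact: nearW].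
Qed.

Let lim_ge0 A : finitely_determined A -> 0 <= ultralimit A.
Proof.
move=> fA; apply: (near_eq_le (cvg_cst 0) (cvg_ultralimit fA)) => n; exact: o0.
Qed.

Let lim_unique (a : nat -> R) (l l' : R) : a @ U --> l -> a @ U --> l' -> l = l'.
Proof. by move=> h h'; rewrite -(cvg_lim (@Rhausdorff R) h) (cvg_lim (@Rhausdorff R) h'). Qed.

Let limU A B : finitely_determined A -> finitely_determined B ->
  A `&` B = set0 -> ultralimit (A `|` B) = ultralimit A + ultralimit B.
Proof.
move=> fA fB AB; apply: (lim_unique (cvg_ultralimit (finitely_determinedU fA fB))).
under eq_fun do rewrite oU//.
exact: cvgD (cvg_ultralimit fA) (cvg_ultralimit fB).
Qed.

Let limT : ultralimit setT = 1.
Proof.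
apply: (lim_unique (cvg_ultralimit (@finitely_determinedT d))).
by under eq_fun do rewrite oT; exact: cvg_cst.
Qed.

Let lim_set0 : ultralimit set0 = 0.
Proof.
apply: (lim_unique (cvg_ultralimit (@finitely_determined0 d))).
by under eq_fun do rewrite o_set0; exact: cvg_cst.
Qed.

Let lim_le A B : finitely_determined A -> finitely_determined B -> A `<=` B ->
  ultralimit A <= ultralimit B.
Proof.
move=> fA fB AB; apply: (near_eq_le (cvg_ultralimit fA) (cvg_ultralimit fB)) => n.
exact: o_le.
Qed.

Let limD A B : finitely_determined A -> finitely_determined B ->
  ultralimit (A `|` B) <= ultralimit A + ultralimit B.
Proof.
move=> fA fB; have fBA : finitely_determined (B `\` A).
  by rewrite setDE; apply: finitely_determinedI => //; exact: finitely_determinedC.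
rewrite (_ : A `|` B = A `|` (B `\` A)); last first.
  apply/seteqP; split => f [Af|]; [by left| |by left|by case; right].
  by move=> Bf; case: (pselect (A f)); [left|right].
rewrite limU//; last by rewrite setDE setICA setICr setI0.
by rewrite lerD2l; apply: lim_le => //; exact: subDsetl.
Qed.

Let limI_tight x (eps : R) : 0 < eps -> exists M : nat,
  ultralimit [set g | (M < `|g x|)%N] <= eps.
Proof.
move=> /(tight x)[M HM]; exists M.
apply: (near_eq_le (cvg_ultralimit _) (cvg_cst eps)) => //.
exact: (finitely_determined_coord x [set v : int | (M < `|v|)%N]).
Qed.

Let fd_bigsetU (F : nat -> set (site d -> int)) n :
  (forall i, finitely_determined (F i)) -> finitely_determined (\big[setU/set0]_(i < n) F i).
Proof.
move=> fF; elim/big_rec: _ => [|i A _ fA]; first exact: finitely_determined0.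
exact: finitely_determinedU.
Qed.

Let lim_bigsetU (F : nat -> set (site d -> int)) n :
  (forall i, finitely_determined (F i)) -> trivIset setT F ->
  ultralimit (\big[setU/set0]_(i < n) F i) = \sum_(i < n) ultralimit (F i).
Proof.
move=> fF tF; elim: n => [|n IH]; first by rewrite !big_ord0 lim_set0.
rewrite !big_ord_recr /= limU ?IH//; first exact: fd_bigsetU.
rewrite -bigcup_mkord -subset0 => x [[i /= ilt Fi] Fn].
have e : i = n by apply: tF => //; exists x.
by move: ilt; rewrite e ltnn.
Qed.

Let lim_bigsetU_le (F : nat -> set (site d -> int)) n :
  (forall i, finitely_determined (F i)) ->
  ultralimit (\big[setU/set0]_(i < n) F i) <= \sum_(i < n) ultralimit (F i).
Proof.
move=> fF; elim: n => [|n IH]; first by rewrite !big_ord0 lim_set0.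
rewrite !big_ord_recr /=; apply: le_trans (limD (fd_bigsetU _ fF) (fF n)) _.
by rewrite lerD2r.
Qed.

(* Compactness: up to a set of small content, the sets lie in a product of finite
   intervals, and points chosen in them have a pointwise ultralimit. *)
Lemma ultralimit_continuous (S : nat -> set (site d -> int)) (eps : R) : 0 < eps ->
  (forall n, finitely_determined (S n)) ->
  (forall m n, (m <= n)%N -> S n `<=` S m) -> \bigcap_n S n = set0 ->
  exists n, ultralimit (S n) <= eps.
Proof.
move=> e0 fS decS S0; apply: contrapT => /forallNP nS.
have {}nS n : eps < ultralimit (S n) by rewrite ltNge; apply/negP.
have eM i : 0 < eps * 2^-1 ^+ i.+1 by rewrite mulr_gt0// exprn_gt0// invr_gt0.
(* Sites are numbered by [pickle], and the heights at each are truncated at a level whose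
   exceptional sets have contents summing to at most [eps]. *)
have [M MP] : {M : site d -> nat & forall x,
    ultralimit [set g | (M x < `|g x|)%N] <= eps * 2^-1 ^+ (choice.pickle x).+1}.
  apply: (@choice _ _ (fun x (M : nat) => ultralimit [set g | (M < `|g x|)%N] <=
    eps * 2^-1 ^+ (choice.pickle x).+1)) => x.
  exact: limI_tight.
pose bad (i : nat) : set (site d -> int) :=
  if @choice.pickle_inv (site d) i is Some x then [set g | (M x < `|g x|)%N] else set0.
have bad_pickle x : bad (choice.pickle x) = [set g | (M x < `|g x|)%N].
  by rewrite /bad choice.pickleK_inv.
have fbad i : finitely_determined (bad i).
  rewrite /bad; case: (@choice.pickle_inv _ _) => [x|]; last exact: finitely_determined0.
  exact: (finitely_determined_coord x [set v : int | (M x < `|v|)%N]).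
have badle i : ultralimit (bad i) <= eps * 2^-1 ^+ i.+1.
  rewrite /bad; case E : (@choice.pickle_inv _ i) => [x|]; last by rewrite lim_set0 ltW.
  suff <- : choice.pickle x = i by exact: MP.
  by have := choice.pickle_invK (T := site d) i; rewrite E.
(* The first [n] exceptional sets have total content at most [eps], strictly less than that of
   [S n], so they cannot cover it. *)
have [g gP] : {g : nat -> site d -> int & forall n,
    S n (g n) /\ ~ (\big[setU/set0]_(i < n) bad i) (g n)}.
  apply: (@choice _ _ (fun n g => S n g /\ ~ (\big[setU/set0]_(i < n) bad i) g)) => n.
  apply: contrapT => /forallNP H.
  have SB : S n `<=` \big[setU/set0]_(i < n) bad i.
    by move=> f Sf; apply: contrapT => nB; exact: (H f).
  have := nS n; rewrite ltNge => /negP; apply.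
  apply: le_trans (lim_le (fS n) (fd_bigsetU n fbad) SB) _.
  apply: le_trans (lim_bigsetU_le n fbad) _.
  apply: le_trans (_ : \sum_(i < n) eps * 2^-1 ^+ i.+1 <= _).
    by apply: ler_sum => i _; exact: badle.
  rewrite -mulr_sumr -[leRHS]mulr1 ler_pM2l//.
  suff -> : \sum_(i < n) 2^-1 ^+ i.+1 = 1 - 2^-1 ^+ n :> R.
    by rewrite gerBl exprn_ge0// invr_ge0.
  elim: (n) => [|k IH]; first by rewrite big_ord0 expr0 subrr.
  by rewrite big_ord_recr /= IH !exprS; lra.
(* Once [n] exceeds the code of [x], the value [g n x] is confined to finitely many integers, and is
   therefore constant along the ultrafilter. *)
have glim x : exists v, \forall n \near U, g n x = v.
  pose s := [seq (k : nat)%:Z | k <- iota 0 (M x).+1] ++ [seq - (k : nat)%:Z | k <- iota 0 (M x).+1].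
  apply: (@ultra_finite _ _ _ s UU).
  have : \forall n \near U, (choice.pickle x < n)%N.
    by apply: U_oo; exists (choice.pickle x).+1.
  apply: filterS => n xn.
  have : ~ bad (choice.pickle x) (g n).
    move=> H; apply: (gP n).2; rewrite -bigcup_mkord.
    by exists (choice.pickle x).
  rewrite bad_pickle /= => /negP; rewrite -leqNgt => gM.
  rewrite mem_cat; apply/orP; case: (leP 0 (g n x)) => h; [left|right].
    by apply/mapP; exists `|g n x|%N; [rewrite mem_iota|]; lia.
  by apply/mapP; exists `|g n x|%N; [rewrite mem_iota|]; lia.
have [f fP] : {f : site d -> int & forall x, \forall n \near U, g n x = f x}.
  exact: (@choice _ _ (fun x v => \forall n \near U, g n x = v)).
suff : (\bigcap_n S n) f by rewrite S0.
(* On the finitely many sites deciding [S m], the limit [f] agrees with some [g n] such that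
   [m <= n], and [S n] is contained in [S m]. *)
move=> m _; have [D HD] := fS m.
have : \forall n \near U, (m <= n)%N /\ {in D, g n =1 f}.
  apply: filterI; first by apply: U_oo; exists m.
  elim: D {HD} => [|x D IH]; first by apply: nearW => n x; rewrite in_nil.
  apply: filterS2 (fP x) IH => n e H y; rewrite in_cons => /orP[/eqP->//|]; exact: H.
move=> /(@filter_ex _ U)[n [mn gf]].
by apply: (HD (g n)) => //; apply: decS mn _ _; exact: (gP n).1.
Qed.

Let phi (A : set (cylinder_space d)) : \bar R := (ultralimit A)%:E.

Let phi0 : phi set0 = 0%E. Proof. by rewrite /phi lim_set0. Qed.

Let phi_ge0 A : (0 <= phi A)%E.
Proof.
(* The measure structure asks for nonnegativity on every set; where there is no limit, [lim] takes
   its default value. *)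
rewrite lee_fin /ultralimit; case: (pselect (cvg (o n A @[n --> U]))) => c.
  by apply: limr_ge => //; exact: nearW.
by rewrite dvgP.
Qed.

(** Partial sums miss the content of the union by that of the remainder [S n]. The remainders
    decrease to the empty set, and [ultralimit_continuous] makes their contents vanish. *)
Let phi_sigma_additive : semi_sigma_additive phi.
Proof.
move=> F mF tF mUF.
have fF i : finitely_determined (F i) by exact: mF.
have fUF : finitely_determined (\bigcup_n F n) by exact: mUF.
pose S n := \bigcup_i F i `\` \big[setU/set0]_(i < n) F i.
have fS n : finitely_determined (S n).
  rewrite /S setDE; apply: finitely_determinedI => //.
  by apply: finitely_determinedC; exact: fd_bigsetU.
have decS m n : (m <= n)%N -> S n `<=` S m.
  by move=> mn; apply: setDS; exact: subset_bigsetU.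
have S0 : \bigcap_n S n = set0.
  rewrite -subset0 => f H; have [[i _ Fi] _] := H 0%N I.
  have [_ nF] := H i.+1 I; apply: nF.
  by rewrite -bigcup_mkord; exists i => /=.
have sumE n : (\sum_(0 <= i < n) phi (F i) = (ultralimit (\bigcup_i F i) - ultralimit (S n))%:E)%E.
  rewrite sumEFin; congr EFin; rewrite big_mkord -(lim_bigsetU n fF tF).
  apply/eqP; rewrite eq_sym subr_eq; apply/eqP.
  rewrite -limU//; last by rewrite /S setDE setICA setICr setI0.
    rewrite setDUK// => f; rewrite -bigcup_mkord => -[i _ Fi]; by exists i.
  exact: fd_bigsetU.
under eq_fun do rewrite sumE.
apply/cvg_EFin; first by apply: nearW.
rewrite -[X in _ --> X]subr0; apply: cvgB; first exact: cvg_cst.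
apply/cvgrPdist_le => e e0.
have [N HN] := ultralimit_continuous e0 fS decS S0.
exists N => // n /= Nn; rewrite sub0r normrN ger0_norm; last exact: lim_ge0.
by apply: le_trans HN; apply: lim_le => //; exact: decS.
Qed.

HB.instance Definition _ := isMeasure.Build _ (cylinder_space d) R phi
  phi0 phi_ge0 phi_sigma_additive.

Let I := g_sigma_algebraType (@measurable _ (cylinder_space d)).

Let id_field : I -> field d := idfun.

Let measurable_id_field : measurable_fun setT id_field.
Proof.
by move=> _ A; rewrite measurable_fieldE setTI.
Qed.

Let ext : set I -> \bar R := measure_extension phi.

HB.instance Definition _ := Measure.on ext.

Let extE A : finitely_determined A -> ext A = (ultralimit A)%:E.
Proof. by move=> fA; rewrite /ext /measure_extension measurable_mu_extE. Qed.

Let extT : ext setT = 1%E.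
Proof. by rewrite extE ?limT//; exact: finitely_determinedT. Qed.

HB.instance Definition _ := Measure_isProbability.Build _ _ _ ext extT.

(** Caratheodory extension from the algebra of finitely determined events, which generates the Borel
    sets. *)
Lemma ultralimit_measure : exists mu : probability (field d) R,
  forall A, finitely_determined A -> mu A = (ultralimit A)%:E.
Proof.
by exists (law ext measurable_id_field) => A fA; exact: extE.
Qed.

End ultralimit.

(** * Time averages started from the flat field *)

Section occupation.
Context {R : realType} {d : nat}.
Notation conf := (config R (site d * nat)%type).
Variable Q : probability conf R.
Hypothesis iQ : iid ex Q id.
Notation tau := (@short_time R d).
Notation step := (@time_step R d).

Lemma measurable_recentred t : measurable_fun setT (fun c : conf => recentred c t : field d).
Proof. by apply: measurable_field => x; exact: cmeasurable_recentred. Qed.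

Definition w_law t : probability (field d) R := law Q (measurable_recentred t).

Definition w_prob t (A : set (site d -> int)) : R := fine (w_law t A).

Lemma w_probE t A : finitely_determined A -> w_law t A = (w_prob t A)%:E.
Proof.
move=> fA; rewrite fineK// fin_num_measure//.
exact: measurable_finitely_determined.
Qed.

Lemma w_prob_ge0 t A : 0 <= w_prob t A. Proof. exact: fine_ge0. Qed.

Lemma w_prob_le1 t A : finitely_determined A -> w_prob t A <= 1.
Proof.
move=> fA; rewrite -lee_fin -w_probE//; apply: probability_le1.
exact: measurable_finitely_determined.
Qed.

Definition occupation (n : nat) (A : set (site d -> int)) : R :=
  (\sum_(j < n.+1 * n.+1) w_prob (step n *+ j) A) / (n.+1 * n.+1)%:R.

Let N_gt0 n : 0 < (n.+1 * n.+1)%:R :> R. Proof. by rewrite ltr0n. Qed.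

Lemma occupation_ge0 n A : 0 <= occupation n A.
Proof. by rewrite divr_ge0// sumr_ge0// => j _; exact: w_prob_ge0. Qed.

Lemma occupation_const n A (v : R) : (forall j : nat, w_prob (step n *+ j) A = v) ->
  occupation n A = v.
Proof.
move=> H; rewrite /occupation (eq_bigr (fun=> v))//.
by rewrite big_const_ord iter_addr_0 -[v *+ _]mulr_natr mulfK// gt_eqF.
Qed.

Lemma occupationT n : occupation n setT = 1.
Proof. by apply: occupation_const => j; rewrite /w_prob probability_setT. Qed.

Lemma occupation_origin n : occupation n [set g | g 0 = 0] = 1.
Proof.
apply: occupation_const => j; rewrite /w_prob.
suff -> : w_law (step n *+ j) [set g | g 0 = 0] = 1%E by [].
change (Q [set c | recentred c (step n *+ j) 0 = 0] = 1%E).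
rewrite (_ : [set _ | _] = setT) ?probability_setT//.
by apply/seteqP; split => // c _; rewrite /= /recentred /recentre subrr.
Qed.

Lemma occupationU n A B : finitely_determined A -> finitely_determined B ->
  A `&` B = set0 -> occupation n (A `|` B) = occupation n A + occupation n B.
Proof.
move=> fA fB AB; rewrite /occupation -mulrDl -big_split; congr (_ / _).
apply: eq_bigr => j _; apply: EFin_inj; rewrite EFinD -!w_probE//; last exact: finitely_determinedU.
by apply: measureU => //; exact: measurable_finitely_determined.
Qed.

Lemma finitely_determined_tail x M : @finitely_determined d [set g | (M < `|g x|)%N].
Proof. exact: (finitely_determined_coord x [set v : int | (M < `|v|)%N]). Qed.

(** An absolute value is the number of levels [M] below it. Truncated sums of tails involve only
    finitely many finitely determined events, so, unlike the moment itself, they pass to the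
    ultralimit. *)
Lemma w_tail_sum t x K :
  ((\sum_(M < K) w_prob t [set g | (M < `|g x|)%N])%:E <= mean_abs Q t x)%E.
Proof.
pose F (M : nat) := [set c : conf | (M < `|recentred c t x|)%N].
have mF M : measurable (F M).
  exact: (cmeasurable_preimage [set v : int | (M < `|v|)%N] (cmeasurable_recentred t x)).
have -> : ((\sum_(M < K) w_prob t [set g | (M < `|g x|)%N])%:E =
    \int[Q]_c \sum_(M < K) (\1_(F M) c)%:E)%E.
  rewrite ge0_integral_sum//; last first.
    by move=> M; apply/measurable_EFinP; exact: measurable_indic.
  rewrite -sumEFin; apply: eq_bigr => M _.
  by rewrite integral_indic// setIT -w_probE//; exact: finitely_determined_tail.
apply: ge0_le_integral => //.
- by move=> c _; apply: sume_ge0 => M _; rewrite lee_fin.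
- by apply: emeasurable_sum => M; apply/measurable_EFinP; exact: measurable_indic.
- exact: (cmeasurable_fun (fun v : int => (`|v|%N%:R)%:E) (cmeasurable_recentred t x)).
move=> c _; rewrite sumEFin lee_fin.
rewrite (eq_bigr (fun M : 'I_K => (M < `|recentred c t x|)%N%:R)); last first.
  by move=> M _; rewrite indicE; congr (_%:R); congr nat_of_bool; apply/idP/idP; rewrite inE.
rewrite -natr_sum ler_nat; move: `|_|%N => v.
elim: K => [|K IH]; first by rewrite big_ord0.
rewrite big_ord_recr /=; case: (ltnP K v) => Kv; last by rewrite addn0.
have : (\sum_(i < K) (i < v) <= K)%N.
  by rewrite -[leqRHS]card_ord -sum1_card; apply: leq_sum => i _; case: (_ < _)%N.
by move=> h; rewrite addn1; exact: leq_ltn_trans h Kv.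
Qed.

Lemma occupation_tail_sum x : exists C : R, forall n K,
  \sum_(M < K) occupation n [set g | (M < `|g x|)%N] <= C.
Proof.
have [C HC] := sum_mean_abs iQ x.
exists C => n K; rewrite -mulr_suml exchange_big /= ler_pdivrMr// mulrC -lee_fin.
apply: le_trans (HC n); rewrite -sumEFin; apply: lee_sum => j _.
exact: w_tail_sum.
Qed.

Lemma occupation_le n A B : finitely_determined A -> finitely_determined B ->
  A `<=` B -> occupation n A <= occupation n B.
Proof.
move=> fA fB AB; rewrite ler_wpM2r ?invr_ge0//; apply: ler_sum => j _.
rewrite -lee_fin -!w_probE//; apply: le_measure; rewrite ?inE//;
  exact: measurable_finitely_determined.
Qed.

(** Tails decrease with the level, so [K] times the tail at [K] is at most the sum of the first [K]
    tails, which is bounded uniformly in [n]. *)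
Lemma occupation_tight x (eps : R) : 0 < eps ->
  exists M : nat, forall n, occupation n [set g | (M < `|g x|)%N] <= eps.
Proof.
move=> e0; have [C HC] := occupation_tail_sum x.
pose K := (Num.truncn `|C / eps|).+1; exists K => n.
have h : K%:R * occupation n [set g | (K < `|g x|)%N] <= C.
  apply: le_trans (HC n K).
  rewrite mulr_natl -[X in _ *+ X]card_ord -sumr_const; apply: ler_sum => M _.
  apply: occupation_le; try exact: finitely_determined_tail.
  by move=> g /= Kg; apply: ltn_trans Kg.
have CK : C <= K%:R * eps.
  rewrite -ler_pdivrMr//; apply: le_trans (ler_norm _) _; rewrite ltW//; exact: truncnS_gt.
by rewrite -(ler_pM2l (ltr0Sn R (Num.truncn `|C / eps|))); exact: le_trans h CK.
Qed.

End occupation.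

(** * Approximation of the dynamics by finitely many update lists *)

Section feller.
Context {R : realType} {d : nat}.
Notation conf := (config R (site d * nat)%type).
Variable Q : probability conf R.
Hypothesis iQ : iid ex Q id.

Lemma exhaustion dT (T : measurableType dT) (P : probability T R) (F : nat -> set T) (eps : R) :
  0 < eps -> (forall n, measurable (F n)) -> {ae P, forall x, exists n, F n x} ->
  exists n, (P (~` \big[setU/set0]_(i < n) F i) <= eps%:E)%E.
Proof.
move=> e0 mF H.
pose G n := \big[setU/set0]_(i < n) F i.
have mG n : measurable (G n) by apply: bigsetU_measurable.
have mUG : measurable (\bigcup_n G n) by exact: bigcupT_measurable.
have ndG : nondecreasing_seq G by move=> m n mn; apply/subsetPset; exact: subset_bigsetU.
have cv := nondecreasing_cvg_mu (mu := P) mG mUG ndG.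
have PU : P (\bigcup_n G n) = 1%E.
  apply/(ae_prob1 P mUG); apply: filterS H => x [n Fx].
  by exists n.+1 => //; rewrite /G -bigcup_mkord; exists n => /=.
have {}cv : P (G n) @[n --> \oo] --> 1%E by rewrite -[1%E]PU; exact: cv.
have /cv : nbhs (1%E : \bar R) [set y | ((1 - eps)%:E < y)%E].
  apply: open_nbhs_nbhs; split; first exact: open_ereal_gt_ereal.
  by rewrite /= lte_fin; lra.
move=> [n _ /(_ n (leqnn n))] /= h; exists n.
rewrite -/(G n) probability_setC//.
move: h; rewrite -{1 2}(fineK (fin_num_measure P _ (mG n))) lte_fin -EFinB lee_fin; lra.
Qed.

(** There are countably many pairs [(D, l)], and their events almost surely cover all
    configurations. On each event the heights on [X] are a deterministic function of the initial
    field. *)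
Definition determined_by (X : seq (site d)) t (D : {fset site d}) (l : seq (site d)) : set conf :=
  [set c | [/\ finitely_influenced (clocks c) t, updates (clocks c) D t = l &
    forall D' : {fset site d}, (D `<=` D')%fset -> forall x, x \in X ->
      forall f, run f (updates (clocks c) D' t) x = run f l x]].

Lemma measurable_determined_by X t D l : measurable (determined_by X t D l).
Proof.
rewrite (_ : determined_by X t D l = [set c : conf | finitely_influenced (clocks c) t] `&`
  ([set c : conf | updates (clocks c) D t = l] `&`
   \bigcap_D' ([set _ | ~ (D `<=` D')%fset] `|` [set c : conf | (fun l' => forall x, x \in X ->
     forall f, run f l' x = run f l x) (updates (clocks c) D' t)]))).
  apply: measurableI; first exact: measurable_finitely_influenced.
  apply: measurableI; first exact: cmeasurable_updates.
  apply: countable_bigcap_measurable => D'; apply: measurableU; first exact: measurable_cst_set.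
  exact: (cmeasurable_preimage [set l' | forall x, x \in X ->
     forall f, run f l' x = run f l x] (cmeasurable_updates D' t)).
apply/seteqP; split => c.
  move=> [h1 h2 h3]; split => //; split => // D' _.
  by case: (boolP (D `<=` D')%fset) => DD'; [right => x xX f; exact: h3|left].
move=> [h1 [h2 h3]]; split => // D' DD' x xX f.
by have [//|/= h] := h3 D' I; exact: h.
Qed.

Lemma determined_height X t D l (c : conf) x f : determined_by X t D l c -> x \in X ->
  height (clocks c) f t x = run f l x.
Proof.
move=> [FI _ H] xX; have [D1 H1] := heightE x FI.
by rewrite (H1 (D `|` D1)%fset) ?fsubsetUr// H// fsubsetUl.
Qed.

Lemma determined_exists X t (c : conf) : finitely_influenced (clocks c) t ->
  exists D l, determined_by X t D l c.
Proof.
move=> FI.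
have [D H] : exists D : {fset site d}, forall D' : {fset site d}, (D `<=` D')%fset ->
    forall x, x \in X -> forall f, run f (updates (clocks c) D' t) x = run f (updates (clocks c) D t) x.
  elim: X => [|x X [D H]]; first by exists fset0.
  have [D1 H1] := FI x; exists (D `|` D1)%fset => D' DD' y.
  rewrite in_cons => /orP[/eqP->|yX] f.
    rewrite H1 ?[in RHS]H1 ?fsubsetUr//.
    by apply: fsubset_trans DD'; exact: fsubsetUr.
  rewrite H// ?[in RHS]H// ?fsubsetUl//.
  by apply: fsubset_trans DD'; exact: fsubsetUl.
by exists D, (updates (clocks c) D t).
Qed.

Lemma finitely_determined_support0 (A : set (site d -> int)) : finitely_determined A ->
  exists X : seq (site d), 0 \in X /\ forall f g, {in X, f =1 g} -> A f <-> A g.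
Proof.
move=> /finitely_determined_eqv[S H]; exists (0 :: S); split; first exact: mem_head.
by move=> f g fg; apply: H => x xS; apply: fg; rewrite in_cons xS orbT.
Qed.

(* Split the clocks according to the finite list of updates that determines the
   heights on the support of [A]; finitely many lists exhaust their law up to
   [eps]. *)
Lemma feller t (A : set (site d -> int)) (eps : R) : 0 <= t -> 0 < eps ->
  finitely_determined A -> exists (n : nat) (a : nat -> R) (B : nat -> set (site d -> int)),
    (forall i, finitely_determined (B i)) /\ forall pi : probability (field d) R,
    `|fine (prod_prob pi Q (w_step t @^-1` A)) - \sum_(i < n) a i * fine (pi (B i))| <= eps.
Proof.
move=> t0 e0 fA; have [X [X0 HX]] := finitely_determined_support0 fA.
pose G (i : nat) := if @choice.pickle_inv ({fset site d} * seq (site d))%type i is Some p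
  then determined_by X t p.1 p.2 else set0.
pose L (i : nat) := if @choice.pickle_inv ({fset site d} * seq (site d))%type i is Some p
  then p.2 else [::].
have mG i : measurable (G i).
  by rewrite /G; case: (@choice.pickle_inv _ _) => [p|//]; exact: measurable_determined_by.
have GL i c x f : G i c -> x \in X -> height (clocks c) f t x = run f (L i) x.
  by rewrite /G /L; case: (@choice.pickle_inv _ _) => [p|//]; exact: determined_height.
have Gae : {ae Q, forall c, exists i, G i c}.
  apply: filterS (ae_finitely_influenced iQ t0) => c /(determined_exists X)[D [l H]].
  by exists (choice.pickle (D, l)); rewrite /G choice.pickleK_inv.
have [n Hn] := exhaustion e0 mG Gae.
(* Events for different pairs may overlap; once made disjoint, their probabilities are the
   coefficients. *)
pose E := seqDU G.
have mE i : measurable (E i).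
  by apply: measurableD => //; exact: bigsetU_measurable.
have tE : trivIset setT E by exact: trivIset_seqDU.
have EG i : E i `<=` G i by exact: subDsetl.
(* On [E i], the event [A] after time [t] is the event [B i] for the initial field. *)
pose B i : set (site d -> int) := [set f | A (fun x => run f (L i) x - run f (L i) 0 + f 0)].
have fB i : finitely_determined (B i).
  exists (flatten [seq x :: flatten [seq lazy_nbrs z | z <- L i] | x <- X]) => f g fg.
  have E1 x : x \in X -> run f (L i) x = run g (L i) x.
    by move=> xX; apply: run_eq_on => y yx; apply: fg; apply/flatten_mapP; exists x.
  apply: (HX _ _ _).1 => x xX; rewrite !E1//; congr (_ + _); apply: fg.
  by apply/flatten_mapP; exists 0 => //; exact: mem_head.
exists n, (fun i => fine (Q (E i))), B; split => // pi.
have mA : measurable (A : set (field d)) by exact: measurable_finitely_determined.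
have mw : measurable (w_step t @^-1` A : set (field d * conf)).
  by rewrite -[_ @^-1` _]setTI; exact: (measurable_w_step t measurableT).
pose W := w_step t @^-1` A : set (field d * conf).
pose Z i : set (field d * conf) := B i `*` E i.
have mB i : measurable (B i : set (field d)) by exact: measurable_finitely_determined.
have mZ i : measurable (Z i) by exact: measurableX.
have ZE i : Z i = W `&` (setT `*` E i).
  apply/seteqP; split => -[f c] /=.
    move=> [Bf Ec]; split => //; apply: (HX _ _ _).1 Bf => x xX.
    by rewrite /w_step /= !(GL i c _ f (EG i c Ec)).
  move=> [Wf [_ Ec]]; split => //; apply: (HX _ _ _).1 Wf => x xX.
  by rewrite /w_step /= !(GL i c _ f (EG i c Ec)).
(* The whole error comes from clocks to which none of the first [n] lists applies. Its bound
   involves the clocks alone and is thus uniform in [pi]. *)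
pose rest : set (field d * conf) := W `&` (setT `*` ~` \big[setU/set0]_(i < n) G i).
have mrest : measurable rest.
  apply: measurableI => //; apply: measurableX => //; apply: measurableC.
  exact: bigsetU_measurable.
have WE : W = \big[setU/set0]_(i < n) Z i `|` rest.
  apply/seteqP; split => z.
    move=> Wz; case: (pselect ((\big[setU/set0]_(i < n) G i) z.2)) => h; [left|by right].
    move: h; rewrite (bigsetU_seqDU G) -!bigcup_mkord => -[i ilt Ez].
    by exists i => //; rewrite ZE.
  rewrite -bigcup_mkord => -[[i _]|[]//]; by rewrite ZE => -[].
have disj : (\big[setU/set0]_(i < n) Z i) `&` rest = set0.
  rewrite -subset0 -bigcup_mkord => z [[i ilt]]; rewrite ZE => -[_ [_ Ez]] [_ [_ nG]].
  by apply: nG; rewrite -bigcup_mkord; exists i => //; exact: EG.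
have tZ : trivIset setT Z.
  move=> i j _ _ [z []]; rewrite !ZE => -[_ [_ Ei]] [_ [_ Ej]].
  by apply: tE => //; exists z.2.
have -> : prod_prob pi Q W = (\sum_(i < n) prod_prob pi Q (Z i) + prod_prob pi Q rest)%E.
  rewrite {1}WE measureU//; last by apply: bigsetU_measurable.
  congr (_ + _)%E; exact: (measure_bigsetU (prod_prob pi Q) mZ tZ).
have rest_le : (prod_prob pi Q rest <= eps%:E)%E.
  apply: le_trans (_ : prod_prob pi Q (setT `*` ~` \big[setU/set0]_(i < n) G i) <= _)%E.
    apply: le_measure; rewrite ?inE//; last exact: subIsetr.
    by apply: measurableX => //; apply: measurableC; exact: bigsetU_measurable.
  rewrite prod_probX//; last by apply: measurableC; exact: bigsetU_measurable.
  by rewrite probability_setT mul1e.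
have -> : (\sum_(i < n) prod_prob pi Q (Z i) =
    (\sum_(i < n) fine (Q (E i)) * fine (pi (B i)))%:E)%E.
  rewrite -sumEFin; apply: eq_bigr => i _; rewrite prod_probX// muleC EFinM.
  by rewrite !fineK// fin_num_measure.
have rf : prod_prob pi Q rest \is a fin_num by rewrite fin_num_measure.
rewrite fineD// /= addrAC subrr add0r ger0_norm ?fine_ge0//.
by rewrite -lee_fin fineK.
Qed.

End feller.

Lemma prod_prob_image {R : realType} d1 d2 d1' d2' (T1 : measurableType d1)
    (T2 : measurableType d2) (T1' : measurableType d1') (T2' : measurableType d2')
    (P1 : probability T1 R) (P2 : probability T2 R)
    (P1' : probability T1' R) (P2' : probability T2' R) (f : T1 -> T1') (g : T2 -> T2') A :
  has_law P1 f P1' -> has_law P2 g P2' -> measurable A ->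
  prod_prob P1' P2' A = prod_prob P1 P2 [set z | A (f z.1, g z.2)].
Proof.
move=> [mf fP] [mg gP].
have mh : measurable_fun setT (fun z : T1 * T2 => (f z.1, g z.2)).
  by apply: measurable_fun_pair; [exact: (measurableT_comp mf measurable_fst)|
    exact: (measurableT_comp mg measurable_snd)].
move=> mA; apply/esym; apply: (prod_prob_unique (P' := law (prod_prob P1 P2) mh)) => //.
move=> B C mB mC; transitivity (prod_prob P1 P2 ((f @^-1` B) `*` (g @^-1` C))); first by [].
rewrite prod_probX ?fP ?gP//; [rewrite -[_ @^-1` _]setTI; exact: mf|
  rewrite -[_ @^-1` _]setTI; exact: mg].
Qed.

Lemma prob_dist_le {R : realType} d (T : measurableType d) (P : probability T R)
    (V W B : set T) : measurable V -> measurable W -> measurable B ->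
  {ae P, forall z, ~ B z -> (V z <-> W z)} ->
  `|fine (P V) - fine (P W)| <= fine (P B).
Proof.
move=> mV mW mB H.
have E C : measurable C -> fine (P C) = fine (P (C `\` B)) + fine (P (C `&` B)).
  move=> mC; rewrite (measureDI P mC mB) fineD// fin_num_measure//.
    exact: measurableD.
  exact: measurableI.
have VW : P (V `\` B) = P (W `\` B).
  apply: ae_eq_prob; [exact: measurableD|exact: measurableD|].
  by apply: filterS H => z h; split=> -[Vz nB]; split => //; apply/(h nB).
have le C : measurable C -> 0 <= fine (P (C `&` B)) <= fine (P B).
  move=> mC; rewrite fine_ge0//= -lee_fin !fineK ?fin_num_measure//; last exact: measurableI.
  by apply: le_measure; rewrite ?inE//; exact: measurableI.
rewrite (E V)// (E W)// VW opprD addrACA subrr add0r.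
by move: (le V mV) (le W mW) => /andP[a b] /andP[a' b']; rewrite ler_distl; lra.
Qed.

Section invariance.
Context {R : realType} {d : nat}.
Notation conf := (config R (site d * nat)%type).
Variable Q : probability conf R.
Hypothesis iQ : iid ex Q id.
Notation tau := (@short_time R d).
Notation step := (@time_step R d).

Lemma measurable_w_step_pre t (A : set (field d)) : measurable A ->
  measurable (w_step t @^-1` A : set (field d * conf)).
Proof. by move=> mA; rewrite -[_ @^-1` _]setTI; exact: (measurable_w_step t measurableT). Qed.

Lemma w_law_add s t (A : set (field d)) : 0 <= s -> 0 <= t -> measurable A ->
  w_law Q (s + t) A = prod_prob (w_law Q s) Q (w_step t @^-1` A).
Proof.
move=> s0 t0 mA.
have mW := measurable_w_step_pre t mA.
have mr u : measurable [set c : conf | A (recentred c u)].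
  by have := measurable_recentred u measurableT mA; rewrite setTI.
have mg : measurable [set z : conf * conf | A (recentred (glue_config s z) (s + t))].
  by have := @measurable_glue_config R _ s measurableT _ (mr (s + t)); rewrite setTI.
have mp : measurable [set z : conf * conf | (w_step t @^-1` A) (recentred z.1 s, z.2)].
  have mf : measurable_fun setT (fun z : conf * conf => (recentred z.1 s : field d, z.2)).
    apply: measurable_fun_pair; last exact: measurable_snd.
    exact: (measurableT_comp (measurable_recentred s) measurable_fst).
  by have := mf measurableT _ mW; rewrite setTI.
transitivity (Q [set c | A (recentred c (s + t))]); first by [].
rewrite (law_glue iQ s0 (mr _)).
transitivity (prod_prob Q Q [set z | (w_step t @^-1` A) (recentred z.1 s, z.2)]).
  apply: ae_eq_prob => //; apply: filterS (w_map_glue iQ s0 t0) => z /(_ (@flat d)) H.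
  by rewrite /= -[recentred z.1 s]/(w_map s (@flat d, z.1)) -H.
apply/esym/(@prod_prob_image _ _ _ _ _ _ _ _ _ Q Q (w_law Q s) Q (recentred^~ s) id) => //.
by split; first exact: measurable_recentred.
Qed.

(** If no clock on the support of [A] rings before [r], the heights there do not move, and each
    clock rings with probability at most [r]. The origin is included because [w_step] reads the
    height there. *)
Lemma w_step_silent (pi : probability (field d) R) r (A : set (field d)) (X : seq (site d)) :
  0 <= r -> measurable A -> 0 \in X -> (forall f g, {in X, f =1 g} -> A f <-> A g) ->
  `|fine (prod_prob pi Q (w_step r @^-1` A)) - fine (pi A)| <= (size X)%:R * r.
Proof.
move=> r0 mA X0 HX.
have mW := measurable_w_step_pre r mA.
pose F x := [set c : conf | c (x, 0%N) < r].
have mF x : measurable (F x).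
  by have := measurable_coord (R := R) (x, 0%N) measurableT (measurable_itv `]-oo, r[); rewrite setTI.
have [mB leB] := @bigcup_seq_le R _ conf Q _ X F mF.
set B := [set c | _] in mB leB.
have -> : fine (pi A) = fine (prod_prob pi Q (A `*` setT)).
  by rewrite prod_probX// probability_setT mule1.
apply: (@le_trans _ _ (fine (prod_prob pi Q (setT `*` B)))).
  apply: prob_dist_le => //; [exact: measurableX|exact: measurableX|].
  have H : {ae Q, forall c, regular (clocks c) /\ finitely_influenced (clocks c) r}.
    by apply: filterS2 (ae_regular iQ) (ae_finitely_influenced iQ r0) => c.
  apply: filterS (ae_snd pi H) => -[f c] /= [rc FI] nB.
  have E x : x \in X -> w_step r (f, c) x = f x.
    have hs y : y \in X -> height (clocks c) f r y = f y.
      move=> yX; apply: height_silent => //; rewrite leNgt; apply/negP => cr.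
      by apply: nB; split => //; exists y.
    by move=> xX; rewrite /w_step /= !hs// subrK.
  by split=> [Wz|[Az _]]; [split => //; apply/(HX _ _ E)|apply/(HX _ _ E)].
rewrite prod_probX// probability_setT mul1e -lee_fin fineK ?fin_num_measure//.
apply: le_trans leB _.
have QF x : Q (F x) = (1 - expR (- r))%:E.
  rewrite -ex_lt//; exact: (iid_coord1 (x, 0%N) iQ (measurable_itv `]-oo, r[)).
under eq_bigr do rewrite QF.
rewrite sumEFin lee_fin big_const_seq count_predT iter_addr_0 mulr_natl.
by rewrite lerMn2r; apply/orP; right; have /andP[] := ring_prob_le r0.
Qed.

End invariance.

(** Each shift by one telescopes to a difference of two values of [p], at most 1 in absolute
    value. *)
Lemma sum_shift_dist {R : realType} (p : nat -> R) (N k : nat) :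
  (forall j, 0 <= p j <= 1) ->
  `|\sum_(j < N) p (j + k)%N - \sum_(j < N) p j| <= k%:R.
Proof.
move=> p01; elim: k => [|k IH].
  by under eq_bigr do rewrite addn0; rewrite subrr normr0.
apply: le_trans (ler_distD (\sum_(j < N) p (j + k)%N) _ _) _.
rewrite [leRHS]mulrS; apply: lerD => //.
rewrite -sumrB (eq_bigr (fun j : 'I_N => p (j.+1 + k)%N - p (j + k)%N)); last first.
  by move=> j _; rewrite addnS.
rewrite -(big_mkord xpredT (fun j => p (j.+1 + k)%N - p (j + k)%N)).
rewrite (telescope_sumr (fun j => p (j + k)%N))//.
by have := p01 (N + k)%N; have := p01 (0 + k)%N; rewrite ler_distl => /andP[? ?] /andP[? ?]; lra.
Qed.

Section invariant.
Context {R : realType} {d : nat}.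
Notation conf := (config R (site d * nat)%type).
Variable Q : probability conf R.
Hypothesis iQ : iid ex Q id.
Notation tau := (@short_time R d).
Notation step := (@time_step R d).

(** Since [t] need not be a multiple of the mesh, it is split into [k] steps and a remainder [r].
    The [k] steps shift the sum by at most [t / step n], to be divided by [(n+1)^2]; the remainder
    changes each law by at most [size X] times the mesh. Both errors are of order [1/(n+1)]. *)
Lemma occupation_shift t A : 0 <= t -> finitely_determined A -> exists C : R, forall n : nat,
  `|(\sum_(j < n.+1 * n.+1) w_prob Q (step n *+ j + t) A) / (n.+1 * n.+1)%:R -
    occupation Q n A| <= C / n.+1%:R.
Proof.
move=> t0 fA; have [X [X0 HX]] := finitely_determined_support0 fA.
have mA : measurable (A : set (field d)) by exact: measurable_finitely_determined.
have tau0 := @short_time_gt0 R d.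
exists ((size X)%:R * tau + t / tau) => n.
have s0 := @time_step_gt0 R d n.
pose k := Num.truncn (t / step n); pose r := t - step n *+ k.
have ts0 : 0 <= t / step n by rewrite divr_ge0// ltW.
have r0 : 0 <= r.
  by rewrite subr_ge0 -mulr_natl -ler_pdivlMr// truncn_le.
have rs : r <= step n.
  rewrite lerBlDr -mulrS -mulr_natl -ler_pdivrMr// ltW//; exact: truncnS_gt.
have n0 : 0 < n.+1%:R :> R by rewrite ltr0n.
have N0 : 0 < (n.+1 * n.+1)%:R :> R by rewrite ltr0n.
rewrite /occupation -mulrBl normrM (gtr0_norm (x := _^-1)) ?invr_gt0// ler_pdivrMr//.
apply: le_trans (ler_distD (\sum_(j < n.+1 * n.+1) w_prob Q (step n *+ (j + k)) A) _ _) _.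
have h1 : `|\sum_(j < n.+1 * n.+1) w_prob Q (step n *+ j + t) A -
    \sum_(j < n.+1 * n.+1) w_prob Q (step n *+ (j + k)) A| <=
    (n.+1 * n.+1)%:R * ((size X)%:R * step n).
  rewrite -sumrB; apply: le_trans (ler_norm_sum _ _ _) _.
  rewrite mulr_natl -[X in _ *+ X]card_ord -sumr_const; apply: ler_sum => j _.
  have -> : step n *+ j + t = step n *+ (j + k) + r.
    by rewrite mulrnDr /r addrA [RHS]addrAC addrK.
  have jk0 : 0 <= step n *+ (j + k) by rewrite mulrn_wge0// ltW.
  rewrite /w_prob (w_law_add iQ jk0 r0 mA).
  apply: le_trans (w_step_silent iQ _ r0 mA X0 HX) _.
  by rewrite ler_wpM2l.
have h2 : `|\sum_(j < n.+1 * n.+1) w_prob Q (step n *+ (j + k)) A -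
    \sum_(j < n.+1 * n.+1) w_prob Q (step n *+ j) A| <= t / step n.
  apply: le_trans (sum_shift_dist (p := fun j => w_prob Q (step n *+ j) A) _ _ _) _.
    by move=> j; rewrite w_prob_ge0 w_prob_le1.
  by rewrite truncn_le.
apply: le_trans (lerD h1 h2) _.
rewrite le_eqVlt; apply/orP; left; apply/eqP.
rewrite /time_step natrM.
by field; rewrite ?gt_eqF.
Qed.

Lemma cvg_near_le (U : set_system nat) (u : nat -> R) (l e : R) : ProperFilter U ->
  u n @[n --> U] --> l -> (\forall n \near U, `|u n| <= e) -> `|l| <= e.
Proof.
move=> PU ul ue; have nl : `|u n| @[n --> U] --> `|l| by exact: cvg_norm.
rewrite -(cvg_lim _ nl)//; apply: limr_le => //; exact: cvgP nl.
Qed.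

Lemma cvg_sum_ord (U : set_system nat) (n : nat) (u : nat -> nat -> R) (l : nat -> R) :
  ProperFilter U -> (forall i, u i m @[m --> U] --> l i) ->
  \sum_(i < n) u i m @[m --> U] --> \sum_(i < n) l i.
Proof.
move=> PU ul; elim: n => [|n IH].
  by rewrite big_ord0; under eq_fun do rewrite big_ord0; exact: cvg_cst.
rewrite big_ord_recr /=; under eq_fun do rewrite big_ord_recr /=.
exact: cvgD.
Qed.

Variable U : set_system nat.
Hypothesis UU : UltraFilter U.
Hypothesis U_oo : \oo `<=` U.
Variable mu : probability (field d) R.
Hypothesis muE : forall A, finitely_determined A -> mu A = (ultralimit U (occupation Q) A)%:E.

Lemma cvg_occupation A : finitely_determined A ->
  occupation Q n A @[n --> U] --> fine (mu A).
Proof.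
move=> fA; rewrite muE//=.
apply: cvg_ultralimit => //.
- by move=> n B; exact: occupation_ge0.
- by move=> n; exact: occupationT.
- by move=> n B C fB fC; exact: occupationU.
Qed.

(** As a function of the initial field, the probability of [A] after time [t] may depend on
    infinitely many sites, so it does not pass to the ultralimit directly. [feller] replaces it,
    uniformly over initial laws, by a finite combination of finitely determined events; this is
    applied both to [mu] and to the laws entering the averages. *)
Lemma ultralimit_invariant t (A : set (field d)) : 0 <= t -> measurable A ->
  prod_prob mu Q (w_step t @^-1` A) = mu A.
Proof.
move=> t0; apply: (field_prob_eq (P := law (prod_prob mu Q) (measurable_w_step t))) => {}A fA.
change (prod_prob mu Q (w_step t @^-1` A) = mu A).
have mA : measurable (A : set (field d)) by exact: measurable_finitely_determined.
rewrite -[LHS]fineK ?fin_num_measure//; last exact: measurable_w_step_pre.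
rewrite -[RHS]fineK ?fin_num_measure//; congr (_%:E).
apply/eqP; rewrite -subr_eq0 -normr_le0; apply/ler_addgt0Pl => e e0; rewrite addr0.
have e3 : 0 < e / 3 by lra.
have [m [a [B [fB H]]]] := feller iQ t0 e3 fA.
have [C HC] := occupation_shift t0 fA.
have h1 := H mu.
(* The first error is that of the approximation at each grid point, the second is the cost of
   shifting the average by [t]. *)
have h2 n : `|occupation Q n A - \sum_(i < m) a i * occupation Q n (B i)| <= e / 3 + C / n.+1%:R.
  have N0 : 0 < (n.+1 * n.+1)%:R :> R by rewrite ltr0n.
  set S := (\sum_(j < n.+1 * n.+1) w_prob Q (step n *+ j + t) A) / (n.+1 * n.+1)%:R.
  apply: le_trans (ler_distD S _ _) _; rewrite addrC; apply: lerD; last first.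
    by rewrite distrC; exact: HC.
  have -> : \sum_(i < m) a i * occupation Q n (B i) = (\sum_(j < n.+1 * n.+1)
      \sum_(i < m) a i * w_prob Q (step n *+ j) (B i)) / (n.+1 * n.+1)%:R.
    rewrite exchange_big /= mulr_suml; apply: eq_bigr => i _.
    by rewrite /occupation mulrA mulr_sumr.
  rewrite /S -mulrBl normrM (gtr0_norm (x := _^-1)) ?invr_gt0// ler_pdivrMr//.
  rewrite -sumrB; apply: le_trans (ler_norm_sum _ _ _) _.
  rewrite mulrC mulr_natl -[X in _ *+ X]card_ord -sumr_const; apply: ler_sum => j _.
  have j0 : 0 <= step n *+ j by rewrite mulrn_wge0// ltW// time_step_gt0.
  by rewrite {1}/w_prob (w_law_add iQ j0 t0 mA); exact: H.
have h3 : `|fine (mu A) - \sum_(i < m) a i * fine (mu (B i))| <= e / 3 + e / 3.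
  apply: (@cvg_near_le U (fun n => occupation Q n A - \sum_(i < m) a i * occupation Q n (B i))).
    apply: cvgB; first exact: cvg_occupation.
    apply: (@cvg_sum_ord U m (fun i n => a i * occupation Q n (B i)) (fun i => a i * fine (mu (B i)))).
    by move=> i; apply: cvgMr; exact: cvg_occupation.
  (* From this index on, the cost of the shift is also at most [e / 3]. *)
  apply: U_oo; exists (Num.truncn `|C / (e / 3)|).+1 => // n /= nC.
  apply: le_trans (h2 n) _; rewrite lerD2l ler_pdivrMr// mulrC -ler_pdivrMr//.
  apply: le_trans (ler_norm _) _; apply: le_trans (ltW (truncnS_gt _)) _.
  by rewrite ler_nat; exact: leq_trans nC (leqnSn n).
move: h1 h3; set p := fine (prod_prob _ _ _); set q := fine (mu A).
by rewrite !ler_norml => /andP[? ?] /andP[? ?]; apply/andP; split; lra.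
Qed.

End invariant.

Lemma finite_expectation_tail {R : realType} dE (E : measurableType dE)
    (P : probability E R) (X : E -> int) (C : R) : cmeasurable X ->
  (forall K, \sum_(M < K) fine (P [set g | (M < `|X g|)%N]) <= C) ->
  finite_expectation P X.
Proof.
move=> mX H; pose F (M : nat) := [set g | (M < `|X g|)%N].
have mF M : measurable (F M).
  exact: (cmeasurable_preimage [set v : int | (M < `|v|)%N] mX).
apply: (@le_lt_trans _ _ C%:E); last exact: ltry.
have mI M : measurable_fun setT (fun g => (\1_(F M) g : R)%:E).
  by apply/measurable_EFinP; exact: measurable_indic.
apply: (@le_trans _ _ (\int[P]_g (\sum_(0 <= M <oo) (\1_(F M) g : R)%:E))%E).
  apply: ge0_le_integral => //.
  - exact: (cmeasurable_fun (fun v : int => `|v%:~R : R|%:E) mX).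
  - by apply: ge0_emeasurable_sum => // M _; exact: mI.
  move=> g _; apply: le_trans (nneseries_lim_ge `|X g|%N _) => //.
  rewrite (eq_big_nat _ _ (F2 := fun=> 1%E)); last first.
    move=> M /andP[_ MX]; rewrite indicE mem_set//.
  by rewrite sumEFin big_const_nat subn0 iter_addr_0 lee_fin -intr_norm -abszE -pmulrn.
rewrite integral_nneseries//.
apply: lime_le; first by apply: is_cvg_nneseries => M _ _; exact: integral_ge0.
apply: nearW => K; apply: le_trans (_ : _ <= (\sum_(M < K) fine (P (F M)))%:E)%E _; last first.
  by rewrite lee_fin; exact: H.
rewrite big_mkord -sumEFin; apply: lee_sum => M _.
by rewrite integral_indic// setIT fineK// fin_num_measure.
Qed.

(** * Stationarity and symmetries *)

Section stationary_recentred.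
Context {R : realType} {d : nat} {dT : measure_display} {T : measurableType dT}.
Variables (P : probability T R) (gap : site d -> nat -> T -> R).
Hypothesis hgap : poisson_clocks P gap.
Notation conf := (config R (site d * nat)%type).

Definition clock_law : probability conf R := law P (iid_gap hgap).1.

Lemma iid_clock_law : iid ex clock_law id.
Proof. exact: (iid_law_gap (iid_gap hgap)). Qed.

Let iQ := iid_clock_law.

Lemma w_map_recentre t : 0 <= t -> {ae clock_law, forall c, forall f : field d,
  w_map t (f, c) = w_step t (recentre f, c)}.
Proof.
move=> t0; apply: filterS (ae_finitely_influenced iQ t0) => c FI f.
apply/funext => x; rewrite /w_map /w_step /recentre /=.
rewrite (height_shift f (- f 0) FI); ring.
Qed.

Lemma measurable_w_process t : measurable_fun setT (w_process (R := R) gap t).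
Proof.
change (measurable_fun setT
  (w_map t \o (fun p : field d * T => (p.1, gap_config gap p.2) : field d * conf))).
apply: (measurableT_comp (measurable_w_map t)).
apply: measurable_fun_pair => //.
exact: (measurableT_comp (iid_gap hgap).1 measurable_snd).
Qed.

(** The initial law enters only through its recentred image, which is the law of the process at time
    0. *)
Lemma w_process_law (rho : probability (field d) R) t (A : set (field d)) :
  0 <= t -> measurable A ->
  (rho \x P)%E (w_process gap t @^-1` A) =
  prod_prob (law rho (@measurable_recentre d)) clock_law (w_step t @^-1` A).
Proof.
move=> t0 mA; have mW := measurable_w_step_pre (R := R) t mA.
have mw : measurable (w_map t @^-1` A : set (field d * conf)).
  by rewrite -[_ @^-1` _]setTI; exact: (measurable_w_map t measurableT).
transitivity (prod_prob rho clock_law (w_map t @^-1` A)).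
  by apply/esym; apply: (@prod_prob_image _ _ _ _ _ _ _ _ _ rho P rho clock_law id (gap_config gap)) => //;
    split => //; exact: (iid_gap hgap).1.
transitivity (prod_prob rho clock_law [set z | (w_step t @^-1` A) (recentre z.1, z.2)]).
  apply: ae_eq_prob => //.
    have mf : measurable_fun setT (fun z : field d * conf => (recentre z.1 : field d, z.2)).
      apply: measurable_fun_pair; last exact: measurable_snd.
      exact: (measurableT_comp (@measurable_recentre d) measurable_fst).
    by have := mf measurableT _ mW; rewrite setTI.
  by apply: filterS (ae_snd rho (w_map_recentre t0)) => -[f c] /= ->.
apply/esym; apply: (@prod_prob_image _ _ _ _ _ _ _ _ _ rho clock_law _ clock_law (@recentre d) id) => //.
by split; first exact: measurable_recentre.
Qed.

(** If the recentred image of [rho] is [mu], invariance under [w_step] gives the law at all later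
    times. Such a [rho] exists: [mu] itself, since recentring fixes almost all of its fields. *)
Lemma stationary_invariant (mu : probability (field d) R) :
  mu [set g | g 0 = 0] = 1%E ->
  (forall t (A : set (field d)), 0 <= t -> measurable A ->
    prod_prob mu clock_law (w_step t @^-1` A) = mu A) ->
  stationary P (w_process gap) mu.
Proof.
move=> mu0 inv.
have mz : measurable [set g : field d | g 0 = 0] by exact: cmeasurable_field_coord.
have mr (A : set (field d)) : measurable A -> measurable (@recentre d @^-1` A).
  by move=> mA; rewrite -[_ @^-1` _]setTI; exact: measurable_recentre.
have w0 (rho : probability (field d) R) (A : set (field d)) : measurable A ->
    (rho \x P)%E (w_process gap 0 @^-1` A) = rho (@recentre d @^-1` A).
  move=> mA; transitivity (prod_prob rho P ((@recentre d @^-1` A) `*` setT)).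
    congr (prod_prob rho P _); apply/seteqP; split => -[f w];
      rewrite /= /w_process /recentred_height /= height_nonpos//; by [|case].
  by rewrite prod_probX ?probability_setT ?mule1//; exact: mr.
split.
  exists mu; split; first exact: measurable_w_process.
  move=> A mA; rewrite w0//; apply: ae_eq_prob => //; first exact: mr.
  apply: filterS ((ae_prob1 mu mz).2 mu0) => g /= g0.
  suff -> : recentre g = g by [].
  by apply/funext => x; rewrite /recentre g0 subr0.
move=> rho [_ H] t t0; split; first exact: measurable_w_process.
move=> A mA; rewrite w_process_law// -[RHS](inv t A t0 mA).
apply: (@prod_prob_image _ _ _ _ _ _ _ _ _ mu clock_law _ clock_law id id) => //; last first.
  exact: measurable_w_step_pre.
by split => // B mB /=; rewrite -H// w0.
Qed.

End stationary_recentred.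

(** * Graph automorphisms and the symmetries of the law *)

Section automorphisms.
Context {d : nat}.

Lemma graph_automorphism_cancel (phi psi : site d -> site d) :
  cancel phi psi -> cancel psi phi ->
  (forall x y, y \in nbrs x -> phi y \in nbrs (phi x)) ->
  (forall x y, y \in nbrs x -> psi y \in nbrs (psi x)) -> graph_automorphism phi.
Proof.
move=> phiK psiK Hphi Hpsi; split; first by exists psi.
move=> x z; apply/idP/idP => [/mapP[y /Hphi h ->]//|/Hpsi]; rewrite phiK => h.
by rewrite -[z]psiK map_f.
Qed.

Lemma translation_automorphism (y : site d) : graph_automorphism (fun x => x + y).
Proof.
have H (u : site d) x z : z \in nbrs x -> z + u \in nbrs (x + u).
  by move=> /nbrsP[i [->|->]]; rewrite addrAC ?nbrsD ?nbrsB.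
apply: (@graph_automorphism_cancel _ (fun x => x - y)).
- by move=> x; rewrite addrK.
- by move=> x; rewrite subrK.
- exact: H.
- exact: H.
Qed.

Lemma lattice_symmetry_nbrs s eps (x y : site d) : y \in nbrs x ->
  lattice_symmetry s eps y \in nbrs (lattice_symmetry s eps x).
Proof.
(* Coordinate [k] of the image reads coordinate [s k], so the unit vector of [i] goes to that of
   [s^-1 i], with the sign attached to the latter index. *)
have E i (b : bool) : lattice_symmetry s eps (x + (-1) ^+ b *: unit_vec i) =
    lattice_symmetry s eps x +
      (-1) ^+ (eps (s^-1%g i) (+) b) *: unit_vec (s^-1%g i).
  apply/rowP => k; rewrite !mxE mulrDr; congr (_ + _).
  rewrite !eqxx /=; case: (eqVneq k (s^-1%g i)) => [->|ki].
    by rewrite permKV eqxx !mulr1 signr_addb.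
  suff /negPf -> : s k != i by rewrite !mulr0.
  by apply: contra ki => /eqP <-; rewrite permK.
have H i (b : bool) : lattice_symmetry s eps (x + (-1) ^+ b *: unit_vec i) \in
    nbrs (lattice_symmetry s eps x).
  by rewrite E; case: addb; rewrite ?expr0 ?expr1 ?scale1r ?scaleN1r ?nbrsD ?nbrsB.
move=> /nbrsP[i [->|->]]; first by have := H i false; rewrite expr0 scale1r.
by have := H i true; rewrite expr1 scaleN1r.
Qed.

Lemma lattice_symmetry_automorphism s eps :
  graph_automorphism (@lattice_symmetry d s eps).
Proof.
(* The inverse applies the signs after permuting back, so they have to be permuted as well. *)
apply: (@graph_automorphism_cancel _ (lattice_symmetry s^-1%g (fun j => eps (s^-1%g j)))).
- by move=> x; apply/rowP => k; rewrite !mxE signrMK permKV.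
- by move=> x; apply/rowP => k; rewrite !mxE permK signrMK.
- exact: lattice_symmetry_nbrs.
- exact: lattice_symmetry_nbrs.
Qed.

(** Recentring is needed because [phi] may move the origin, as translations do. *)
Definition transport (phi : site d -> site d) (g : field d) : field d :=
  recentre (g \o phi).

Lemma measurable_precomp (phi : site d -> site d) :
  measurable_fun setT (fun g : field d => (g \o phi) : field d).
Proof. by apply: measurable_field => x; exact: cmeasurable_field_coord. Qed.

Lemma measurable_transport phi : measurable_fun setT (transport phi).
Proof. exact: (measurableT_comp (@measurable_recentre d) (measurable_precomp phi)). Qed.

Lemma finitely_determined_transport phi (A : set (site d -> int)) : finitely_determined A ->
  finitely_determined (transport phi @^-1` A).
Proof.
move=> [S H]; exists (phi 0 :: [seq phi x | x <- S]) => f g fg; apply: H => x xS.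
rewrite /transport /recentre /= !fg ?mem_head// in_cons.
by apply/orP; right; exact: map_f.
Qed.

End automorphisms.

Section symmetric_law.
Context {R : realType} {d : nat}.
Notation conf := (config R (site d * nat)%type).
Variable Q : probability conf R.
Hypothesis iQ : iid ex Q id.
Variable phi : site d -> site d.
Hypothesis aphi : graph_automorphism phi.

Let relabel (c : conf) : conf := fun p => c (phi p.1, p.2).

Let iid_relabel : iid ex Q relabel.
Proof.
apply: (@iid_reindex _ _ _ _ _ _ Q id (fun p => (phi p.1, p.2)) _ iQ).
by move=> [x m] [y n] /= [/(bij_inj aphi.1) -> ->].
Qed.

Let relabel_law (A : set conf) : measurable A -> Q (relabel @^-1` A) = Q A.
Proof. by move=> mA; exact: (iid_unique iid_relabel iQ mA). Qed.

Let measurable_relabel (A : set conf) : measurable A -> measurable (relabel @^-1` A).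
Proof. by move=> mA; have := iid_relabel.1 measurableT _ mA; rewrite setTI. Qed.

Let ae_relabel (A : set conf) : measurable A -> {ae Q, forall c, A c} ->
  {ae Q, forall c, A (relabel c)}.
Proof.
move=> mA /(ae_prob1 Q mA) QA; apply/(ae_prob1 Q (measurable_relabel mA)).
by rewrite -QA; exact: relabel_law.
Qed.

(** The flat field is fixed by [phi], so moving the heights amounts to relabelling the clocks, which
    preserves their law. *)
Lemma transport_recentred t : 0 <= t -> {ae Q, forall c,
  transport phi (recentred c t) = recentred (relabel c) t}.
Proof.
move=> t0; near=> c.
have r1 : regular (clocks c) by near: c; exact: ae_regular.
have r2 : regular (clocks (relabel c)).
  by near: c; apply: (@ae_relabel [set c | regular (clocks c)]);
    [exact: measurable_regular|exact: ae_regular].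
have f1 : finitely_influenced (clocks c) t by near: c; exact: ae_finitely_influenced.
have f2 : finitely_influenced (clocks (relabel c)) t.
  near: c; apply: (@ae_relabel [set c | finitely_influenced (clocks c) t]).
    exact: measurable_finitely_influenced.
  exact: ae_finitely_influenced.
have := @height_relabel _ _ phi (clocks c) (@flat d) t aphi r1 r2 f1 f2.
rewrite -[height (fun x => clocks c (phi x)) _ t]/(flat_height (relabel c) t) => E.
apply/funext => x; rewrite /transport /recentred /recentre E /= /flat_height; lia.
Unshelve. all: by end_near. Qed.

Lemma w_prob_transport t A : 0 <= t -> finitely_determined A ->
  w_prob Q t (transport phi @^-1` A) = w_prob Q t A.
Proof.
move=> t0 fA; rewrite /w_prob; congr fine.
have mA : measurable (A : set (field d)) by exact: measurable_finitely_determined.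
have mr : measurable [set c : conf | A (recentred c t)].
  by have := measurable_recentred t measurableT mA; rewrite setTI.
transitivity (Q (relabel @^-1` [set c | A (recentred c t)])); last exact: relabel_law.
transitivity (Q [set c | A (transport phi (recentred c t))]); first by [].
apply: ae_eq_prob.
- have mt := measurable_finitely_determined (finitely_determined_transport phi fA).
  by have := measurable_recentred t measurableT mt; rewrite setTI.
- exact: measurable_relabel.
by apply: filterS (transport_recentred t0) => c /= ->.
Qed.

Lemma occupation_transport n A : finitely_determined A ->
  occupation Q n (transport phi @^-1` A) = occupation Q n A.
Proof.
move=> fA; congr (_ / _); apply: eq_bigr => j _; apply: w_prob_transport => //.
by rewrite mulrn_wge0// ltW// time_step_gt0.
Qed.

End symmetric_law.

Lemma exists_invariant {R : realType} {d : nat}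
    (Q : probability (config R (site d * nat)%type) R) : iid ex Q id ->
  exists mu : probability (field d) R, [/\ mu [set g | g 0 = 0] = 1%E,
    forall t (A : set (field d)), 0 <= t -> measurable A ->
      prod_prob mu Q (w_step t @^-1` A) = mu A,
    forall x, finite_expectation mu (fun g => g x) &
    forall phi, graph_automorphism phi -> forall A : set (field d), measurable A ->
      mu (transport phi @^-1` A) = mu A].
Proof.
move=> iQ; have [U [UU U_oo]] := ultraFilterLemma eventually_filter.
have [mu muE] := ultralimit_measure U_oo (occupation_ge0 Q) (occupationT Q)
  (occupationU Q) (occupation_tight iQ).
have PU : ProperFilter U by exact: ultra_proper.
have cvg_occ := cvg_occupation UU muE.
have fz : finitely_determined [set g : site d -> int | g 0 = 0].
  exact: (finitely_determined_coord 0 [set 0]).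
exists mu; split.
- rewrite -[LHS]fineK ?fin_num_measure//; last exact: measurable_finitely_determined.
  congr _%:E; rewrite -(cvg_lim _ (cvg_occ _ fz))//.
  under eq_fun do rewrite occupation_origin; exact: lim_cst.
- by move=> t A; exact: ultralimit_invariant.
(* Truncated tail sums converge along [U] and keep their bound; the first moment under [mu] is then
   recovered from them. *)
- move=> x; have [C HC] := occupation_tail_sum iQ x.
  apply: (@finite_expectation_tail _ _ _ _ _ C); first exact: cmeasurable_field_coord.
  move=> K; have cv : \sum_(M < K) occupation Q n [set g | (M < `|g x|)%N] @[n --> U] -->
      \sum_(M < K) fine (mu [set g | (M < `|g x|)%N]).
    apply: (@cvg_sum_ord _ U K (fun M n => occupation Q n [set g | (M < `|g x|)%N])
      (fun M => fine (mu [set g | (M < `|g x|)%N]))).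
    by move=> M; apply: cvg_occ; exact: finitely_determined_tail.
  by rewrite -(cvg_lim _ cv)//; apply: limr_le; [exact: cvgP cv|exact: nearW].
move=> phi aphi.
apply: (field_prob_eq (P := law mu (measurable_transport phi))) => A fA.
change (mu (transport phi @^-1` A) = mu A).
rewrite muE; last exact: finitely_determined_transport.
rewrite muE// /ultralimit; congr (_%:E); congr (lim _).
by under eq_fun do rewrite (occupation_transport iQ aphi)//.
Qed.

(** The gradient of [g \o phi] is a function of [grad g] alone, through [potential]. Hence any [rho]
    with the same gradient law may be replaced by [mu]. *)
Lemma invariant_under_transport {R : realType} {d : nat} (mu : probability (field d) R)
    (phi : site d -> site d) :
  (forall A : set (field d), measurable A -> mu (transport phi @^-1` A) = mu A) ->
  invariant_under (law mu (@measurable_grad d)) phi.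
Proof.
move=> H rho [_ rhoE].
have mgp : measurable_fun setT (fun g : field d => grad (g \o phi)).
  exact: (measurableT_comp (@measurable_grad d) (measurable_precomp phi)).
split => // A mA.
pose B := [set v : gradient_field d | A (grad (potential v \o phi))].
have mB : measurable B.
  by have := measurableT_comp mgp (@measurable_potential d) measurableT mA; rewrite setTI.
have BE (g : field d) : A (grad (g \o phi)) = B (grad g).
  rewrite /B /= (potential_unique erefl).
  by rewrite -[LHS](congr1 A (grad_shift (g \o phi) (- g 0))).
have mgA : measurable (@grad d @^-1` A).
  by rewrite -[_ @^-1` _]setTI; exact: measurable_grad.
transitivity (rho (@grad d @^-1` B)).
  by congr (rho _); apply/seteqP; split => g /=; rewrite BE.
rewrite rhoE// lawE [RHS]lawE -[RHS]H//; congr (mu _); apply/seteqP.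
have E (g : field d) : grad (transport phi g) = grad (g \o phi).
  exact: (grad_shift (g \o phi) (- g (phi 0))).
by split => g /=; rewrite -BE E.
Qed.

Lemma finite_expectation_slope {R : realType} {d : nat} (mu : probability (field d) R) :
  (forall x, finite_expectation mu (fun g => g x)) ->
  forall x i, finite_expectation (law mu (@measurable_grad d)) (fun v => slope v x i).
Proof.
move=> H x i; rewrite /finite_expectation.
have mabs (X : field d -> int) : cmeasurable X ->
    measurable_fun setT (fun g => `|(X g)%:~R : R|%:E).
  exact: (cmeasurable_fun (fun v : int => `|v%:~R : R|%:E)).
have ms := cmeasurable_fun (fun v : int => `|v%:~R : R|%:E) (@cmeasurable_slope d x i).
rewrite (integral_law mu (@measurable_grad d) ms)//.
apply: (@le_lt_trans _ _ (\int[mu]_g (`|(g (x + unit_vec i)%R)%:~R : R|%:E + `|(g x)%:~R : R|%:E))%E).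
  apply: ge0_le_integral => //.
  - exact: (measurableT_comp ms (@measurable_grad d)).
  - by apply: emeasurable_funD; apply: mabs; exact: cmeasurable_field_coord.
  by move=> g _; rewrite slope_grad -EFinD lee_fin intrB; exact: ler_normB.
rewrite ge0_integralD//; [|by apply: mabs; exact: cmeasurable_field_coord..].
by rewrite lte_add_pinfty//; exact: H.
Qed.

Theorem theorem1p1 (R : realType) (d : nat) (hd : (1 <= d)%N)
    (dT : measure_display) (T : measurableType dT) (P : probability T R)
    (gap : site d -> nat -> T -> R) (hgap : poisson_clocks P gap) :
  (time_homogeneous_markov P (w_process gap) /\
   exists mu : probability (field d) R,
     stationary P (w_process gap) mu /\
     forall x : site d, finite_expectation mu (fun g => g x)) /\
  (time_homogeneous_markov P (gradient_process gap) /\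
   exists nu : probability (gradient_field d) R,
     stationary P (gradient_process gap) nu /\
     translation_invariant nu /\
     symmetry_invariant nu /\
     forall (x : site d) (i : 'I_d),
       finite_expectation nu (fun v => slope v x i)) /\
  (forall (mu : probability (field d) R) (nu : probability (gradient_field d) R),
     mu [set g : field d | g 0%R = 0] = 1%E ->
     has_law mu (@grad d) nu ->
     (stationary P (w_process gap) mu <->
      stationary P (gradient_process gap) nu)).
Proof.
have [mu [mu0 inv fin sym]] := exists_invariant (iid_clock_law hgap).
have st := stationary_invariant mu0 inv.
split; first by split; [exact: w_markov|exists mu].
split; last by move=> mu' nu'; exact: stationary_iff.
split; first exact: gradient_markov.
have law_nu : has_law mu (@grad d) (law mu (@measurable_grad d)).
  by split; first exact: measurable_grad.
(* One invariant law of recentred fields serves both processes: its gradient image inherits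
   stationarity, the symmetries and the moment bound. *)
exists (law mu (@measurable_grad d)); split.
  exact/(stationary_iff P gap mu0 law_nu).
split.
  by move=> y; apply/invariant_under_transport/sym; exact: translation_automorphism.
split; last exact: finite_expectation_slope.
by move=> s eps; apply/invariant_under_transport/sym; exact: lattice_symmetry_automorphism.
Qed.
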